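(* For every $n\ge1$, the restriction of $\rho$ is an isomorphism from the weak order on $S_n$ restricted to Baxter permutations to the lattice $\mathrm{dRec}_n$ of diagonal rectangulations of size $n$, with inverse $\beta$.
   Context: Permutations are in one-line notation $x=x_1\cdots x_n\in S_n$. The weak order on $S_n$ is the partial order in which one moves up by a cover by swapping adjacent entries $x_i<x_{i+1}$. Patterns, always with $a<b<c<d$: $x$ contains 3-41-2 if it has a subsequence $c\,d\,a\,b$ with $d$ immediately before $a$ in $x$; 2-41-3 if it has a subsequence $b\,d\,a\,c$ with $d$ immediately before $a$; 3-14-2 if it has a subsequence $c\,a\,d\,b$ with $a$ immediately before $d$. Baxter permutations avoid 3-14-2 and 2-41-3; twisted Baxter permutations avoid 3-41-2 and 2-41-3. Diagonal rectangulations. Let $S$ be a square with sides parallel to the coordinate axes; its diagonal is the interior of the segment from its top-left corner to its bottom-right corner. For a subdivision of $S$ into finitely many (axis-parallel) rectangles, the walls are the maximal line segments contained in the union of the boundaries of the rectangles, excluding the four edges of $S$. For a set $X$ of $n-1$ distinct points on the diagonal, a diagonal rectangulation of $(S,X)$ is a subdivision of $S$ into rectangles such that no two walls intersect in their interiors, every wall contains a point of $X$, and every point of $X$ lies on exactly one wall. Diagonal rectangulations are considered up to dilation or translation of $S$ and order-preserving motion of the points of $X$ along the diagonal (carrying the walls along); an equivalence class is a diagonal rectangulation of size $n$, and it has a unique integral representative, with $S=[0,n]\times[0,n]$ and $X=\{(i,n-i):1\le i\le n-1\}$. $\mathrm{dRec}_n$ is the set of diagonal rectangulations of size $n$, identified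 with their integral representatives. Such a rectangulation has $n$ rectangles, each with interior meeting the diagonal. The map $\rho:S_n\to\mathrm{dRec}_n$. Let $S=[0,n]\times[0,n]$, $p_i=(i,n-i)$ for $0\le i\le n$, and give the space between $p_{k-1}$ and $p_k$ the label $k$. Read $x_1\cdots x_n$ from left to right, drawing one rectangle for each entry. Let $T_{i-1}$ be the union of the left and bottom edges of $S$ and the rectangles drawn in the first $i-1$ steps. In step $i$, put $k=x_i$, $p=p_{k-1}$, $p'=p_k$, and draw the rectangle with the following top-left and bottom-right corners. If $p\notin T_{i-1}$, the top-left corner is the rightmost point of $T_{i-1}$ directly left of $p$; if $p\in T_{i-1}$, it is the highest point of $T_{i-1}$ directly above (or equal to) $p$. If $p'\notin T_{i-1}$, the bottom-right corner is the highest point of $T_{i-1}$ directly below $p'$; if $p'\in T_{i-1}$, it is the rightmost point of $T_{i-1}$ directly right of (or equal to) $p'$. The $n$ rectangles drawn form $\rho(x)$. The lattice $\mathrm{dRec}_n$. The map $\rho$ restricts to a bijection from twisted Baxter permutations in $S_n$ to $\mathrm{dRec}_n$, and its fibers are the classes of a lattice congruence $\Theta_{\mathrm{tB}}$ of the weak order whose minimal class representatives are the twisted Baxter permutations. The order on $\mathrm{dRec}_n$ is that of the quotient lattice of the weak order by $\Theta_{\mathrm{tB}}$; equivalently, $R\le R'$ if and only if $x\le x'$ in the weak order, where $x,x'$ are the twisted Baxter permutations with $\rho(x)=R$, $\rho(x')=R'$. The map $\beta$. Given $R\in\mathrm{dRec}_n$, label its rectangles $1,\dots,n$ in the order in which the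 diagonal meets them from top-left to bottom-right. Order the rectangles as follows. The first rectangle is the one containing the bottom-left corner of $S$. Suppose $i-1\ge1$ rectangles have been chosen, let $U$ be the one chosen in step $i-1$, let $p$ be the top-right corner of $U$, and let $T_{i-1}$ be the union of the rectangles chosen so far with the left and bottom sides of $S$. Follow the boundary of $T_{i-1}$ left from $p$ until it turns upward, and let $U_A$ be the rectangle of $R$ whose bottom-left corner is the point where it turns ($U_A$ is undefined if the top edge of $U$ lies in the boundary of $S$). Follow the boundary of $T_{i-1}$ down from $p$ until it turns towards the right side of $S$, and let $U_B$ be the rectangle whose bottom-left corner is the point where it turns ($U_B$ is undefined if the right edge of $U$ lies in the boundary of $S$). If both the top and right edges of $U$ lie in the boundary of $S$, stop (all rectangles have been chosen). Otherwise exactly three edges of $R$ (edges of rectangles, subdivided at vertices of rectangles) meet at $p$, and the one not opposite another leaves $p$ either to the left ($p$ is a left vertex) or downward ($p$ is a down vertex); choose $U_A$ in step $i$ if $p$ is a left vertex and $U_B$ if $p$ is a down vertex. Then $\beta(R)\in S_n$ is the permutation whose one-line notation lists the labels of the rectangles in the order chosen; it is a Baxter permutation. *)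

(* Defs.v *)
From HB Require Import structures.
From mathcomp Require Import all_boot all_order all_algebra all_fingroup finmap.
From mathcomp Require Import all_classical reals topology normedtype.
Set Implicit Arguments.
Unset Strict Implicit.
Unset Printing Implicit Defensive.
Import Order.TTheory GRing.Theory Num.Theory.
Import numFieldTopology.Exports numFieldNormedType.Exports.
Local Open Scope classical_set_scope.
Local Open Scope ring_scope.

(* Elements of ['S_n] act on [{0, ..., n-1}]; the one-line notation is
   [x 0, ..., x (n-1)] with entries shifted by one ([oneline]).  Conditions
   that only compare entries are stated on the unshifted entries. *)

Definition oneline n (x : 'S_n) : seq nat := [seq (x i).+1 | i <- enum 'I_n].

(* Products in ['S_n] compose left to right: [(tperm i j * x) k] is
   [x (tperm i j k)], so multiplying on the left swaps positions. *)
Definition weak_cover n : rel 'S_n := fun x y =>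
  [exists i : 'I_n, exists j : 'I_n,
    [&& j == i.+1 :> nat, (x i < x j)%N & y == (tperm i j * x)%g]].

Definition weak_le n : rel 'S_n := connect (@weak_cover n).

(* Subsequence [e1 e2 e3 e4] of [x] satisfying [P], with [e2] immediately
   before [e3]. *)
Definition has_pattern n (P : nat -> nat -> nat -> nat -> bool) (x : 'S_n) :=
  [exists i : 'I_n, exists j : 'I_n, exists k : 'I_n, exists l : 'I_n,
    [&& (i < j)%N, k == j.+1 :> nat, (k < l)%N & P (x i) (x j) (x k) (x l)]].

Definition pat_3_41_2 (c d a b : nat) := (a < b < c)%N && (c < d)%N.
Definition pat_2_41_3 (b d a c : nat) := (a < b < c)%N && (c < d)%N.
Definition pat_3_14_2 (c a d b : nat) := (a < b < c)%N && (c < d)%N.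

Definition baxter n (x : 'S_n) :=
  ~~ has_pattern pat_3_14_2 x && ~~ has_pattern pat_2_41_3 x.

Definition twisted_baxter n (x : 'S_n) :=
  ~~ has_pattern pat_3_41_2 x && ~~ has_pattern pat_2_41_3 x.

(* A box is a pair (bottom-left corner, top-right corner).  Boxes represent
   both axis-parallel rectangles and axis-parallel line segments.  No other
   segments are needed: a nondegenerate segment contained in a finite union
   of axis-parallel segments is axis-parallel. *)

Section Geometry.
Variable R : realType.
Local Notation pt := (R * R)%type.
Local Notation box := (pt * pt)%type.
Implicit Types (p q v : pt) (b s w S : box) (D : {fset box}) (A : set pt).

Definition in_box b p : bool :=
  (b.1.1 <= p.1 <= b.2.1) && (b.1.2 <= p.2 <= b.2.2).

Definition box_set b : set pt := [set p | in_box b p].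

Definition is_rect b : bool := (b.1.1 < b.2.1) && (b.1.2 < b.2.2).

Definition rect_interior b : set pt :=
  [set p | (b.1.1 < p.1 < b.2.1) && (b.1.2 < p.2 < b.2.2)].

Definition horizontal s : bool := (s.1.1 < s.2.1) && (s.1.2 == s.2.2).
Definition vertical s : bool := (s.1.1 == s.2.1) && (s.1.2 < s.2.2).
Definition is_segment s : bool := horizontal s || vertical s.

Definition segment_interior s : set pt :=
  [set p | [&& in_box s p, p != s.1 & p != s.2]].

Definition bottom_left b : pt := b.1.
Definition top_right b : pt := b.2.
Definition top_left b : pt := (b.1.1, b.2.2).
Definition bottom_right b : pt := (b.2.1, b.1.2).

Definition corners b : seq pt :=
  [:: bottom_left b; bottom_right b; top_left b; top_right b].

Definition bottom_side b : box := (bottom_left b, bottom_right b).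
Definition top_side b : box := (top_left b, top_right b).
Definition left_side b : box := (bottom_left b, top_left b).
Definition right_side b : box := (bottom_right b, top_right b).

Definition sides b : seq box :=
  [:: bottom_side b; top_side b; left_side b; right_side b].

Definition subdivision S D : Prop :=
  [/\ forall b, b \in D -> is_rect b,
      forall p, in_box S p <-> exists2 b, b \in D & in_box b p
    & forall b c, b \in D -> c \in D -> b != c ->
        rect_interior b `&` rect_interior c = set0].

Definition skeleton D : set pt :=
  [set p | exists2 b, b \in D & has (fun s => in_box s p) (sides b)].

Definition wall S D w : Prop :=
  [/\ is_segment w,
      box_set w `<=` skeleton D,
      forall w', is_segment w' -> box_set w' `<=` skeleton D ->
        box_set w `<=` box_set w' -> w' = w
    & w \notin sides S].

Definition diagonal_rectangulation S (X : {fset pt}) D : Prop :=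
  [/\ subdivision S D,
      forall w w', wall S D w -> wall S D w' -> w <> w' ->
        segment_interior w `&` segment_interior w' = set0,
      forall w, wall S D w -> exists2 p, p \in X & in_box w p
    & forall p, p \in X -> exists! w, wall S D w /\ in_box w p].

(* Diagonal rectangulations of size [n] are identified with their integral
   representatives. *)
Definition square (n : nat) : box := ((0, 0), (n%:R, n%:R)).
Definition diag_pt (n i : nat) : pt := (i%:R, n%:R - i%:R).
Definition diag_pts (n : nat) : {fset pt} :=
  [fset p in [seq diag_pt n i | i <- iota 1 n.-1]]%fset.

Definition dRec (n : nat) : set {fset box} :=
  [set D | diagonal_rectangulation (square n) (diag_pts n) D].

(* Union of the left and bottom sides of the square with the boxes in [rs]. *)
Definition filled (n : nat) (rs : seq box) : set pt :=
  [set p | has (fun b => in_box b p)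
             [:: left_side (square n), bottom_side (square n) & rs]].

(* The default value of [xget] is never used on the sets considered below. *)
Definition rightmost A : pt :=
  xget (0, 0) [set q | A q /\ forall q', A q' -> q'.1 <= q.1].
Definition highest A : pt :=
  xget (0, 0) [set q | A q /\ forall q', A q' -> q'.2 <= q.2].

Definition rho_rect (n : nat) (rs : seq box) (k : nat) : box :=
  let T := filled n rs in
  let p := diag_pt n k.-1 in
  let p' := diag_pt n k in
  let tl := if `[< T p >] then highest [set q | [/\ T q, q.1 = p.1 & p.2 <= q.2]]
            else rightmost [set q | [/\ T q, q.2 = p.2 & q.1 < p.1]] in
  let br := if `[< T p' >] then rightmost [set q | [/\ T q, q.2 = p'.2 & p'.1 <= q.1]]
            else highest [set q | [/\ T q, q.1 = p'.1 & q.2 < p'.2]] in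
  ((tl.1, br.2), (br.1, tl.2)).

Definition rho_seq (n : nat) (ks : seq nat) : seq box :=
  foldl (fun rs k => rcons rs (rho_rect n rs k)) [::] ks.

Definition rho n (x : 'S_n) : {fset box} :=
  [fset b in rho_seq n (oneline x)]%fset.

Definition dRec_le n D D' : Prop :=
  exists x x' : 'S_n, [/\ twisted_baxter x, twisted_baxter x',
    rho x = D, rho x' = D' & weak_le x x'].

(* The point of the diagonal at horizontal distance [t] from the left side is
   [(t, n - t)]. *)
Definition met_before (n : nat) b c : Prop :=
  forall t u : R, rect_interior b (t, n%:R - t) ->
    rect_interior c (u, n%:R - u) -> t < u.

Definition label (n : nat) D b : nat :=
  (#|` [fset c in D | `[< met_before n c b >]]%fset |).+1.

Definition vertex D v : Prop := exists2 b, b \in D & v \in corners b.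

(* Edges are sides of rectangles, subdivided at all vertices. *)
Definition edge D s : Prop :=
  [/\ is_segment s, vertex D s.1 /\ vertex D s.2,
      exists2 b, b \in D &
        exists2 s', s' \in sides b & box_set s `<=` box_set s'
    & forall v, vertex D v -> ~ segment_interior s v].

Definition edge_left D p := exists s, [/\ edge D s, horizontal s & s.2 = p].
Definition edge_right D p := exists s, [/\ edge D s, horizontal s & s.1 = p].
Definition edge_down D p := exists s, [/\ edge D s, vertical s & s.2 = p].
Definition edge_up D p := exists s, [/\ edge D s, vertical s & s.1 = p].

Definition left_vertex D p : Prop :=
  [/\ edge_left D p, edge_up D p, edge_down D p & ~ edge_right D p].
Definition down_vertex D p : Prop :=
  [/\ edge_down D p, edge_left D p, edge_right D p & ~ edge_up D p].

Definition boundary A : set pt := closure A `\` interior A.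

Definition leaves_up A q : Prop :=
  exists2 e : R, 0 < e & box_set (q, (q.1, q.2 + e)) `<=` boundary A.
Definition leaves_right A q : Prop :=
  exists2 e : R, 0 < e & box_set (q, (q.1 + e, q.2)) `<=` boundary A.

(* [q] is the first point where the boundary of [A], followed left from [p],
   turns upward. *)
Definition turn_up A p q : Prop :=
  [/\ q.2 = p.2, q.1 <= p.1, box_set (q, p) `<=` boundary A, leaves_up A q
    & forall q', q'.2 = p.2 -> q.1 < q'.1 <= p.1 -> ~ leaves_up A q'].

(* Likewise, followed down from [p] until it turns to the right. *)
Definition turn_right A p q : Prop :=
  [/\ q.1 = p.1, q.2 <= p.2, box_set (q, p) `<=` boundary A, leaves_right A q
    & forall q', q'.1 = p.1 -> q.2 < q'.2 <= p.2 -> ~ leaves_right A q'].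

(* In the two definitions below, and in [beta_seq], [b] is the rectangle chosen
   last and [rs] lists the rectangles chosen so far, including [b]. *)
Definition rect_A n D (rs : seq box) b : box :=
  xget b [set c | c \in D /\ turn_up (filled n rs) (top_right b) (bottom_left c)].
Definition rect_B n D (rs : seq box) b : box :=
  xget b [set c | c \in D /\ turn_right (filled n rs) (top_right b) (bottom_left c)].

Definition beta_next n D (rs : seq box) b : option box :=
  if ((top_right b).1 == n%:R) && ((top_right b).2 == n%:R) then None
  else if `[< left_vertex D (top_right b) >] then Some (rect_A n D rs b)
  else if `[< down_vertex D (top_right b) >] then Some (rect_B n D rs b)
  else None.

(* [m] bounds the number of further steps. *)
Fixpoint beta_seq n D (m : nat) (rs : seq box) b : seq box :=
  if m isn't m'.+1 then rs else
  if beta_next n D rs b is Some c then beta_seq n D m' (rcons rs c) c else rs.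

Definition beta_first D : box :=
  xget ((0, 0), (0, 0)) [set b | b \in D /\ in_box b (0, 0)].

(* The bound [n] leaves room for one rectangle more than there are, so it never
   stops the procedure prematurely. *)
Definition beta_word n D : seq nat :=
  [seq label n D b | b <- beta_seq n D n [:: beta_first D] (beta_first D)].

(* The permutation with one-line notation [beta_word n D]; the value [1] is a
   default for sets [D] for which there is none. *)
Definition beta n D : 'S_n :=
  odflt 1%g [pick x : 'S_n | oneline x == beta_word n D].

End Geometry.

Arguments dRec R n : clear implicits.
Arguments rho R {n} x.

(* Main.v *)
(* Write l, t, r, s for the left, top, right and bottom sides of the rectangle
   which rho draws for the label k of x: l (t) is the largest j < k standing
   before (after) k in x, and r + 1 (s + 1) is the smallest j > k standing after
   (before) k.  Hence the unit cell in column i and row j <= i lies in the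
   rectangle of the last label of [j, i] to occur in x, and the cell with i < j in
   that of the first label of [i, j]: the rectangles tile the n x n grid, and each
   contains one diagonal cell.  Conversely every diagonal rectangulation is such a
   tiling: a side of a rectangle lies in a wall, which meets the diagonal, so a
   rectangle missing the diagonal would make two walls cross at its corner.

   A word is Baxter if and only if each entry fills a gap (a maximal interval of
   missing labels) next to the block of labels containing the previous entry.
   Filling such gaps greedily, on the side dictated by the wall that ends at the
   top-right corner of the last rectangle, realizes every tiling by a Baxter word;
   this is the procedure beta.

   For the order, consider the inversions d ... a (a < d) for which all values
   between a and d precede a, or all of them follow d.  They depend only on
   rho(x), increase with x, and generate all inversions when x is twisted Baxter.
   For Baxter words x and y the same inversions decide whether x <= y: a pair of
   minimal width inverted in x but not in y would contain a narrower one. *)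
Require Import Defs.
From HB Require Import structures.
From mathcomp Require Import all_boot all_order all_algebra all_fingroup finmap.
From mathcomp Require Import all_classical reals topology normedtype.
From mathcomp Require Import zify lra.

Set Implicit Arguments.
Unset Strict Implicit.
Unset Printing Implicit Defensive.

(** Two obstacles shape the argument. Equality of corners is awkward to prove directly, since every
    side is a nearest label of some kind; but if each rectangle of one tiling lies inside the
    equally labelled rectangle of another, the tilings coincide ([tiling_sub]). So one inequality
    per side suffices, both for the greedy word and for the swaps that lead to twisted Baxter words.
    And [beta], a procedure on real geometry, is hard to follow on an arbitrary rectangulation;
    surjectivity of [rho] on Baxter permutations is therefore derived from tilings alone, and [beta]
    is only followed on [rho R x] with [x] Baxter, where all coordinates are read off [oneline x].
    Injectivity then comes from [beta n (rho R x) = x]. Since [dRec_le] compares representatives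
    other than the Baxter ones, the weak order is handled as inclusion of inversions, part of which
    is visible in the rectangles. *)

Section Nearest.
Implicit Types (P : pred nat) (j k m : nat).

(** Without a positive solution the value is 0, the left or top side of the square. [above] stops
    one before the first solution (at [m] if there is none), because label [e] occupies the diagonal
    between the points [e - 1] and [e]. *)
Definition below P k := \max_(j < k | P j) j.
Definition above P m k := k + find P (iota k.+1 (m - k)).

Lemma below_ltP P k j : 0 < j ->
  below P k < j <-> forall e, j <= e < k -> ~~ P e.
Proof.
move=> j0; split=> [lt_j e /andP[je ek]|H].
  apply/negP => Pe; have := @leq_bigmax_cond _ (fun i : 'I_k => P i) (@nat_of_ord k) (Ordinal ek) Pe.
  by rewrite -/(below P k) /=; lia.
apply: (big_ind (fun z => z < j)) => // [x y|[i ik] /= Pi]; first by lia.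
by rewrite ltnNge; apply/negP => ji; have := H i; rewrite ji ik Pi => /(_ isT).
Qed.

Lemma below_lt P k : 0 < k -> below P k < k.
Proof. by move=> k0; apply/below_ltP => // e; lia. Qed.

Lemma below_in P k : 0 < below P k -> P (below P k).
Proof.
move=> b0; apply/negPn/negP => Pb.
suff : below P k < below P k by lia.
apply/below_ltP => // e /andP[be ek]; case: (ltngtP (below P k) e) be => // [lt|<-] _ //.
by move: lt => /[dup] lt /(below_ltP P k (ltn_trans b0 lt) ).1; apply; lia.
Qed.

Lemma above_ge P m k : k <= above P m k.
Proof. by rewrite /above; lia. Qed.

Lemma above_le P m k : k <= m -> above P m k <= m.
Proof.
by move=> km; rewrite /above; have := find_size P (iota k.+1 (m - k)); rewrite size_iota; lia.
Qed.

Lemma above_geP P m k j : k <= j <= m ->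
  j <= above P m k <-> forall e, k < e <= j -> ~~ P e.
Proof.
move=> /andP[kj jm]; split=> [le_j e /andP[ke ej]|H].
  have := @before_find _ 0 P (iota k.+1 (m - k)) (e - k.+1).
  by rewrite nth_iota ?subnKC // => [->//|]; rewrite /above in le_j; lia.
rewrite leqNgt; apply/negP => lt_j.
have hs : find P (iota k.+1 (m - k)) < m - k by rewrite /above in lt_j; lia.
have := @nth_find _ 0 P (iota k.+1 (m - k)); rewrite has_find size_iota nth_iota // => /(_ hs).
by apply/negP/H; rewrite /above in lt_j; lia.
Qed.

Lemma above_in P m k : k <= m -> above P m k < m -> P (above P m k).+1.
Proof.
move=> km lt_m.
have hs : find P (iota k.+1 (m - k)) < m - k by rewrite /above in lt_m; lia.
by have := @nth_find _ 0 P (iota k.+1 (m - k)); rewrite has_find size_iota nth_iota // => /(_ hs).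
Qed.

End Nearest.

(** * Words and the sides of their rectangles *)

Definition word n (w : seq nat) := perm_eq w (iota 1 n).
(* A label absent from [w] comes after all labels of [w]; in particular so do [0]
   and [n.+1]. *)
Definition bef (w : seq nat) j k := index j w < index k w.

(* The sides of the rectangle drawn for [k]: its corners are at the points
   [(lft w k, n - bot w k)] and [(rgt w k, n - top w k)]. *)
Definition lft w k := below (bef w ^~ k) k.
Definition top w k := below (bef w k) k.
Definition rgt w k := above (bef w k) (size w) k.
Definition bot w k := above (bef w ^~ k) (size w) k.

(* [lia] would split on the disjunctions and truth values in the context and
   reify the inequalities between reals. *)
Ltac nlia := first
  [ solve [repeat match goal with
             | H : _ \/ _ |- _ => clear H
             | H : ~ (_ \/ _) |- _ => clear H
             | H : is_true (bef _ _ _) |- _ => clear H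
             | H : is_true (_ \in _) |- _ => clear H
             | H : is_true (_ \notin _) |- _ => clear H
             | H : is_true (@Order.le _ _ _ _) |- _ => clear H
             | H : is_true (@Order.lt _ _ _ _) |- _ => clear H
             | H : context [@GRing.natmul _ _ _] |- _ => clear H
           end; lia]
  | lia ].

Lemma bef_asym w j k : bef w j k -> ~~ bef w k j.
Proof. by rewrite /bef; lia. Qed.

Lemma bef_trans w j k m : bef w j k -> bef w k m -> bef w j m.
Proof. exact: ltn_trans. Qed.

Section Word.
Variables (n : nat) (w : seq nat).
Hypothesis w_word : word n w.

Lemma word_size : size w = n.
Proof. by rewrite (perm_size w_word) size_iota. Qed.

Lemma word_uniq : uniq w.
Proof. by rewrite (perm_uniq w_word) iota_uniq. Qed.

Lemma word_mem k : (k \in w) = (0 < k <= n).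
Proof. by rewrite (perm_mem w_word) mem_iota add1n ltnS. Qed.

Lemma bef_neg j k : 0 < j <= n -> j <> k -> ~~ bef w j k = bef w k j.
Proof.
rewrite -word_mem => jw jk; rewrite /bef -leqNgt leq_eqVlt.
case: eqP => //= eq_i; case: jk.
have kw : k \in w by rewrite -index_mem eq_i index_mem.
by rewrite -(nth_index 0 jw) -(nth_index 0 kw) eq_i.
Qed.

Lemma bef_negr j k : 0 < k <= n -> j <> k -> ~~ bef w j k = bef w k j.
Proof. by move=> kw jk; rewrite -(@bef_neg k j) ?negbK //; apply/nesym. Qed.

Lemma bef_memr j k : 0 < k <= n -> bef w j k -> 0 < j <= n.
Proof.
rewrite -!word_mem -!index_mem /bef => kw jk; exact: ltn_trans jk kw.
Qed.

Lemma bef_out j k : 0 < k <= n -> ~~ (0 < j <= n) -> bef w k j.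
Proof.
by rewrite -!word_mem -!index_mem /bef -leqNgt; apply: leq_trans.
Qed.

Variable k : nat.
Hypothesis k_in : 0 < k <= n.
Let k0 : 0 < k. Proof. by case/andP: k_in. Qed.
Let kn : k <= n. Proof. by case/andP: k_in. Qed.

Lemma lft_lt : lft w k < k. Proof. exact: below_lt. Qed.
Lemma top_lt : top w k < k. Proof. exact: below_lt. Qed.
Lemma rgt_ge : k <= rgt w k. Proof. exact: above_ge. Qed.
Lemma bot_ge : k <= bot w k. Proof. exact: above_ge. Qed.
Lemma rgt_le : rgt w k <= n. Proof. by rewrite /rgt word_size above_le. Qed.
Lemma bot_le : bot w k <= n. Proof. by rewrite /bot word_size above_le. Qed.

(** A bound on a side amounts to [k] preceding, or following, a whole interval of labels next to it;
    later arguments use the sides mostly in this form. *)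
Lemma lftP j : 0 < j -> lft w k < j <-> forall e, j <= e < k -> bef w k e.
Proof.
move=> j0; rewrite /lft below_ltP //; split=> H e he; have := H e he;
  by rewrite bef_negr //; lia.
Qed.

Lemma topP j : 0 < j -> top w k < j <-> forall e, j <= e < k -> bef w e k.
Proof.
move=> j0; rewrite /top below_ltP //; split=> H e he; have := H e he;
  by rewrite bef_neg //; lia.
Qed.

Lemma rgtP j : k <= j <= n -> j <= rgt w k <-> forall e, k < e <= j -> bef w e k.
Proof.
move=> kj; rewrite /rgt above_geP ?word_size //; split=> H e he; have := H e he;
  by rewrite bef_neg //; lia.
Qed.

Lemma botP j : k <= j <= n -> j <= bot w k <-> forall e, k < e <= j -> bef w k e.
Proof.
move=> kj; rewrite /bot above_geP ?word_size //; split=> H e he; have := H e he;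
  by rewrite bef_negr //; lia.
Qed.

Lemma bef_lft : 0 < lft w k -> bef w (lft w k) k.
Proof. exact: (@below_in (bef w ^~ k)). Qed.
(** The labels 0 and [n.+1] count as later than [k], so the top and right sides need no exception at
    the border of the square. The left and bottom sides, where the stopping label precedes [k],
    do. *)
Lemma bef_top : bef w k (top w k).
Proof.
have [/eqP t0|t0] := posnP (top w k); last exact: (@below_in (bef w k)).
by rewrite (eqP t0) bef_out.
Qed.
Lemma bef_rgt : bef w k (rgt w k).+1.
Proof.
have := rgt_le; rewrite leq_eqVlt => /orP[/eqP->|lt]; first by rewrite bef_out //; lia.
by have := @above_in (bef w k) (size w) k; rewrite -/(rgt w k) word_size; apply.
Qed.
Lemma bef_bot : bot w k < n -> bef w (bot w k).+1 k.
Proof.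
by have := @above_in (bef w ^~ k) (size w) k; rewrite -/(bot w k) word_size; apply.
Qed.

Lemma lft_bef e : lft w k < e < k -> bef w k e.
Proof. by move=> /andP[le ek]; apply: ((@lftP e ltac:(lia)).1 le e); lia. Qed.
Lemma top_bef e : top w k < e < k -> bef w e k.
Proof. by move=> /andP[le ek]; apply: ((@topP e ltac:(lia)).1 le e); lia. Qed.
Lemma rgt_bef e : k < e <= rgt w k -> bef w e k.
Proof.
by move=> /andP[ke er]; have := rgt_le => le; have kn' := kn; apply: ((@rgtP e ltac:(lia)).1 er e); lia.
Qed.
Lemma bot_bef e : k < e <= bot w k -> bef w k e.
Proof.
by move=> /andP[ke er]; have := bot_le => le; have kn' := kn; apply: ((@botP e ltac:(lia)).1 er e); lia.
Qed.

End Word.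

(** * Tilings of the grid *)

(* Cells of the [n] by [n] grid are indexed by column, from the left, and row,
   from the top, both starting at [1]. *)
Definition in_cell (l t r s : nat -> nat) k i j :=
  (l k < i <= r k) && (t k < j <= s k).

(** The first clause puts the diagonal cell [(k, k)] into rectangle [k], which fixes the
    labelling. *)
Definition tiling n (l t r s : nat -> nat) :=
  [/\ forall k, 0 < k <= n -> [/\ l k < k, t k < k, k <= r k <= n & k <= s k <= n],
      forall i j, 0 < i <= n -> 0 < j <= n ->
        exists2 k, 0 < k <= n & in_cell l t r s k i j
    & forall i j a b, 0 < a <= n -> 0 < b <= n ->
        in_cell l t r s a i j -> in_cell l t r s b i j -> a = b].

(** A cell of the unprimed rectangle [k] is covered by some primed [k'], hence also by the unprimed
    [k'], and disjointness gives [k' = k]. So no primed rectangle can be strictly smaller. *)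
Lemma tiling_sub n l t r s l' t' r' s' :
  tiling n l t r s -> tiling n l' t' r' s' ->
  (forall k, 0 < k <= n -> [/\ l k <= l' k, t k <= t' k, r' k <= r k & s' k <= s k]) ->
  forall k, 0 < k <= n -> [/\ l k = l' k, t k = t' k, r k = r' k & s k = s' k].
Proof.
move=> [bd _ inj] [bd' cov' _] sub k k_in.
have eq_k i j : 0 < i <= n -> 0 < j <= n -> in_cell l t r s k i j ->
    in_cell l' t' r' s' k i j.
  move=> i_in j_in cij; have [k' k'_in c'ij] := cov' _ _ i_in j_in.
  suff -> : k = k' by [].
  apply: (inj i j) => //; have [? ? ? ?] := sub _ k'_in; move: c'ij; rewrite /in_cell; lia.
have [? ? ? ?] := bd _ k_in; have [? ? ? ?] := bd' _ k_in.
have [? ? ? ?] := sub _ k_in.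
(* Each strict inequality is refuted by a cell in row or column [k] that the larger rectangle would
   contain and the smaller one would not. *)
have e1 := eq_k (l' k) k; have e2 := eq_k k (t' k).
have e3 := eq_k (r k) k; have e4 := eq_k k (s k).
rewrite /in_cell in e1 e2 e3 e4; split; lia.
Qed.

Section WordTiling.
Variables (n : nat) (w : seq nat).
Hypothesis w_word : word n w.

Lemma last_in_interval a b : 0 < a <= b -> b <= n ->
  exists2 k, a <= k <= b & forall e, a <= e <= b -> e <> k -> bef w e k.
Proof.
elim: b => [|b IH] ab bn; first lia.
have [ab1|ab1] := ltnP b a; first by exists b.+1 => [|e]; lia.
have [k kin kl] := IH ltac:(lia) ltac:(lia).
have [kb|] := boolP (bef w k b.+1).
  exists b.+1 => [|e ein eb]; first lia.
  have [->//|/eqP ek] := eqVneq e k.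
  by apply: (bef_trans _ kb); apply: kl; lia.
rewrite (bef_neg w_word); [|lia|lia] => bk; exists k; first lia.
move=> e ein ek; have [->//|/eqP eb] := eqVneq e b.+1.
by apply: kl; lia.
Qed.

Lemma first_in_interval a b : 0 < a <= b -> b <= n ->
  exists2 k, a <= k <= b & forall e, a <= e <= b -> e <> k -> bef w k e.
Proof.
elim: b => [|b IH] ab bn; first lia.
have [ab1|ab1] := ltnP b a; first by exists b.+1 => [|e]; lia.
have [k kin kl] := IH ltac:(lia) ltac:(lia).
have [kb|] := boolP (bef w b.+1 k).
  exists b.+1 => [|e ein eb]; first lia.
  have [->//|/eqP ek] := eqVneq e k.
  by apply: (bef_trans kb); apply: kl; lia.
rewrite (bef_neg w_word); [|lia|lia] => bk; exists k; first lia.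
move=> e ein ek; have [->//|/eqP eb] := eqVneq e b.+1.
by apply: kl; lia.
Qed.

Local Notation cell := (in_cell (lft w) (top w) (rgt w) (bot w)).

(** If [k < j], the rectangle would extend beyond [k] both to the right and downwards, so [k.+1]
    would stand both before and after [k]; if [k > i], the same happens to [k.-1]. *)
Lemma cell_last k i j : 0 < k <= n -> 0 < j <= i -> i <= n ->
  cell k i j <-> j <= k <= i /\ forall e, j <= e <= i -> e <> k -> bef w e k.
Proof.
move=> k_in ji i_n; split=> [/andP[/andP[li ir] /andP[tj jb]]|[jk H]].
  have kj : j <= k.
    rewrite leqNgt; apply/negP => kj.
    have b1 := rgt_bef w_word k_in (_ : k < k.+1 <= rgt w k).
    have b2 := bot_bef w_word k_in (_ : k < k.+1 <= bot w k).
    by have := bef_asym (b1 ltac:(lia)); rewrite b2 //; lia.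
  have ki : k <= i.
    rewrite leqNgt; apply/negP => ki.
    have b1 := lft_bef w_word k_in (_ : lft w k < k.-1 < k).
    have b2 := top_bef w_word k_in (_ : top w k < k.-1 < k).
    by have := bef_asym (b1 ltac:(lia)); rewrite b2 //; lia.
  split=> [|e eji ek]; first lia.
  by have [ke|ke] := ltnP k e; [apply: (rgt_bef w_word k_in)|apply: (top_bef w_word k_in)]; lia.
have := lft_lt w k_in; have := bot_ge w k.
have : i <= rgt w k by apply/(rgtP w_word k_in) => [|e he]; [lia|apply: H; lia].
have : top w k < j by apply/(topP w_word k_in) => [|e he]; [lia|apply: H; lia].
rewrite /in_cell; lia.
Qed.

Lemma cell_first k i j : 0 < k <= n -> 0 < i <= j -> j <= n ->
  cell k i j <-> i <= k <= j /\ forall e, i <= e <= j -> e <> k -> bef w k e.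
Proof.
move=> k_in ji i_n; split=> [/andP[/andP[li ir] /andP[tj jb]]|[jk H]].
  have kj : i <= k.
    rewrite leqNgt; apply/negP => kj.
    have b1 := rgt_bef w_word k_in (_ : k < k.+1 <= rgt w k).
    have b2 := bot_bef w_word k_in (_ : k < k.+1 <= bot w k).
    by have := bef_asym (b1 ltac:(lia)); rewrite b2 //; lia.
  have ki : k <= j.
    rewrite leqNgt; apply/negP => ki.
    have b1 := lft_bef w_word k_in (_ : lft w k < k.-1 < k).
    have b2 := top_bef w_word k_in (_ : top w k < k.-1 < k).
    by have := bef_asym (b1 ltac:(lia)); rewrite b2 //; lia.
  split=> [|e eji ek]; first lia.
  by have [ke|ke] := ltnP k e; [apply: (bot_bef w_word k_in)|apply: (lft_bef w_word k_in)]; lia.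
have := top_lt w k_in; have := rgt_ge w k.
have : j <= bot w k by apply/(botP w_word k_in) => [|e he]; [lia|apply: H; lia].
have : lft w k < i by apply/(lftP w_word k_in) => [|e he]; [lia|apply: H; lia].
rewrite /in_cell; lia.
Qed.

Lemma word_tiling : tiling n (lft w) (top w) (rgt w) (bot w).
Proof.
split=> [k k_in|i j i_in j_in|i j a b a_in b_in].
- have := lft_lt w k_in; have := top_lt w k_in; have := rgt_ge w k.
  have := bot_ge w k; have := rgt_le w_word k_in; have := bot_le w_word k_in.
  by split; lia.
- case: (leqP j i) => ij.
    have [k kin H] := @last_in_interval j i ltac:(lia) ltac:(lia).
    by exists k; [lia|apply/cell_last => //; lia].
  have [k kin H] := @first_in_interval i j ltac:(lia) ltac:(lia).
  by exists k; [lia|apply/cell_first => //; lia].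
- have [// /eqP nab ca cb|/eqP nab ca cb] := eqVneq a b.
  have rin : rgt w a <= n := rgt_le w_word a_in.
  have sin : bot w a <= n := bot_le w_word a_in.
  case: (leqP j i) => ij.
    have := ca; have := cb; rewrite {1 2}/in_cell => ? ?.
    move: ca cb => /cell_last-[] //; [lia|lia|] => ak Ha /cell_last-[] //; [lia|lia|] => bk Hb.
    by have := bef_asym (Ha b ltac:(lia) ltac:(lia)); rewrite Hb //; lia.
  have := ca; have := cb; rewrite {1 2}/in_cell => ? ?.
  move: ca cb => /cell_first-[] //; [lia|lia|] => ak Ha /cell_first-[] //; [lia|lia|] => bk Hb.
  by have := bef_asym (Ha b ltac:(lia) ltac:(lia)); rewrite Hb //; lia.
Qed.

End WordTiling.

(** * Weak order on words *)

Definition adjacent (w : seq nat) d a := index a w = (index d w).+1.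

(** The first conclusion excludes 3-14-2, the second 2-41-3. The bound [f <= n] keeps out labels
    above [n], which count as following every entry. *)
Definition baxter_word n (w : seq nat) := forall e d a f, f <= n ->
  bef w e d -> adjacent w d a -> bef w a f ->
  (d < f < e -> e < a -> False) /\ (a < e < f -> f < d -> False).

(** The patterns 3-41-2 and 2-41-3 differ only in the relative size of [e] and [f], which is left
    open here. *)
Definition tb_word n (w : seq nat) := forall e d a f, f <= n ->
  bef w e d -> adjacent w d a -> bef w a f ->
  a < e < d -> a < f < d -> False.

(** Inclusion of inversion sets, the classical description of the weak order; see [weak_leP]. *)
Definition inv_sub n (w v : seq nat) :=
  forall a d, 0 < a < d -> d <= n -> bef w d a -> bef v d a.

Definition same_boxes n (w v : seq nat) := forall k, 0 < k <= n ->
  [/\ lft w k = lft v k, top w k = top v k, rgt w k = rgt v k & bot w k = bot v k].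

Lemma nat_switch (Q : pred nat) i j : i < j -> Q i -> ~~ Q j ->
  exists m, [/\ i <= m < j, Q m & ~~ Q m.+1].
Proof.
elim: j => // j IH ij Qi Qj; have [Qm|Qm] := boolP (Q j).
  by exists j; split=> //; lia.
have [ij'|ij'] := ltnP i j.
  by have [m [? ? ?]] := IH ij' Qi Qm; exists m; split=> //; lia.
by move: Qm; rewrite (_ : j = i) ?Qi //; lia.
Qed.

Lemma inv_subW n w v : word n w -> word n v -> inv_sub n w v ->
  (forall a d, 0 < a < d -> d <= n -> bef v a d -> bef w a d).
Proof.
move=> ww wv sub a d ad dn avd.
have a_in : 0 < a <= n by lia.
have ad' : a <> d by lia.
apply/negPn/negP; rewrite (bef_neg ww a_in ad') => wda.
by have := sub _ _ ad dn wda; apply/negP/bef_asym.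
Qed.

Section WordOrder.
Variables (n : nat) (w : seq nat).
Hypothesis w_word : word n w.

(** A discrete intermediate value argument along the word. It supplies the adjacent pair that the
    patterns ask for. *)
Lemma word_switch (Q : pred nat) u v : 0 < v <= n -> bef w u v -> Q u -> ~~ Q v ->
  exists z z', [/\ 0 < z <= n /\ 0 < z' <= n, adjacent w z z', Q z /\ ~~ Q z',
    index u w <= index z w & index z' w <= index v w].
Proof.
move=> v_in uv Qu Qv; have u_in := bef_memr w_word v_in uv.
have [uw vw] : u \in w /\ v \in w by rewrite !(word_mem w_word).
have vs : index v w < size w by rewrite index_mem.
have [m [im Qm Qm1]] := @nat_switch (fun i => Q (nth 0 w i)) _ _ uv
  ltac:(by rewrite /= nth_index) ltac:(by rewrite /= nth_index).
have ms : m < size w by lia.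
have ms1 : m.+1 < size w by lia.
exists (nth 0 w m), (nth 0 w m.+1); rewrite /adjacent -!(word_mem w_word).
by rewrite !mem_nth // !index_uniq ?(word_uniq w_word) //; split=> //; lia.
Qed.

Lemma lt_rgt_bef a d : 0 < a < d -> d <= n -> d <= rgt w a -> bef w d a.
Proof. by move=> ad dn H; apply: (rgt_bef w_word); lia. Qed.

Lemma lft_lt_bef a d : 0 < a < d -> d <= n -> lft w d < a -> bef w d a.
Proof. by move=> ad dn H; apply: (lft_bef w_word); lia. Qed.

Lemma lt_bot_bef a d : 0 < a < d -> d <= n -> d <= bot w a -> bef w a d.
Proof. by move=> ad dn H; apply: (bot_bef w_word); lia. Qed.

Lemma top_lt_bef a d : 0 < a < d -> d <= n -> top w d < a -> bef w a d.
Proof. by move=> ad dn H; apply: (top_bef w_word); lia. Qed.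

(* The inversions [(a, d)] in the hypothesis on [v], those for which every value
   between [a] and [d] precedes [a] or every such value follows [d], depend only
   on the boxes; they generate all inversions of [w] under transitivity. *)
Lemma tb_inv_sub v : tb_word n w -> word n v ->
  (forall a d, 0 < a < d -> d <= n -> d <= rgt w a \/ lft w d < a -> bef v d a) ->
  inv_sub n w v.
Proof.
move=> tb v_word base a d.
have [m] := ubnP (index a w - index d w); elim: m a d => // m IH a d sz ad dn da.
have [e /andP[/andP[ae ed] /andP[de ea]]|none] :=
    @pickP 'I_n.+1 (fun e => (a < e < d) && (bef w d e && bef w e a)).
  rewrite /bef in da de ea sz.
  by apply: (@bef_trans _ _ e); apply: IH => //; rewrite /bef; lia.
have between e : a < e < d -> bef w e d \/ bef w a e.
  move=> aed; have en : e < n.+1 by lia.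
  have := none (Ordinal en) => /=; rewrite aed /=.
  have [ed|] := boolP (bef w e d); first by left.
  rewrite (bef_neg w_word); [|lia|lia] => -> /= /negbT.
  by rewrite (bef_neg w_word); [right|lia|lia].
have [z [z' [[z_in z'_in] zz' [/= dz dz'] iz iz']]] :=
  @word_switch (leq d) d a ltac:(lia) da (leqnn d) ltac:(lia).
have {dz'} az' : z' <= a.
  rewrite leqNgt; apply/negP => az'; have := @between z' ltac:(lia).
  rewrite /adjacent in zz'; rewrite /bef; lia.
apply: base => //.
have [/existsP[e /andP[aed ed]]|/existsPn H] :=
    boolP [exists e : 'I_n.+1, (a < e < d) && bef w e d]; last first.
  right; apply/(lftP w_word) => [||e he]; [lia|lia|].
  have [->//|/eqP ae] := eqVneq e a; have en : e < n.+1 by lia.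
  have := H (Ordinal en); rewrite /= (_ : a < e < d) /=; last lia.
  by rewrite (bef_neg w_word) //; lia.
(* Here [e] precedes [d], so a value [f] following [a] would complete the forbidden pattern
   [e z z' f]; hence all values in between precede [a]. *)
left; apply/(rgtP w_word) => [||f hf]; [lia|lia|].
have [->//|/eqP fd] := eqVneq f d.
have [fd'|af] := @between f ltac:(lia); first exact: (bef_trans fd' da).
exfalso; apply: (tb e z z' f _ _ zz'); rewrite /bef in ed af *; lia.
Qed.

(** As no intermediate value stands between [d] and [a] in the word, some adjacent [z z'] there
    drops from at least [d] to at most [a]. With [e < f], the entries [e z z' f] would form
    2-41-3. *)
Lemma baxter_split_inv a d : baxter_word n w -> 0 < a < d -> d <= n -> bef w d a ->
  (forall e, a < e < d -> bef w e d \/ bef w a e) ->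
  forall e f, a < e < d -> a < f < d -> bef w e d -> bef w a f -> f <= e.
Proof.
move=> bx ad dn da between e f he hf ed af.
have [z [z' [[z_in z'_in] zz' [/= dz dz'] iz iz']]] :=
  @word_switch (leq d) d a ltac:(lia) da (leqnn d) ltac:(lia).
have {dz'} az' : z' <= a.
  rewrite leqNgt; apply/negP => az'; have := @between z' ltac:(lia).
  rewrite /adjacent in zz'; rewrite /bef; lia.
rewrite leqNgt; apply/negP => ef.
by have [_] := bx e z z' f ltac:(lia) ltac:(rewrite /bef in ed *; lia) zz'
  ltac:(rewrite /bef in af *; lia); apply; lia.
Qed.

(** Mirror image of [baxter_split_inv]: the adjacent pair jumps from at most [a] to at least [d],
    and the pattern excluded is 3-14-2. *)
Lemma baxter_split_noninv a d : baxter_word n w -> 0 < a < d -> d <= n -> bef w a d ->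
  (forall e, a < e < d -> bef w e a \/ bef w d e) ->
  forall e f, a < e < d -> a < f < d -> bef w e a -> bef w d f -> e <= f.
Proof.
move=> bx ad dn da between e f he hf ea df.
have [z [z' [[z_in z'_in] zz' [/= az az'] iz iz']]] :=
  @word_switch (fun z => z <= a) a d ltac:(lia) da (leqnn a) ltac:(lia).
have {az'} dz' : d <= z'.
  rewrite leqNgt; apply/negP => dz'; have := @between z' ltac:(lia).
  rewrite /adjacent in zz'; rewrite /bef; lia.
rewrite leqNgt; apply/negP => ef.
by have [+ _] := bx e z z' f ltac:(lia) ltac:(rewrite /bef in ea *; lia) zz'
  ltac:(rewrite /bef in df *; lia); apply; lia.
Qed.

End WordOrder.

(** Induction on the width [d - a]. The two hypotheses concern only pairs whose intermediate values
    are all on one side: such inversions of [w] are inversions of [v], and such non-inversions of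
    [v] are non-inversions of [w]. *)
Lemma baxter_inv_sub n w v : word n w -> word n v ->
  baxter_word n w -> baxter_word n v ->
  (forall a d, 0 < a < d -> d <= n -> d <= rgt w a \/ lft w d < a -> bef v d a) ->
  (forall a d, 0 < a < d -> d <= n -> d <= bot v a \/ top v d < a -> bef w a d) ->
  inv_sub n w v.
Proof.
move=> ww wv bw bv B C a d.
have [m] := ubnP (d - a); elim: m a d => // m IH a d sz ad dn wda.
have a_in : 0 < a <= n by nlia.
have d_in : 0 < d <= n by nlia.
apply/negPn/negP; rewrite (bef_neg wv d_in) => [vad|]; last nlia.
have btw e : a < e < d -> bef w e d \/ bef w a e.
  move=> aed; have [ed|] := boolP (bef w e d); first by left.
  rewrite (bef_neg ww) => [de||]; [|nlia|nlia].
  right; apply/negPn/negP; rewrite (bef_neg ww) => [ea||]; [|nlia|nlia].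
  have := bef_trans (IH e d ltac:(nlia) ltac:(nlia) dn de) (IH a e ltac:(nlia) ltac:(nlia) ltac:(nlia) ea).
  by apply/negP/bef_asym.
have btv e : a < e < d -> bef v e a \/ bef v d e.
  move=> aed; have [ed|] := boolP (bef v e a); first by left.
  rewrite (bef_neg wv) => [ae||]; [|nlia|nlia].
  right; apply/negPn/negP; rewrite (bef_neg wv) => [ed||]; [|nlia|nlia].
  have wae : bef w a e.
    apply/negPn/negP; rewrite (bef_neg ww) => [ea||]; [|nlia|nlia].
    by have := IH a e ltac:(nlia) ltac:(nlia) ltac:(nlia) ea; apply/negP/bef_asym.
  have wed : bef w e d.
    apply/negPn/negP; rewrite (bef_neg ww) => [ea||]; [|nlia|nlia].
    by have := IH e d ltac:(nlia) ltac:(nlia) ltac:(nlia) ea; apply/negP/bef_asym.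
  by have := bef_trans wae wed; apply/negP/bef_asym.
have sw := baxter_split_inv ww bw ad dn wda btw.
have sv := baxter_split_noninv wv bv ad dn vad btv.
have nB : ~ (d <= rgt w a \/ lft w d < a).
  by move=> /(B _ _ ad dn); apply/negP/bef_asym.
have nC : ~ (d <= bot v a \/ top v d < a).
  by move=> /(C _ _ ad dn); apply/negP/bef_asym.
have w1 e : a < e < d -> ~ (forall f, a < f < d -> bef w f d).
  move=> he H; apply: nB; left; apply/(rgtP ww a_in) => [|f hf]; first nlia.
  by have [->//|/eqP fd] := eqVneq f d; apply: bef_trans wda; apply: H; nlia.
have w2 e : a < e < d -> ~ (forall f, a < f < d -> bef w a f).
  move=> he H; apply: nB; right; apply/(lftP ww d_in) => [|f hf]; first nlia.
  by have [->//|/eqP fd] := eqVneq f a; apply: (bef_trans wda); apply: H; nlia.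
have v1 e : a < e < d -> ~ (forall f, a < f < d -> bef v d f).
  move=> he H; apply: nC; left; apply/(botP wv a_in) => [|f hf]; first nlia.
  by have [->//|/eqP fd] := eqVneq f d; apply: (bef_trans vad); apply: H; nlia.
have v2 e : a < e < d -> ~ (forall f, a < f < d -> bef v f a).
  move=> he H; apply: nC; right; apply/(topP wv d_in) => [|f hf]; first nlia.
  by have [->//|/eqP fd] := eqVneq f a; apply: bef_trans vad; apply: H; nlia.
have [ad1|ad1] := eqVneq a.+1 d.
  apply: nB; left; apply/(rgtP ww a_in) => [|f hf]; first nlia.
  by rewrite (_ : f = d) //; nlia.
(* In [w] the values following [a] form a lower class of []a, d[] and those preceding [d] an upper
   class; in [v] the values preceding [a] are the lower class and those following [d] the upper one.
   None of these classes is empty, which locates [a.+1] and [d.-1] in both words. *)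
have wa : bef w a a.+1.
  have [ad'|//] := btw a.+1 ltac:(nlia); case: (w1 a.+1); first nlia.
  move=> f hf; have [//|af] := btw f hf.
  by rewrite (_ : f = a.+1) //; have := sw a.+1 f ltac:(nlia) hf ad' af; nlia.
have wd : bef w d.-1 d.
  have [//|ad'] := btw d.-1 ltac:(nlia); case: (w2 d.-1); first nlia.
  move=> f hf; have [fd|//] := btw f hf.
  by rewrite (_ : f = d.-1) //; have := sw f d.-1 hf ltac:(nlia) fd ad'; nlia.
have va : bef v a.+1 a.
  have [//|ad'] := btv a.+1 ltac:(nlia); case: (v1 a.+1); first nlia.
  move=> f hf; have [fa|//] := btv f hf.
  by rewrite (_ : f = a.+1) //; have := sv f a.+1 hf ltac:(nlia) fa ad'; nlia.
have vd : bef v d d.-1.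
  have [ad'|//] := btv d.-1 ltac:(nlia); case: (v2 d.-1); first nlia.
  move=> f hf; have [//|df] := btv f hf.
  by rewrite (_ : f = d.-1) //; have := sv d.-1 f ltac:(nlia) hf ad' df; nlia.
(* The order in [w] is [d.-1, d, a, a.+1] and in [v] it is [a.+1, a, d, d.-1], so [(a.+1, d.-1)] is
   a narrower counterexample. *)
have ad2 : a.+1 < d.-1.
  have := bef_trans wd (bef_trans wda wa); rewrite /bef.
  by have [->|] := eqVneq a.+1 d.-1; nlia.
have := IH a.+1 d.-1 ltac:(nlia) ltac:(nlia) ltac:(nlia) (bef_trans wd (bef_trans wda wa)).
by apply/negP/bef_asym; apply: bef_trans va (bef_trans vad vd).
Qed.

(** An inequality [d <= rgt w a] or [lft w d < a] asserts that a whole interval of pairs is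
    inverted. It therefore survives the passage to more inversions, and it is shared by all words
    with the same boxes. *)
Lemma inv_sub_same_boxes_tb n w v w' v' :
  word n w -> word n v -> word n w' -> word n v' -> tb_word n w' ->
  same_boxes n w w' -> same_boxes n v v' ->
  inv_sub n w v -> inv_sub n w' v'.
Proof.
move=> ww wv ww' wv' tb sw sv sub; apply: (tb_inv_sub ww' tb wv') => a d ad dn.
have a_in : 0 < a <= n by lia.
have d_in : 0 < d <= n by lia.
have [_ _ <- _] := sw _ a_in; have [<- _ _ _] := sw _ d_in => -[H|H].
  have [_ _ E _] := sv _ a_in; apply: (lt_rgt_bef wv' ad dn); rewrite -E.
  apply/(rgtP wv a_in) => [|e he]; first lia.
  by apply: sub; [lia|lia|apply: (rgt_bef ww); lia].
have [E _ _ _] := sv _ d_in; apply: (lft_lt_bef wv' ad dn); rewrite -E.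
apply/(lftP wv d_in) => [|e he]; first lia.
by apply: sub; [lia|lia|apply: (lft_bef ww); lia].
Qed.

(** Inversions recorded by the right and left sides are pushed from [w] to [v]; non-inversions
    recorded by the bottom and top sides are pulled back from [v] to [w]. *)
Lemma inv_sub_same_boxes_baxter n w v w' v' :
  word n w -> word n v -> word n w' -> word n v' ->
  baxter_word n w -> baxter_word n v ->
  same_boxes n w w' -> same_boxes n v v' ->
  inv_sub n w' v' -> inv_sub n w v.
Proof.
move=> ww wv ww' wv' bw bv sw sv sub.
apply: (baxter_inv_sub ww wv bw bv) => a d ad dn.
  have a_in : 0 < a <= n by lia.
  have d_in : 0 < d <= n by lia.
  have [_ _ -> _] := sw _ a_in; have [-> _ _ _] := sw _ d_in => -[H|H].
    have [_ _ E _] := sv _ a_in; apply: (lt_rgt_bef wv ad dn); rewrite E.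
    apply/(rgtP wv' a_in) => [|e he]; first lia.
    by apply: sub; [lia|lia|apply: (rgt_bef ww'); lia].
  have [E _ _ _] := sv _ d_in; apply: (lft_lt_bef wv ad dn); rewrite E.
  apply/(lftP wv' d_in) => [|e he]; first lia.
  by apply: sub; [lia|lia|apply: (lft_bef ww'); lia].
have a_in : 0 < a <= n by lia.
have d_in : 0 < d <= n by lia.
have [_ _ _ ->] := sv _ a_in; have [_ -> _ _] := sv _ d_in => -[H|H].
  have [_ _ _ E] := sw _ a_in; apply: (lt_bot_bef ww ad dn); rewrite E.
  apply/(botP ww' a_in) => [|e he]; first lia.
  by apply: (inv_subW ww' wv' sub); [lia|lia|apply: (bot_bef wv'); lia].
have [_ E _ _] := sw _ d_in; apply: (top_lt_bef ww ad dn); rewrite E.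
apply/(topP ww' d_in) => [|e he]; first lia.
by apply: (inv_subW ww' wv' sub); [lia|lia|apply: (top_bef wv'); lia].
Qed.

(** * Swapping two adjacent entries *)

Section Swap.
Variables (n : nat) (w : seq nat) (d a : nat).
Hypotheses (w_word : word n w) (a_in : 0 < a <= n) (da : adjacent w d a).

Definition swap_word :=
  take (index d w) w ++ [:: a, d & drop (index a w).+1 w].

Lemma adjacent_split : w = take (index d w) w ++ [:: d, a & drop (index a w).+1 w].
Proof.
have aw : a \in w by rewrite (word_mem w_word).
have ia : index a w < size w by rewrite index_mem.
have id : index d w < size w by move: da; rewrite /adjacent; nlia.
have dw : d \in w by rewrite -index_mem.
rewrite -{1}(cat_take_drop (index d w) w) (drop_nth 0 id) nth_index //.
by rewrite -da (drop_nth 0 ia) nth_index.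
Qed.

Lemma swap_word_word : word n swap_word.
Proof.
rewrite /word -(permPr w_word) [X in perm_eq _ X]adjacent_split perm_cat2l.
by rewrite -(cat1s a) -(cat1s d) perm_catCA.
Qed.

Lemma index_swap j : index j swap_word =
  if j == d then index a w else if j == a then index d w else index j w.
Proof.
have uw := word_uniq w_word; have Ew := adjacent_split.
have [dA aA] : d \notin take (index d w) w /\ a \notin take (index d w) w.
  by move: uw; rewrite {1}Ew cat_uniq /= !negb_or => /and3P[_ /and3P[? ? _] _].
have nda : d != a.
  by apply/eqP => E; move: da; rewrite E /adjacent; nlia.
have sA : size (take (index d w) w) = index d w.
  by rewrite size_takel // index_size.
have iA k : k \in take (index d w) w -> index k swap_word = index k w.
  by move=> kA; rewrite /swap_word [in RHS]Ew !index_cat kA.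
have [->|jd] := eqVneq j d.
  by rewrite /swap_word index_cat (negbTE dA) sA /= eqxx eq_sym (negbTE nda) da addn1.
have [->|ja] := eqVneq j a; first by rewrite /swap_word index_cat (negbTE aA) sA /= eqxx addn0.
have [/iA//|jA] := boolP (j \in take (index d w) w).
rewrite /swap_word [in RHS]Ew !index_cat (negbTE jA) /=.
by rewrite ![d == j]eq_sym ![a == j]eq_sym (negbTE jd) (negbTE ja).
Qed.

Lemma bef_swap j k : bef swap_word j k =
  if (j == d) && (k == a) then false else
  if (j == a) && (k == d) then true else bef w j k.
Proof.
have nda : d != a.
  by apply/eqP => E; move: da; rewrite E /adjacent; nlia.
have dw : d \in w.
  by rewrite -index_mem; have := index_mem a w; move: da; rewrite (word_mem w_word) a_in /adjacent; nlia.
have aw : a \in w by rewrite (word_mem w_word).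
have ned y : y != d -> index y w != index d w.
  by apply: contraNneq => E; rewrite -(nth_index 0 dw) -E nth_index // -index_mem E index_mem.
have nea y : y != a -> index y w != index a w.
  by apply: contraNneq => E; rewrite -(nth_index 0 aw) -E nth_index // -index_mem E index_mem.
have := (ned j, nea j, ned k, nea k); rewrite /bef !index_swap; move: da; rewrite /adjacent.
have [->|jd] := eqVneq j d; have [->|kd] := eqVneq k d; rewrite /= ?(negbTE nda) //=.
- by rewrite !ltnn; case: (d == a).
- by have [->|ka] := eqVneq k a => /= E [[[n1 n2] n3] n4]; have := n4; have := n3; rewrite ?ka ?kd; nlia.
- by have [->|ja] := eqVneq j a => /= E [[[n1 n2] n3] n4]; have := n1; have := n2; rewrite ?ja ?jd; nlia.
- have [->|ja] := eqVneq j a; have [->|ka] := eqVneq k a => /= E [[[n1 n2] n3] n4];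
    have := n1; have := n2; have := n3; have := n4; rewrite ?ja ?jd ?ka ?kd; nlia.
Qed.

(* The values [e] and [f] keep the boxes of [a] and [d] apart. *)
Lemma swap_same_boxes e f : f <= n -> bef w e d -> bef w a f ->
  a < e < d -> a < f < d -> same_boxes n swap_word w.
Proof.
move=> fn ed af ae_d af_d k k_in.
have d_in : 0 < d <= n.
  rewrite -(word_mem w_word) -index_mem; move: da; rewrite /adjacent.
  by have := index_mem a w; rewrite (word_mem w_word) a_in; nlia.
have ww := swap_word_word.
have da' : bef w d a by move: da; rewrite /bef /adjacent; nlia.
have ea : bef w e a := bef_trans ed da'.
have df : bef w d f := bef_trans da' af.
have e_in : 0 < e <= n by nlia.
have f_in : 0 < f <= n by nlia.
have sub x y : (x == d) && (y == a) = false -> bef w x y -> bef swap_word x y.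
  by rewrite bef_swap => ->; case: ifP.
apply: (tiling_sub (word_tiling ww) (word_tiling w_word)) => {k k_in} // k k_in.
have [rk bk] := (rgt_le w_word k_in, bot_le w_word k_in).
have [rk' bk'] := (rgt_ge w k, bot_ge w k).
split.
- rewrite -ltnS; apply/(lftP ww k_in) => // g hg; apply: sub; last by apply: (lft_bef w_word).
  apply/negP => /andP[/eqP kd /eqP ga]; subst g k.
  by have := lft_bef w_word k_in (_ : lft w d < e < d); move/(_ ltac:(nlia)); apply/negP/bef_asym.
- rewrite -ltnS; apply/(topP ww k_in) => // g hg; apply: sub; last by apply: (top_bef w_word).
  by apply/negP => /andP[/eqP kd /eqP ga]; subst g k; nlia.
- apply/(rgtP ww k_in) => [|g hg]; first nlia.
  apply: sub; last by apply: (rgt_bef w_word).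
  apply/negP => /andP[/eqP kd /eqP ga]; subst g k.
  by have := rgt_bef w_word k_in (_ : a < f <= rgt w a); move/(_ ltac:(nlia)); apply/negP/bef_asym.
- apply/(botP ww k_in) => [|g hg]; first nlia.
  apply: sub; last by apply: (bot_bef w_word).
  by apply/negP => /andP[/eqP kd /eqP ga]; subst g k; nlia.
Qed.

End Swap.

Definition inversions n (w : seq nat) :=
  [set p : 'I_n.+1 * 'I_n.+1 | (p.1 < p.2) && bef w p.2 p.1].

(** Swapping the descent [d a] of a forbidden pattern keeps the boxes and removes an inversion, so
    the process ends. *)
Lemma tb_word_exists n w : word n w ->
  exists w', [/\ word n w', tb_word n w' & same_boxes n w' w].
Proof.
have [m] := ubnP #|inversions n w|; elim: m w => // m IH w sz ww.
pose P (q : 'I_n.+1 * 'I_n.+1 * 'I_n.+1 * 'I_n.+1) := 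
  let: (e, d, a, f) := (val q.1.1.1, val q.1.1.2, val q.1.2, val q.2) in
  [&& bef w e d, index a w == (index d w).+1, bef w a f, a < e < d & a < f < d].
have [[[[e d] a] f] /and5P[/= ed /eqP da af he hf]|none] := @pickP _ P; last first.
  exists w; split=> // e d a f fn ed da af he hf.
  have a_in : 0 < a <= n.
    have f_in : 0 < f <= n by nlia.
    exact: (bef_memr ww f_in af).
  have d_in : 0 < d <= n.
    by apply: (bef_memr ww a_in); rewrite /bef da.
  have [? ? ? ?] : [/\ e < n.+1, d < n.+1, a < n.+1 & f < n.+1] by split; nlia.
  have := none (inord e, inord d, inord a, inord f).
  by rewrite /P /= !inordK // ed da eqxx af he hf.
have fn : f <= n by have := ltn_ord f; nlia.
have f_in : 0 < f <= n by nlia.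
have a_in := bef_memr ww f_in af.
have ww1 := swap_word_word ww a_in da.
have sb := swap_same_boxes ww a_in da fn ed af he hf.
have [|w' [ww' tb sb']] := IH (swap_word w d a) _ ww1; last first.
  exists w'; split=> // k k_in; have [-> -> -> ->] := sb' k k_in; exact: sb.
suff : inversions n (swap_word w d a) \proper inversions n w by move/proper_card; nlia.
apply/properP; split; last first.
  exists (a, d); rewrite !inE /= ?(bef_swap ww a_in da) ?eqxx ?andbF //.
  by rewrite /bef da; nlia.
apply/fintype.subsetP => -[x y]; rewrite !inE /= (bef_swap ww a_in da).
case: ifP; rewrite ?andbF // => _; case: ifP => // /andP[/eqP -> /eqP ->].
by nlia.
Qed.

(** * Greedy construction of a Baxter word from a tiling *)

Section Greedy.
Variables (n : nat) (l t r s : nat -> nat).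
Hypothesis tl : tiling n l t r s.
Local Notation cell := (in_cell l t r s).

Lemma tiling_bounds k : 0 < k <= n ->
  [/\ l k < k, t k < k, k <= r k <= n & k <= s k <= n].
Proof. by case: tl => bd _ _; apply: bd. Qed.

Lemma tiling_eq i j a b : 0 < a <= n -> 0 < b <= n -> cell a i j -> cell b i j -> a = b.
Proof. by case: tl => _ _; apply. Qed.

(** Otherwise rectangle [k] would cover the diagonal cell of [k.-1] too. *)
Lemma tiling_before k : 0 < k <= n -> l k < k.-1 -> t k = k.-1.
Proof.
move=> k_in lk; have [_ tk _ _] := tiling_bounds k_in.
apply/eqP; rewrite eqn_leq -ltnS prednK ?tk; last nlia.
rewrite leqNgt; apply/negP => tk1.
have k1 : 0 < k.-1 <= n by nlia.
have [? ? ? ?] := tiling_bounds k1; have [? ? ? ?] := tiling_bounds k_in.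
by have := @tiling_eq k.-1 k.-1 k k.-1 k_in k1; rewrite /in_cell; nlia.
Qed.

Lemma tiling_after k : 0 < k <= n -> k < s k -> r k = k.
Proof.
move=> k_in sk; have [? ? ? ?] := tiling_bounds k_in.
apply/eqP; rewrite eqn_leq andbC; apply/andP; split; first nlia.
rewrite leqNgt; apply/negP => rk.
have k1 : 0 < k.+1 <= n by nlia.
have [? ? ? ?] := tiling_bounds k1.
by have := @tiling_eq k.+1 k.+1 k k.+1 k_in k1; rewrite /in_cell; nlia.
Qed.

(* [w] is a prefix of a word realizing the tiling. *)
Definition stage (w : seq nat) := [/\ uniq w,
    forall a, a \in w -> 0 < a <= n /\ forall e, t a < e <= r a -> e \in w,
    forall b, 0 < b <= n -> b \notin w -> forall e, l b < e <= s b -> e \notin w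
  & forall k, k \in w ->
      (forall e, t k < e <= r k -> e <> k -> bef w e k) /\
      (forall e, l k < e <= s k -> e <> k -> bef w k e)].

Definition gap (w : seq nat) g h := [/\ g < h <= n,
  forall x, g < x <= h -> x \notin w, g = 0 \/ g \in w & h = n \/ h.+1 \in w].

(* The last placed label is [u]; at the corners of the staircase left (right) of
   [u] the horizontal (vertical) wall goes through. *)
Definition corners_from (w : seq nat) u := forall e f, 0 < e -> e.+1 < f <= n ->
  e \notin w -> f \notin w -> (forall x, e < x < f -> x \in w) ->
  (f < u -> f <= r e) /\ (u < e -> t f < e).

Lemma index_rcons (w : seq nat) k e : k \notin w -> index e (rcons w k) =
  if e \in w then index e w else if e == k then size w else (size w).+1.
Proof.
move=> kw; rewrite -cats1 index_cat; case: ifP => //= _.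
by rewrite eq_sym; case: eqP; rewrite ?addn0 ?addn1.
Qed.

(** The label is found at the cell in column [g.+1] and row [h], the lower-left cell of the free
    region over the gap. The third clause of [stage] keeps its rectangle from reaching past the
    placed labels [g] and [h.+1]. *)
Lemma gap_label w g h : stage w -> gap w g h ->
  exists k, [/\ g < k <= h, k \notin w, l k = g & s k = h].
Proof.
case=> uw dw uo od [gh gw gl hr]; case: tl => _ cov _.
have [k k_in ck] := cov g.+1 h ltac:(nlia) ltac:(nlia).
have [lk tk rk sk] := tiling_bounds k_in.
have gk : g < k.
  rewrite ltnNge; apply/negP => kg; move: ck; rewrite /in_cell => ck.
  by have := tiling_after k_in ltac:(nlia); nlia.
have kh : k <= h.
  rewrite leqNgt; apply/negP => kg; move: ck; rewrite /in_cell => ck.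
  by have := tiling_before k_in ltac:(nlia); nlia.
have kw : k \notin w by apply: gw; nlia.
move: ck; rewrite /in_cell => ck; have := uo k k_in kw => ko.
exists k; split => //; first nlia.
  case: gl => [|gl]; first nlia.
  suff : ~~ (l k < g <= s k) by nlia.
  by apply: contraL gl; apply: ko.
case: hr => [|hr]; first nlia.
suff : ~~ (l k < h.+1 <= s k) by nlia.
by apply: contraL hr; apply: ko.
Qed.

Lemma stage_rcons w g h k : stage w -> gap w g h ->
  g < k <= h -> l k = g -> s k = h ->
  (forall x, t k < x <= r k -> x <> k -> x \in w) -> stage (rcons w k).
Proof.
case=> uw dw uo od [gh gw gl hr] gk lk sk add.
have kw : k \notin w by apply: gw; nlia.
have k_in : 0 < k <= n by nlia.
have ik := index_rcons _ kw.
split.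
- by rewrite rcons_uniq kw.
- move=> a; rewrite mem_rcons inE => /orP[/eqP->|aw].
    split=> // e he; rewrite mem_rcons inE.
    by have [//|/eqP ek] := eqVneq e k; rewrite add.
  have [a_in H] := dw a aw; split=> // e he.
  by rewrite mem_rcons inE H ?orbT.
- move=> b b_in; rewrite mem_rcons inE negb_or => /andP[bk bw] e he.
  rewrite mem_rcons inE negb_or (uo b) // andbT; apply/eqP => ek; subst e.
  have [? ? ? ?] := tiling_bounds b_in; have [? ? ? ?] := tiling_bounds k_in.
  (* Both rectangles fit the same gap, and the lower-left cell of [b] would belong to [k] as
     well. *)
  move/eqP: bk; apply; apply: (@tiling_eq (l b).+1 (s b)) => //; rewrite /in_cell; first nlia.
  have gb : g <= l b.
    case: gl => [|gl]; first nlia.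
    rewrite leqNgt; apply/negP => lg; have := uo b b_in bw g; rewrite gl; nlia.
  have hb : s b <= h.
    case: hr => [|hr]; first nlia.
    rewrite leqNgt; apply/negP => lg; have := uo b b_in bw h.+1; rewrite hr; nlia.
  nlia.
- move=> a; rewrite mem_rcons inE => /orP[/eqP->|aw].
    split=> e he ek; rewrite /bef !ik (negbTE kw) eqxx.
      by rewrite add // index_mem add.
    have -> : e \in w = false by apply/negbTE/gw; nlia.
    by case: eqP.
  have aw' : index a w < size w by rewrite index_mem.
  have [a_in H] := dw a aw; have [H1 H2] := od a aw; split=> e he ea; rewrite /bef !ik aw.
    by rewrite H //; apply: H1.
  have := H2 e he ea; rewrite /bef; case: ifP => // ew _; case: (e == k) => //. exact: ltnW.
Qed.

(* When the next entry [k] fills a gap adjacent to the block of [u], the entries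
   between [u] and [k] not yet placed all lie on the side of [k]. *)
Lemma baxter_rcons (w : seq nat) u (k : nat) : uniq w -> last 0 w = u -> u \in w -> k \notin w ->
  baxter_word n w ->
  (forall e f, f <= n -> e \in w -> f \notin w ->
     (u < f < e -> e < k -> False) /\ (k < e < f -> f < u -> False)) ->
  baxter_word n (rcons w k).
Proof.
move=> uw lw uin kw bw H e d a f fn; rewrite /adjacent /bef.
have E (x : nat) : [\/ x \in w /\ index x w < size w /\ index x (rcons w k) = index x w,
    x = k /\ index x (rcons w k) = size w
  | x \notin w /\ index x w = size w /\ index x (rcons w k) = (size w).+1].
  rewrite index_rcons //; case: ifP => [xw|/negbT xw].
    by apply: Or31; rewrite index_mem.
  case: eqP => [xk|_]; [by apply: Or32|by apply: Or33; rewrite memNindex].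
move=> ed da af.
have [[aw [ia ia']]|[ak ia]|[aw [ia ia']]] := E a; last first.
- by have [[fw [jf jf']]|[fk jf]|[fw [jf jf']]] := E f; nlia.
- have [[dw [jd jd']]|[fk jd]|[dw [jd jd']]] := E d; try nlia.
  have [[ew [je je']]|[fk je]|[ew [je je']]] := E e; try nlia.
  have [[fw [jf jf']]|[fk jf]|[fw [jf jf']]] := E f; try nlia.
  have -> : d = u by rewrite -lw -nth_last (_ : (size w).-1 = index d w) ?nth_index //; nlia.
  by rewrite ak; apply: H.
- have [[dw [jd jd']]|[fk jd]|[dw [jd jd']]] := E d; try nlia.
  have [[ew [je je']]|[fk je]|[ew [je je']]] := E e; try nlia.
  apply: bw => //; rewrite /bef /adjacent; try nlia.
  have [[fw [jf jf']]|[fk jf]|[fw [jf jf']]] := E f; try nlia.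
  by rewrite fk (memNindex kw).
Qed.

Definition greedy w u := [/\ stage w, last 0 w = u, u \in w, corners_from w u & baxter_word n w].

Lemma greedy_first : 0 < n -> exists u, greedy [:: u] u.
Proof.
move=> n0; have st : stage [::] by split.
have gp : gap [::] 0 n by split; [nlia| |left|left].
have [k [gk kw lk sk]] := gap_label st gp.
have k_in : 0 < k <= n by nlia.
have [? ? ? ?] := tiling_bounds k_in.
exists k; split=> //.
- apply: (stage_rcons st gp gk lk sk) => x hx xk.
  have [xk'|xk'] := ltnP x k.
    by have := tiling_before k_in ltac:(nlia); nlia.
  have [kn|kn] := ltnP k n; last nlia.
  by have := tiling_after k_in ltac:(nlia); nlia.
- by rewrite inE.
- move=> e f e0 ef; rewrite !inE => ek fk H.
  have := H e.+1 ltac:(nlia); have := H f.-1 ltac:(nlia); rewrite !inE; nlia.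
- move=> e d a f fn; rewrite /adjacent /bef /=; do ![case: ifP => _]; nlia.
Qed.

(** At the top-right corner of the block between [e] and [f] the vertical wall goes through
    ([t f < e]), so the gap ending at [e] is filled. This corner then lies to the right of the new
    label and satisfies [corners_from] by that very condition. *)
Lemma greedy_left w u e f g : greedy w u -> 0 < e < u -> u < f ->
  e \notin w -> f = n.+1 \/ f <= n /\ f \notin w ->
  (forall x, e < x < f -> x \in w) -> f = n.+1 \/ t f < e ->
  gap w g e -> exists k, greedy (rcons w k) k.
Proof.
move=> [st lw uw cw bw] eu uf ew fw ef cf gp.
have [k [gk kw lk sk]] := gap_label st gp.
have [uniw dw _ _] := st; have [gh gw gl _] := gp.
have u_in := (dw u uw).1.
have k_in : 0 < k <= n by nlia.
have e_in : 0 < e <= n by nlia.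
have [? ? ? ?] := tiling_bounds k_in; have [? ? ? ?] := tiling_bounds e_in.
exists k; split.
- apply: (stage_rcons st gp gk lk sk) => x hx xk.
  have [xk'|xk'] := ltnP x k.
    have [kg|kg] := ltnP g k.-1; first by have := tiling_before k_in ltac:(nlia); nlia.
    apply/negPn/negP => xw.
    (* [y] is the nearest unplaced label below [k]. The corner between [y] and [k] is left of [u],
       so rectangle [y] reaches column [k], and rectangle [k] cannot rise to row [y]. *)
    pose y := below (fun y => y \notin w) k.
    have xy : x <= y.
      rewrite leqNgt; apply/negP => /below_ltP H.
      by have := H ltac:(nlia) x; rewrite xw; move/(_ ltac:(nlia)).
    have yw : y \notin w by apply: (@below_in (fun y => y \notin w)); rewrite -/y; nlia.
    have yk : y < k by apply: below_lt; nlia.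
    have yg : y < g.
      have [|gy] := ltnP y g => //; case: gl => [|gl]; first nlia.
      by move: yw; rewrite (_ : y = g) ?gl //; nlia.
    have btw z : y < z < k -> z \in w.
      move=> hz; have /(@below_ltP (fun y => y \notin w)) H : y < z by nlia.
      by have := H ltac:(nlia) z ltac:(nlia); rewrite negbK.
    have [+ _] := cw y k ltac:(nlia) ltac:(nlia) yw kw btw; move/(_ ltac:(nlia)) => ry.
    have y_in : 0 < y <= n by nlia.
    have [? ? ? ?] := tiling_bounds y_in.
    by have := @tiling_eq k y k y k_in y_in; rewrite /in_cell; nlia.
  have [ke|ke] := ltnP k e; first by have := tiling_after k_in ltac:(nlia); nlia.
  have Ek : k = e by nlia.
  apply: ef; suff : r k < f by nlia.
  case: cf => [|cf]; first nlia.
  case: fw => [|[fn fw]]; first nlia.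
  rewrite ltnNge; apply/negP => fr; have f_in : 0 < f <= n by nlia.
  have [? ? ? ?] := tiling_bounds f_in.
  by have := @tiling_eq f k k f k_in f_in; rewrite /in_cell; nlia.
- by rewrite last_rcons.
- by rewrite mem_rcons inE eqxx.
- move=> x y x0 xy; rewrite !mem_rcons !inE !negb_or => /andP[xk xw] /andP[yk yw] H.
  have H' z : x < z < y -> z <> k -> z \in w.
    by move=> hz zk; have := H z hz; rewrite mem_rcons inE => /orP[/eqP|].
  split=> [yk'|kx].
    have [+ _] := cw x y x0 xy xw yw (fun z hz => H' z hz ltac:(nlia)).
    by apply; nlia.
  (* A corner right of [k] is either that of the block just left, where [cf] applies, or already was
     to the right of [u]. *)
  have [xe|xe] := leqP x e.
    have Ex : x = e.
      apply/eqP; rewrite eqn_leq xe leqNgt; apply/negP => xe'.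
      by have := gw x.+1 ltac:(nlia); rewrite H' //; nlia.
    have Ey : y = f.
      have [yf|fy|//] := ltngtP y f; first by rewrite ef // in yw; nlia.
      case: fw => [|[fn fw]]; first nlia.
      by rewrite H' // in fw; nlia.
    by case: cf; [nlia|rewrite Ex Ey].
  have [_] := cw x y x0 xy xw yw (fun z hz => H' z hz ltac:(nlia)); apply.
  by rewrite ltnNge; apply/negP => xu; rewrite ef // in xw; nlia.
- apply: (baxter_rcons uniw lw uw kw bw) => x y yn xw yw; split=> hxy; first nlia.
  move=> yu; have ye : y <= e by rewrite leqNgt; apply/negP => ye; rewrite ef // in yw; nlia.
  by have := gw x ltac:(nlia); rewrite xw.
Qed.

(** Reflection of [greedy_left]: the horizontal wall goes through the corner, and the gap starting
    at [f] is filled. *)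
Lemma greedy_right w u e f h : greedy w u -> e < u -> u < f <= n ->
  f \notin w -> e = 0 \/ 0 < e /\ e \notin w ->
  (forall x, e < x < f -> x \in w) -> e = 0 \/ f <= r e ->
  gap w f.-1 h -> exists k, greedy (rcons w k) k.
Proof.
move=> [st lw uw cw bw] eu uf fw ew ef ce gp.
have [k [gk kw lk sk]] := gap_label st gp.
have [uniw dw _ _] := st; have [gh gw _ hr] := gp.
have u_in := (dw u uw).1.
have k_in : 0 < k <= n by nlia.
have f_in : 0 < f <= n by nlia.
have [? ? ? ?] := tiling_bounds k_in; have [? ? ? ?] := tiling_bounds f_in.
exists k; split.
- apply: (stage_rcons st gp gk lk sk) => x hx xk.
  have [xk'|xk'] := ltnP x k.
    have [kg|kg] := ltnP f k; first by have := tiling_before k_in ltac:(nlia); nlia.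
    have Ek : k = f by nlia.
    apply: ef; suff : e <= t k by nlia.
    case: ce => [->//|ce]; case: ew => [->//|[e0 ew]].
    rewrite leqNgt; apply/negP => te; have e_in : 0 < e <= n by nlia.
    have [? ? ? ?] := tiling_bounds e_in.
    by have := @tiling_eq k e k e k_in e_in; rewrite /in_cell; nlia.
  have [ke|ke] := ltnP k h; first by have := tiling_after k_in ltac:(nlia); nlia.
  have Ek : k = h by nlia.
  case: hr => [|hr]; first nlia.
  apply/negPn/negP => xw.
  pose P y := y \notin w; pose y := (above P n k).+1.
  have yx : y <= x.
    rewrite leqNgt; apply/negP => yx.
    have /(@above_geP P n k x) H : x <= above P n k by [].
    by have := H ltac:(nlia) x ltac:(nlia); rewrite /P xw.
  have yw : y \notin w by apply: (@above_in P); rewrite /y; nlia.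
  have ky : k < y by have := above_ge P n k; rewrite /y; nlia.
  have ky' : k.+1 < y.
    by have [|yk] := ltnP k.+1 y => //; move: yw; rewrite (_ : y = h.+1) ?hr; nlia.
  have btw z : k < z < y -> z \in w.
    move=> hz; have /(@above_geP P n k z) H : z <= above P n k by rewrite /y in hz; nlia.
    by have := H ltac:(nlia) z ltac:(nlia); rewrite /P negbK.
  have [_ +] := cw k y ltac:(nlia) ltac:(nlia) kw yw btw; move/(_ ltac:(nlia)) => ry.
  have y_in : 0 < y <= n by nlia.
  have [? ? ? ?] := tiling_bounds y_in.
  by have := @tiling_eq y k k y k_in y_in; rewrite /in_cell; nlia.
- by rewrite last_rcons.
- by rewrite mem_rcons inE eqxx.
- move=> x y x0 xy; rewrite !mem_rcons !inE !negb_or => /andP[xk xw] /andP[yk yw] H.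
  have H' z : x < z < y -> z <> k -> z \in w.
    by move=> hz zk; have := H z hz; rewrite mem_rcons inE => /orP[/eqP|].
  split=> [yk'|kx]; last first.
    have [_] := cw x y x0 xy xw yw (fun z hz => H' z hz ltac:(nlia)).
    by apply; nlia.
  have [yf|yf] := leqP f y.
    have Ey : y = f.
      apply/eqP; rewrite eqn_leq yf andbT leqNgt; apply/negP => fy.
      by have := gw y.-1 ltac:(nlia); rewrite H' //; nlia.
    have Ex : x = e.
      have [xe|xe|//] := ltngtP x e; last by rewrite ef // in xw; nlia.
      case: ew => [|[e0 ew]]; first nlia.
      by rewrite H' // in ew; nlia.
    by case: ce; [nlia|rewrite Ex Ey].
  have [+ _] := cw x y x0 xy xw yw (fun z hz => H' z hz ltac:(nlia)); apply.
  by rewrite ltnNge; apply/negP => xu; rewrite ef // in yw; nlia.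
- apply: (baxter_rcons uniw lw uw kw bw) => x y yn xw yw; split=> hxy; last nlia.
  move=> xk; have ye : f <= y by rewrite leqNgt; apply/negP => ye; rewrite ef // in yw; nlia.
  by have := gw x ltac:(nlia); rewrite xw.
Qed.

Lemma greedy_next w u : greedy w u -> size w < n -> exists k, greedy (rcons w k) k.
Proof.
move=> gr sz; have [st lw uw cw bw] := gr; have [uniw dw uo _] := st.
have u_in := (dw u uw).1.
pose P y := y \notin w; pose e := below P u; pose f := (above P n u).+1.
have eu : e < u by apply: below_lt; nlia.
have uf : u < f by have := above_ge P n u; rewrite /f; nlia.
have fn : f <= n.+1 by have := @above_le P n u; rewrite /f; nlia.
have ew : e = 0 \/ 0 < e /\ e \notin w.
  by have [->|e0] := posnP e; [left|right; split=> //; apply: (@below_in P)].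
have fw : f = n.+1 \/ f <= n /\ f \notin w.
  have [fn'|fn'] := leqP f n; [right; split=> //|left; nlia].
  by apply: (@above_in P); rewrite /f in fn'; nlia.
have ef x : e < x < f -> x \in w.
  move=> hx; have [xu|ux|->//] := ltngtP x u.
    have /(@below_ltP P u x) H : e < x by nlia.
    by have := H ltac:(nlia) x ltac:(nlia); rewrite /P negbK.
  have /(@above_geP P n u x) H : x <= above P n u by rewrite /f in hx; nlia.
  by have := H ltac:(rewrite /f in fn; nlia) x ltac:(nlia); rewrite /P negbK.
have goleft : 0 < e -> f = n.+1 \/ t f < e -> exists k, greedy (rcons w k) k.
  move=> e0 cf; case: ew => [|[_ ew]]; first nlia.
  pose Q y := y \in w; pose g := below Q e.
  apply: (@greedy_left w u e f g) => //; first nlia.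
  split.
  - by have : g < e by [apply: below_lt|]; nlia.
  - move=> x hx; have [->//|xe] := eqVneq x e.
    have /(@below_ltP Q e x) H : g < x by nlia.
    by apply: H => //; nlia.
  - by have [->|g0] := posnP g; [left|right; apply: (@below_in Q)].
  - by right; apply: ef; nlia.
have goright : f <= n -> e = 0 \/ f <= r e -> exists k, greedy (rcons w k) k.
  move=> fn' ce; case: fw => [|[_ fw]]; first nlia.
  pose Q y := y \in w; pose h := above Q n f.
  have fh : f <= h by apply: above_ge.
  have hn : h <= n by apply: above_le.
  apply: (@greedy_right w u e f h) => //; first nlia.
  split.
  - nlia.
  - move=> x hx; have [->//|xe] := eqVneq x f.
    have /(@above_geP Q n f x) H : x <= h by nlia.
    by apply: H => //; nlia.
  - by right; apply: ef; nlia.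
  - have [hn'|hn'] := ltnP h n; last by left; nlia.
    by right; apply: (@above_in Q).
case: (ew) => [e0|[e0 ew']].
  case: (fw) => [fn1|[fn' _]]; last by apply: goright => //; left.
  suff : n <= size w by nlia.
  rewrite -(size_iota 1 n); apply: uniq_leq_size (iota_uniq _ _) _ => x.
  by rewrite mem_iota => hx; apply: ef; nlia.
case: (fw) => [fn1|[fn' fw']]; first by apply: goleft => //; left.
(* The cell diagonally beyond the top-right corner of the block decides which wall goes through. Its
   label lies in [[e, f]]; a label strictly between is placed, and then the second clause of [stage]
   would place [e] too. *)
case: tl => _ cov _; have [k k_in ck] := cov f e ltac:(nlia) ltac:(nlia).
have [? ? ? ?] := tiling_bounds k_in; move: ck; rewrite /in_cell => ck.
have ke : e <= k.
  rewrite leqNgt; apply/negP => ke; have := tiling_after k_in ltac:(nlia); nlia.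
have kf : k <= f.
  rewrite leqNgt; apply/negP => kf; have := tiling_before k_in ltac:(nlia); nlia.
have [Ek|nke] := eqVneq k e; first by apply: goright => //; right; rewrite -Ek; nlia.
have [Ek|nkf] := eqVneq k f; first by apply: goleft => //; right; rewrite -Ek; nlia.
have kw : k \in w by apply: ef; nlia.
by have := (dw k kw).2 e; rewrite (negbTE ew'); move/(_ ltac:(nlia)).
Qed.

Theorem tiling_baxter_word : 0 < n -> exists w, [/\ word n w, baxter_word n w &
  forall k, 0 < k <= n -> [/\ lft w k = l k, top w k = t k, rgt w k = r k & bot w k = s k]].
Proof.
move=> n0; have /(_ n.-1 ltac:(nlia)) [w [u [gr sz]]] : forall m, m < n ->
    exists w u, greedy w u /\ size w = m.+1.
  elim=> [|m IH] mn.
    by have [u gr] := greedy_first n0; exists [:: u], u.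
  have [w [u [gr sz]]] := IH ltac:(nlia).
  have [k gk] := greedy_next gr ltac:(nlia).
  by exists (rcons w k), k; rewrite size_rcons sz.
have [st lw uw cw bw] := gr; have [uniw dw uo od] := st.
have ww : word n w.
  rewrite /word; apply: uniq_perm => //; first exact: iota_uniq.
  have sub : {subset w <= iota 1 n} by move=> x /dw[x_in _]; rewrite mem_iota; nlia.
  have sn : size (iota 1 n) <= size w by rewrite size_iota sz prednK.
  exact: (uniq_min_size uniw sub sn).2.
exists w; split=> //.
(* The precedences kept by [stage] show only that each rectangle of [w] contains the given one,
   which is enough. *)
apply: (tiling_sub (word_tiling ww) tl) => k k_in.
have kw : k \in w by rewrite (word_mem ww).
have [H1 H2] := od k kw; have [? ? ? ?] := tiling_bounds k_in.
split.
- by rewrite -ltnS; apply/(lftP ww k_in) => // g hg; apply: H2; nlia.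
- by rewrite -ltnS; apply/(topP ww k_in) => // g hg; apply: H1; nlia.
- by apply/(rgtP ww k_in) => [|g hg]; [nlia|apply: H1; nlia].
- by apply/(botP ww k_in) => [|g hg]; [nlia|apply: H2; nlia].
Qed.

End Greedy.

(** * Permutations and their words *)

Section Oneline.
Variable n : nat.
Implicit Types (x y : 'S_n) (i j k : 'I_n).

Lemma size_oneline x : size (oneline x) = n.
Proof. by rewrite size_map size_enum_ord. Qed.

Lemma nth_oneline x i : nth 0 (oneline x) i = (x i).+1.
Proof. by rewrite (nth_map i) ?size_enum_ord ?ltn_ord // nth_ord_enum. Qed.

Lemma uniq_oneline x : uniq (oneline x).
Proof. by rewrite map_inj_uniq ?enum_uniq // => i j [] /val_inj /perm_inj. Qed.

Lemma oneline_word x : word n (oneline x).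
Proof.
apply: uniq_perm; [exact: uniq_oneline|exact: iota_uniq|].
have sub : {subset oneline x <= iota 1 n}.
  by move=> _ /mapP[i _ ->]; rewrite mem_iota add1n; have := ltn_ord (x i); nlia.
have sn : size (iota 1 n) <= size (oneline x) by rewrite size_iota size_oneline.
exact: (uniq_min_size (uniq_oneline x) sub sn).2.
Qed.

Lemma index_oneline x i : index i.+1 (oneline x) = (x^-1)%g i.
Proof.
have := nth_oneline x ((x^-1)%g i); rewrite permKV => <-.
by rewrite index_uniq ?uniq_oneline // size_oneline.
Qed.

Lemma oneline_inj : injective (@oneline n).
Proof.
move=> x y E; apply/permP => i; apply: val_inj.
by apply: succn_inj; rewrite -!nth_oneline E.
Qed.

Lemma word_oneline w : word n w -> exists x, oneline x = w.
Proof.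
move=> ww; have sw := word_size ww; have uw := word_uniq ww.
have wi i : (nth 0 w i).-1 < n.
  have : nth 0 w i \in w by rewrite mem_nth ?sw.
  by rewrite (word_mem ww); nlia.
have inj : injective (fun i => Ordinal (wi i)).
  move=> i j [] E; apply: val_inj; apply/eqP.
  have [iw jw] : nth 0 w i \in w /\ nth 0 w j \in w by rewrite !mem_nth ?sw.
  have := nth_uniq 0 (_ : i < size w) (_ : j < size w) uw.
  rewrite sw => /(_ (ltn_ord i) (ltn_ord j)) <-.
  suff -> : nth 0 w i = nth 0 w j by [].
  by move: iw jw; rewrite !(word_mem ww); nlia.
exists (perm inj); apply: (@eq_from_nth _ 0); first by rewrite size_oneline sw.
move=> i; rewrite size_oneline => i_n; rewrite (nth_oneline _ (Ordinal i_n)) permE /=.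
have : nth 0 w i \in w by rewrite mem_nth ?sw.
by rewrite (word_mem ww); nlia.
Qed.

Lemma has_patternP (P : nat -> nat -> nat -> nat -> bool) x :
  reflect (exists e d a f : 'I_n,
    [/\ bef (oneline x) e.+1 d.+1, adjacent (oneline x) d.+1 a.+1,
        bef (oneline x) a.+1 f.+1 & P e d a f])
  (has_pattern P x).
Proof.
rewrite /bef /adjacent; apply: (iffP existsP).
  move=> [i /existsP[j /existsP[k /existsP[l /and4P[ij /eqP jk kl Px]]]]].
  by exists (x i), (x j), (x k), (x l); rewrite !index_oneline !permK.
move=> [e [d [a [f]]]]; rewrite !index_oneline => -[ed da af Px].
exists ((x^-1)%g e); apply/existsP; exists ((x^-1)%g d); apply/existsP.
exists ((x^-1)%g a); apply/existsP; exists ((x^-1)%g f).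
by rewrite ed da eqxx -da af !permKV.
Qed.

Lemma baxterP x : reflect (baxter_word n (oneline x)) (baxter x).
Proof.
apply: (iffP andP) => [[/has_patternP n1 /has_patternP n2] e d a f fn ed da af|bx]; last first.
  split; apply/has_patternP => -[e [d [a [f [ed da af]]]]].
    by rewrite /pat_3_14_2 => P; apply: (bx _ _ _ _ _ ed da af).1; have := ltn_ord f; nlia.
  by rewrite /pat_2_41_3 => P; apply: (bx _ _ _ _ _ ed da af).2; have := ltn_ord f; nlia.
have w_word := oneline_word x.
have [f0|f0] := posnP f; first by rewrite f0; split; nlia.
have f_in : 0 < f <= n by nlia.
have a_in := bef_memr w_word f_in af.
have d_in : 0 < d <= n by apply: (bef_memr w_word a_in); rewrite /bef da.
have e_in := bef_memr w_word d_in ed.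
case: e d a f => [|e] [|d] [|a] [|f] // in fn ed da af f0 f_in a_in d_in e_in *.
have fn' : f < n by nlia.
have an : a < n by nlia.
have dn : d < n by nlia.
have en : e < n by nlia.
split=> h1 h2.
  by apply: n1; exists (Ordinal en), (Ordinal dn), (Ordinal an), (Ordinal fn'); rewrite /pat_3_14_2; split=> //=; nlia.
by apply: n2; exists (Ordinal en), (Ordinal dn), (Ordinal an), (Ordinal fn'); rewrite /pat_2_41_3; split=> //=; nlia.
Qed.

Lemma twisted_baxterP x : reflect (tb_word n (oneline x)) (twisted_baxter x).
Proof.
apply: (iffP andP) => [[/has_patternP n1 /has_patternP n2] e d a f fn ed da af h1 h2|bx]; last first.
  split; apply/has_patternP => -[e [d [a [f [ed da af]]]]].
    by rewrite /pat_3_41_2 => P; apply: (bx _ _ _ _ _ ed da af); have := ltn_ord f; nlia.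
  by rewrite /pat_2_41_3 => P; apply: (bx _ _ _ _ _ ed da af); have := ltn_ord f; nlia.
have w_word := oneline_word x.
have f_in : 0 < f <= n by nlia.
have a_in := bef_memr w_word f_in af.
have d_in : 0 < d <= n by apply: (bef_memr w_word a_in); rewrite /bef da.
have e_in := bef_memr w_word d_in ed.
case: e d a f => [|e] [|d] [|a] [|f] // in fn ed da af h1 h2 f_in a_in d_in e_in *.
have fn' : f < n by nlia.
have an : a < n by nlia.
have dn : d < n by nlia.
have en : e < n by nlia.
have [ef|fe|E] := ltngtP e f.
- by apply: n2; exists (Ordinal en), (Ordinal dn), (Ordinal an), (Ordinal fn'); rewrite /pat_2_41_3; split=> //=; nlia.
- by apply: n1; exists (Ordinal en), (Ordinal dn), (Ordinal an), (Ordinal fn'); rewrite /pat_3_41_2; split=> //=; nlia.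
- by move: ed da af; rewrite /bef /adjacent E; nlia.
Qed.

Lemma inv_subP x y : inv_sub n (oneline x) (oneline y) <->
  forall a d : 'I_n, a < d -> (x^-1)%g d < (x^-1)%g a -> (y^-1)%g d < (y^-1)%g a.
Proof.
split=> H a d ad.
  by have := H a.+1 d.+1; rewrite /bef !index_oneline; apply=> //; have := ltn_ord d; nlia.
case: a d ad => [|a] [|d] // ad dn; have an : a < n by nlia.
by rewrite /bef -[a]/(val (Ordinal an)) -[d]/(val (Ordinal dn)) !index_oneline; apply: H.
Qed.

Lemma weak_cover_inv_sub x y : weak_cover x y -> inv_sub n (oneline x) (oneline y).
Proof.
move=> /existsP[i /existsP[j /and3P[/eqP ij xij /eqP ->]]].
apply/inv_subP => a d ad; rewrite !invMg tpermV !permM.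
have tp k : [\/ k = i /\ tperm i j k = j, k = j /\ tperm i j k = i
  | [/\ k != i, k != j & tperm i j k = k]].
  case: tpermP => [->|->|/eqP ki /eqP kj]; [by apply: Or31|by apply: Or32|by apply: Or33].
have := tp ((x^-1)%g d); have := tp ((x^-1)%g a).
case=> [[Ea ->]|[Ea ->]|[ai aj ->]]; case=> [[Ed ->]|[Ed ->]|[di dj ->]];
  rewrite ?Ea ?Ed; try nlia.
- by move=> _; move: xij; rewrite -Ea -Ed !permKV; nlia.
- by rewrite -val_eqE /= in di; rewrite -val_eqE /= in dj; nlia.
- by rewrite -val_eqE /= in ai; rewrite -val_eqE /= in aj; nlia.
Qed.

Lemma perm_mono_id (z : 'S_n) :
  (forall i j, j = i.+1 :> nat -> z i < z j) -> z = 1%g.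
Proof.
move=> mono; have ge m i : i = m :> nat -> i <= z i.
  elim: m i => [|m IH] i im; first by rewrite im.
  have mn : m < n by have := ltn_ord i; nlia.
  by have := IH (Ordinal mn) erefl; have := mono (Ordinal mn) i im; rewrite /=; nlia.
have le m i : i + m = n.-1 -> z i <= i.
  elim: m i => [|m IH] i im; first by have := ltn_ord (z i); nlia.
  have mn : i.+1 < n by nlia.
  by have := IH (Ordinal mn) ltac:(rewrite /=; nlia); have := mono i (Ordinal mn) erefl; rewrite /=; nlia.
apply/permP => i; apply: val_inj; rewrite perm1 /=; apply/eqP; rewrite eqn_leq.
by rewrite (ge i i) // (le (n.-1 - i)) //; have := ltn_ord i; nlia.
Qed.

(** For the converse, an ascent of [x] at adjacent positions whose values are inverted in [y] can be
    swapped while staying below [y]; the number of inversions of [y] missing from [x] decreases. *)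
Lemma weak_leP x y : weak_le x y <-> inv_sub n (oneline x) (oneline y).
Proof.
split.
  move=> /connectP[p]; elim: p x => [|z p IH] x /=; first by move=> _ ->.
  by move=> /andP[/weak_cover_inv_sub xz /IH zy] /zy H a d ad dn /xz-/(_ ad dn)/H; apply.
pose I x := [set p : 'I_n * 'I_n | (p.1 < p.2) && ((x^-1)%g p.2 < (x^-1)%g p.1)].
have [m] := ubnP #|I y :\: I x|; elim: m x => // m IH x sz sub.
have [/existsP[i /existsP[j /and3P[/eqP ij xij yij]]]|/existsPn none] :=
  boolP [exists i : 'I_n, exists j : 'I_n,
    [&& j == i.+1 :> nat, x i < x j & (y^-1)%g (x j) < (y^-1)%g (x i)]].
  have cov : weak_cover x (tperm i j * x)%g.
    by apply/existsP; exists i; apply/existsP; exists j; rewrite ij eqxx xij eqxx.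
  apply: connect_trans (connect1 cov) _.
  have inv_iff (a d : 'I_n) : a < d -> ((tperm i j * x)^-1)%g d < ((tperm i j * x)^-1)%g a ->
      (x^-1)%g d < (x^-1)%g a \/ a = x i /\ d = x j.
    move=> ad; rewrite !invMg tpermV !permM.
    have tp k : [\/ k = i /\ tperm i j k = j, k = j /\ tperm i j k = i
      | [/\ k != i, k != j & tperm i j k = k]].
      case: tpermP => [->|->|/eqP ki /eqP kj]; [by apply: Or31|by apply: Or32|by apply: Or33].
    have := tp ((x^-1)%g d); have := tp ((x^-1)%g a).
    case=> [[Ea ->]|[Ea ->]|[ai aj ->]]; case=> [[Ed ->]|[Ed ->]|[di dj ->]];
      rewrite ?Ea ?Ed; try nlia.
    - by right; rewrite -Ea -Ed !permKV.
    - by rewrite -val_eqE /= in di; rewrite -val_eqE /= in dj; nlia.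
    - by rewrite -val_eqE /= in ai; rewrite -val_eqE /= in aj; nlia.
  apply: IH; last first.
    apply/inv_subP => a d ad /(inv_iff _ _ ad)[|[-> ->]] //.
    by move: ad; move/inv_subP: sub; apply.
  suff : I y :\: I (tperm i j * x)%g \proper I y :\: I x by move/proper_card; nlia.
  apply/properP; split; last first.
    exists (x i, x j); rewrite !inE /= ?xij ?yij ?permK ?andbT; first by rewrite -leqNgt ij.
    by rewrite !invMg tpermV !permM !permK tpermL tpermR ij leqnn.
  apply: finset.setDS; apply/fintype.subsetP => -[a d]; rewrite !inE /= => /andP[ad xda]; rewrite ad /=.
  by have /inv_subP := weak_cover_inv_sub cov; apply.
suff -> : x = y by exact: connect0.
(* With no such ascent left, the position in [y] of the entries of [x] increases from each place to
   the next, so [x * y^-1] is the identity. *)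
apply/eqP; rewrite eq_mulgV1; apply/eqP; apply: perm_mono_id => i j ij.
rewrite !permM; have := none i => /existsPn/(_ j); rewrite ij eqxx /=.
have nij : i != j by rewrite -val_eqE /= ij; nlia.
have [xij|xji|/val_inj/perm_inj E] := ltngtP (x i) (x j); last by rewrite E eqxx in nij.
  rewrite /= -leqNgt leq_eqVlt => /orP[|//].
  by rewrite val_eqE (inj_eq perm_inj) (inj_eq perm_inj) (negbTE nij).
by move=> _; move/inv_subP: sub => sub; apply: sub => //; rewrite !permK ij.
Qed.

End Oneline.

Import Order.TTheory GRing.Theory Num.Theory.
Import numFieldTopology.Exports numFieldNormedType.Exports.
Local Open Scope classical_set_scope.
Local Open Scope ring_scope.

(** * The rectangles drawn by [rho] *)

Section Drawing.
Variable R : realType.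
Local Notation pt := (R * R)%type.
Local Notation box := (pt * pt)%type.
Implicit Types (p q : pt) (b : box) (A : set pt).

Lemma natr_le m k : (m <= k)%N -> m%:R <= k%:R :> R.
Proof. by rewrite ler_nat. Qed.

Lemma natrS_le m k : (m < k)%N -> m%:R + 1 <= k%:R :> R.
Proof. by rewrite natr1 ler_nat. Qed.

Lemma natr_pred k : (0 < k)%N -> k.-1%:R = k%:R - 1 :> R.
Proof. by case: k => // k _; rewrite -natr1 addrK. Qed.

Lemma in_boxE b p : in_box b p = [&& b.1.1 <= p.1, p.1 <= b.2.1, b.1.2 <= p.2 & p.2 <= b.2.2].
Proof. by rewrite /in_box -!andbA. Qed.

Lemma filledP n (rs : seq box) p : filled n rs p <->
  [\/ p.1 = 0 /\ 0 <= p.2 <= n%:R, p.2 = 0 /\ 0 <= p.1 <= n%:R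
    | exists2 b, b \in rs & in_box b p].
Proof.
rewrite /filled /= /in_box /=; split.
  move=> /or3P[h|h|/hasP[b]]; [apply: Or31|apply: Or32|by move=> *; apply: Or33; exists b].
    by split; lra.
  by split; lra.
case=> [[h1 h2]|[h1 h2]|[b bin h]]; apply/or3P.
- by apply: Or31; rewrite h1 h2 lexx.
- by apply: Or32; rewrite h1 h2 lexx.
- by apply: Or33; apply/hasP; exists b.
Qed.

Lemma highest_eq A q : A q -> (forall q', A q' -> q'.1 = q.1 /\ q'.2 <= q.2) -> highest A = q.
Proof.
move=> Aq H; apply: xget_unique => [|[y1 y2] [/= Ay Hy]]; first by split=> // q' /H[].
have [/= -> y2q] := H _ Ay; have := Hy _ Aq => q2y.
by rewrite [q]surjective_pairing; congr (_, _); apply/eqP; rewrite eq_le y2q q2y.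
Qed.

Lemma rightmost_eq A q : A q -> (forall q', A q' -> q'.2 = q.2 /\ q'.1 <= q.1) -> rightmost A = q.
Proof.
move=> Aq H; apply: xget_unique => [|[y1 y2] [/= Ay Hy]]; first by split=> // q' /H[].
have [/= -> y2q] := H _ Ay; have := Hy _ Aq => q2y.
by rewrite [q]surjective_pairing; congr (_, _); apply/eqP; rewrite eq_le y2q q2y.
Qed.

Definition tile n (l t r s : nat -> nat) k : box :=
  (((l k)%:R, n%:R - (s k)%:R), ((r k)%:R, n%:R - (t k)%:R)).

Lemma tile_cell n (l t r s : nat -> nat) k i j p : in_cell l t r s k i j ->
  i%:R - 1 <= p.1 <= i%:R -> n%:R - j%:R <= p.2 <= n%:R - j%:R + 1 ->
  in_box (tile n l t r s k) p.
Proof.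
move=> /andP[/andP[li ir] /andP[tj js]] h1 h2; rewrite in_boxE /=.
have := natrS_le li; have := natr_le ir; have := natrS_le tj; have := natr_le js.
by move=> *; apply/and4P; split; lra.
Qed.

Section WordDrawing.
Variables (n : nat) (w : seq nat).
Hypothesis w_word : word n w.
Local Notation bx := (tile n (lft w) (top w) (rgt w) (bot w)).
Local Notation T i := (filled n [seq bx k | k <- take i w]).

Lemma filled_takeP i p : T i p <->
  [\/ p.1 = 0 /\ 0 <= p.2 <= n%:R, p.2 = 0 /\ 0 <= p.1 <= n%:R
    | exists2 k, (0 < k <= n)%N && (index k w < i)%N & in_box (bx k) p].
Proof.
rewrite filledP; split=> -[h|h|[b]]; [exact: Or31|exact: Or32| |exact: Or31|exact: Or32|].
  move=> /mapP[k kw ->] kp; apply: Or33; exists k => //.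
  have kw' := mem_take kw; rewrite -(word_mem w_word) kw' /=.
  by rewrite -(in_take _ kw').
move=> /andP[k_in ki] kp; apply: Or33; exists (bx b) => //; apply/mapP; exists b => //.
by rewrite in_take // (word_mem w_word).
Qed.

Lemma filled_square i p : T i p -> 0 <= p.1 <= n%:R /\ 0 <= p.2 <= n%:R.
Proof.
move=> /filled_takeP[[-> ?]|[-> ?]|[k /andP[k_in _]]].
- by have := ler0n R n; split; lra.
- by have := ler0n R n; split; lra.
rewrite in_boxE /= => /and4P[? ? ? ?].
have := natr_le (rgt_le w_word k_in); have := natr_le (bot_le w_word k_in).
by have := ler0n R (lft w k); have := ler0n R (top w k); split; lra.
Qed.

(** A run of undrawn labels keeps an open quadrant empty: a drawn rectangle with label below [a]
    does not reach column [a], one with label above [b] does not rise into row [b]. *)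
Lemma filled_gap i p (a b : nat) : (0 < a <= b)%N -> (b <= n)%N ->
  (forall x, (a <= x <= b)%N -> (i <= index x w)%N) ->
  T i p -> p.1 <= a%:R - 1 \/ p.2 <= n%:R - b%:R.
Proof.
move=> ab bn gap /filled_takeP[[-> _]|[-> _]|[m /andP[m_in mi]]].
- have a0 : (0 < a)%N by nlia.
  by left; have := natrS_le a0; lra.
- by right; have := natr_le bn; lra.
rewrite in_boxE /= => /and4P[_ mr _ mt].
have [ma|am] := ltnP m a; last have [mb|bm] := leqP m b.
- left; suff : (rgt w m < a)%N by move/natrS_le; lra.
  rewrite ltnNge; apply/negP => ar.
  have := rgt_bef w_word m_in (_ : m < a <= rgt w m)%N; move/(_ ltac:(nlia)).
  by have := gap a ltac:(nlia); rewrite /bef; nlia.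
- by have := gap m ltac:(nlia); nlia.
- right; suff : (b <= top w m)%N by move/natr_le; lra.
  rewrite leqNgt; apply/negP => tb.
  have := top_bef w_word m_in (_ : top w m < b < m)%N; move/(_ ltac:(nlia)).
  by have := gap b ltac:(nlia); rewrite /bef; nlia.
Qed.

(** By [cell_last] and [cell_first], a cell on or right of the diagonal is drawn with the last label
    of its interval, a cell left of the diagonal with the first. *)
Lemma filled_cell i (a b : nat) p : (0 < a <= n)%N -> (0 < b <= n)%N ->
  (if (b <= a)%N then (forall x, (b <= x <= a)%N -> (index x w < i)%N)
   else exists2 x, (a <= x <= b)%N & (index x w < i)%N) ->
  a%:R - 1 <= p.1 <= a%:R -> n%:R - b%:R <= p.2 <= n%:R - b%:R + 1 -> T i p.
Proof.
move=> a_in b_in H h1 h2; apply/filled_takeP/Or33.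
have [_ cov _] := word_tiling w_word; have [k k_in ck] := cov a b a_in b_in.
exists k; last exact: tile_cell ck h1 h2.
rewrite k_in /=; move: H; have [ba|ab] := leqP b a => H.
  have := ck => /(cell_last w_word k_in)-/(_ ltac:(nlia) ltac:(nlia))[kab _].
  by apply: H; nlia.
case: H => x xab xi; have [->//|/eqP kx] := eqVneq k x.
have := ck => /(cell_first w_word k_in)-/(_ ltac:(nlia) ltac:(nlia))[_ kf].
by have := kf x ltac:(nlia) ltac:(nlia); rewrite /bef; nlia.
Qed.

Section Step.
Variables (i k : nat).
Hypotheses (k_in : (0 < k <= n)%N) (ki : index k w = i).

Let befi x : bef w x k = (index x w < i)%N. Proof. by rewrite /bef ki. Qed.

Let nbef x : (x == k) || bef w k x -> (i <= index x w)%N.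
Proof. by move=> /orP[/eqP ->|]; rewrite /bef ?ki //; nlia. Qed.

(** The case distinction of [rho_rect] at [p] thus depends only on the order of [k] and its
    neighbour; [filled_after] does the same for [p']. *)
Lemma filled_before : T i (diag_pt R n k.-1) <-> (k == 1%N) || bef w k.-1 k.
Proof.
have kR : k.-1%:R = k%:R - 1 :> R by apply: natr_pred; nlia.
have knR : k%:R <= n%:R :> R by apply: natr_le; nlia.
split=> [H|/orP[/eqP k1|bk1]].
- rewrite -[X in is_true X](negbK _) negb_or; apply/negP => /andP[/eqP k1].
  rewrite (bef_neg w_word) => [kb||]; [|nlia|nlia].
  have := @filled_gap i _ k.-1 k ltac:(nlia) ltac:(nlia) _ H.
  case=> [x hx||]; rewrite /= ?kR; try lra.
  by apply: nbef; have [//|/eqP xk] := eqVneq x k; rewrite (_ : x = k.-1) //; nlia.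
- by apply/filled_takeP/Or31; rewrite /= k1 /= subr0; split=> //; have := ler0n R n; lra.
- have k1_in := bef_memr w_word k_in bk1.
  apply: (@filled_cell i k.-1 k.-1); rewrite ?leqnn /= ?kR //; [|lra|lra].
  by move=> x hx; rewrite (_ : x = k.-1) -?befi //; nlia.
Qed.

Lemma filled_after : T i (diag_pt R n k) <-> (k == n) || bef w k.+1 k.
Proof.
have knR : k%:R <= n%:R :> R by apply: natr_le; nlia.
have k0R : 0 <= k%:R :> R by [].
split=> [H|/orP[/eqP kn|bk1]].
- rewrite -[X in is_true X](negbK _) negb_or; apply/negP => /andP[/eqP k1].
  rewrite (bef_negr w_word) => [kb||]; [|nlia|nlia].
  have := @filled_gap i _ k k.+1 ltac:(nlia) ltac:(nlia) _ H.
  case=> [x hx||]; rewrite /= -?natr1; try lra.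
  by apply: nbef; have [//|/eqP xk] := eqVneq x k; rewrite (_ : x = k.+1) //; nlia.
- by apply/filled_takeP/Or32; rewrite /= kn; split; lra.
- have k1_in := bef_memr w_word k_in bk1.
  apply: (@filled_cell i k.+1 k.+1); rewrite ?leqnn //= -?natr1; [|lra|lra].
  by move=> x hx; rewrite (_ : x = k.+1) -?befi //; nlia.
Qed.

(** This and the next three corner computations share a scheme: [filled_cell], or a side of the
    square, puts the expected corner into the drawn region, and [filled_gap], or the square itself,
    bounds every competitor. *)
Lemma highest_above : (k == 1%N) || bef w k.-1 k ->
  highest [set q | [/\ T i q, q.1 = k.-1%:R & n%:R - k.-1%:R <= q.2]] =
  ((lft w k)%:R, n%:R - (top w k)%:R).
Proof.
move=> H; have [lk tk] := (lft_lt w k_in, top_lt w k_in).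
have kR : k.-1%:R = k%:R - 1 :> R by apply: natr_pred; nlia.
have knR : k%:R <= n%:R :> R by apply: natr_le; nlia.
have tk0 := ler0n R (top w k).
have -> : lft w k = k.-1.
  have [k1|k1] := eqVneq k 1%N; first nlia.
  rewrite (negbTE k1) /= in H; apply/eqP; rewrite eqn_leq; apply/andP; split; first nlia.
  rewrite leqNgt; apply/negP => l1; have := lft_bef w_word k_in (_ : lft w k < k.-1 < k)%N.
  by move/(_ ltac:(nlia)); apply/negP/bef_asym.
apply: highest_eq => [|q' [/= Tq q1 q2]]; last first.
  split=> //; have [t0|t0] := posnP (top w k).
    by have [_ ?] := filled_square Tq; rewrite t0; lra.
  have := @filled_gap i q' (top w k) (top w k) ltac:(nlia) ltac:(nlia) _ Tq.
  case=> [x hx|h|//].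
    by apply: nbef; rewrite (_ : x = top w k) ?(bef_top w_word) ?orbT //; nlia.
  have : (top w k)%:R <= k.-1%:R :> R by apply: natr_le; nlia.
  by rewrite kR in q1 *; lra.
split; rewrite /= ?lerD2l ?lerN2 ?ler_nat //; last nlia.
have [k1|k1] := eqVneq k 1%N.
  have t0 : top w k = 0%N by nlia.
  by apply/filled_takeP/Or31; rewrite t0 k1 /= subr0; split=> //; have := ler0n R n; lra.
rewrite (negbTE k1) /= in H.
have tk1 : (top w k < k.-1)%N.
  rewrite ltnNge; apply/negP => tk1.
  by have := bef_top w_word k_in; rewrite (_ : top w k = k.-1); [apply/negP/bef_asym|nlia].
apply: (@filled_cell i k.-1 (top w k).+1); rewrite /= -?natr1; try lra; try nlia.
by rewrite tk1 => x hx; rewrite -befi; apply: (top_bef w_word); nlia.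
Qed.

Lemma rightmost_left : ~ ((k == 1%N) || bef w k.-1 k) ->
  rightmost [set q | [/\ T i q, q.2 = n%:R - k.-1%:R & q.1 < k.-1%:R]] =
  ((lft w k)%:R, n%:R - (top w k)%:R).
Proof.
move=> /negP; rewrite negb_or => /andP[k1]; rewrite (bef_neg w_word) => [H||]; [|nlia|nlia].
have [lk tk] := (lft_lt w k_in, top_lt w k_in).
have kR : k.-1%:R = k%:R - 1 :> R by apply: natr_pred; nlia.
have knR : k%:R <= n%:R :> R by apply: natr_le; nlia.
have lk0 := ler0n R (lft w k).
have -> : top w k = k.-1.
  apply/eqP; rewrite eqn_leq; apply/andP; split; first nlia.
  rewrite leqNgt; apply/negP => l1; have := top_bef w_word k_in (_ : top w k < k.-1 < k)%N.
  by move/(_ ltac:(nlia)); apply/negP/bef_asym.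
have lk1 : (lft w k < k.-1)%N.
  rewrite ltnNge; apply/negP => lk1; have El : lft w k = k.-1 by nlia.
  have := @bef_lft w k; rewrite El; move/(_ ltac:(nlia)); apply/negP/bef_asym/H.
have lk1R := natrS_le lk1; rewrite kR in lk1R.
apply: rightmost_eq => [|q' [/= Tq q2 q1]]; last first.
  split=> //.
  have := @filled_gap i q' (lft w k).+1 k ltac:(nlia) ltac:(nlia) _ Tq.
  case=> [x hx||]; rewrite -?natr1; [|lra|lra].
  apply: nbef; have [//|/eqP xk] := eqVneq x k; apply: (lft_bef w_word) => //; nlia.
split; rewrite /= ?ltr_nat //.
have [l0|l0] := posnP (lft w k).
  by apply/filled_takeP/Or31; rewrite l0 /= kR; split; lra.
apply: (@filled_cell i (lft w k) k.-1); rewrite /= ?kR; try lra; try nlia.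
by rewrite leqNgt lk1; exists (lft w k); rewrite -?befi ?bef_lft //; nlia.
Qed.

Lemma highest_below : ~ ((k == n) || bef w k.+1 k) ->
  highest [set q | [/\ T i q, q.1 = k%:R & q.2 < n%:R - k%:R]] =
  ((rgt w k)%:R, n%:R - (bot w k)%:R).
Proof.
move=> /negP; rewrite negb_or => /andP[k1]; rewrite (bef_negr w_word) => [H||]; [|nlia|nlia].
have [rk bk] := (rgt_le w_word k_in, bot_le w_word k_in).
have [rk' bk'] := (rgt_ge w k, bot_ge w k).
have k0R : 0 <= k%:R :> R by []. have knR : k%:R <= n%:R :> R by apply: natr_le; nlia.
have -> : rgt w k = k.
  apply/eqP; rewrite eqn_leq andbC; apply/andP; split; first nlia.
  rewrite leqNgt; apply/negP => l1; have := rgt_bef w_word k_in (_ : k < k.+1 <= rgt w k)%N.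
  by move/(_ ltac:(nlia)); apply/negP/bef_asym.
have bk1 : (k < bot w k)%N.
  rewrite ltnNge; apply/negP => bk1; have El : bot w k = k by nlia.
  have := bef_bot w_word k_in; rewrite El; move/(_ ltac:(nlia)); apply/negP/bef_asym/H.
have bk1R := natrS_le bk1; have bkR := natr_le bk.
apply: highest_eq => [|q' [/= Tq q1 q2]]; last first.
  split=> //.
  have := @filled_gap i q' k (bot w k) ltac:(nlia) ltac:(nlia) _ Tq.
  case=> [x hx||]; [|lra|lra].
  apply: nbef; have [//|/eqP xk] := eqVneq x k; apply: (bot_bef w_word) => //; nlia.
split; rewrite /= ?ltrD2l ?ltrN2 ?ltr_nat //.
have [bn|bn] := eqVneq (bot w k) n.
  by apply/filled_takeP/Or32; rewrite bn /=; split; lra.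
apply: (@filled_cell i k (bot w k).+1); rewrite /= -?natr1; try lra; try nlia.
rewrite leqNgt (_ : (k < (bot w k).+1)%N) /=; last nlia.
by exists (bot w k).+1; rewrite -?befi ?(bef_bot w_word) //; nlia.
Qed.

Lemma rightmost_right : (k == n) || bef w k.+1 k ->
  rightmost [set q | [/\ T i q, q.2 = n%:R - k%:R & k%:R <= q.1]] =
  ((rgt w k)%:R, n%:R - (bot w k)%:R).
Proof.
move=> H; have [rk bk] := (rgt_le w_word k_in, bot_le w_word k_in).
have [rk' bk'] := (rgt_ge w k, bot_ge w k).
have k0R : 0 <= k%:R :> R by []. have knR : k%:R <= n%:R :> R by apply: natr_le; nlia.
have -> : bot w k = k.
  have [kn|kn] := eqVneq k n; first nlia.
  rewrite (negbTE kn) /= in H; apply/eqP; rewrite eqn_leq andbC; apply/andP; split; first nlia.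
  rewrite leqNgt; apply/negP => l1; have := bot_bef w_word k_in (_ : k < k.+1 <= bot w k)%N.
  by move/(_ ltac:(nlia)); apply/negP/bef_asym.
have rkR := natr_le rk; have rkR' := natr_le rk'.
apply: rightmost_eq => [|q' [/= Tq q2 q1]]; last first.
  split=> //; have [rn|rn] := eqVneq (rgt w k) n.
    by have [? _] := filled_square Tq; rewrite rn; lra.
  have := @filled_gap i q' (rgt w k).+1 (rgt w k).+1 ltac:(nlia) ltac:(nlia) _ Tq.
  case=> [x hx||]; rewrite -?natr1; [|lra|lra].
  by apply: nbef; rewrite (_ : x = (rgt w k).+1) ?(bef_rgt w_word) ?orbT //; nlia.
split; rewrite /= ?ler_nat //.
have [kn|kn] := eqVneq k n.
  have rn : rgt w k = n by nlia.
  by apply/filled_takeP/Or32; rewrite /= rn kn; split; lra.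
rewrite (negbTE kn) /= in H.
have rk1 : (k < rgt w k)%N.
  rewrite ltnNge; apply/negP => rk1; have E : rgt w k = k by nlia.
  have := bef_rgt w_word k_in; rewrite E; apply/negP/bef_asym/H.
apply: (@filled_cell i (rgt w k) k.+1); rewrite /= -?natr1; try lra; try nlia.
by rewrite rk1 => x hx; rewrite -befi; apply: (rgt_bef w_word); nlia.
Qed.

Lemma rho_rect_tile : rho_rect n [seq bx j | j <- take i w] k = bx k.
Proof.
rewrite /rho_rect; set tl := (if _ then _ else _); set br := (if _ then _ else _).
have -> : tl = ((lft w k)%:R, n%:R - (top w k)%:R).
  rewrite /tl; case: asboolP => [/filled_before/highest_above <-|H] //.
  by rewrite -rightmost_left // => /filled_before.
have -> // : br = ((rgt w k)%:R, n%:R - (bot w k)%:R).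
rewrite /br; case: asboolP => [/filled_after/rightmost_right <-|H] //.
by rewrite -highest_below // => /filled_after.
Qed.

End Step.

Lemma rho_seq_tiles : rho_seq R n w = [seq bx k | k <- w].
Proof.
suff H i : (i <= n)%N -> rho_seq R n (take i w) = [seq bx k | k <- take i w].
  by have := H (size w); rewrite take_size; apply; rewrite (word_size w_word).
elim: i => [|i IH] i_n; first by rewrite take0.
have sw := word_size w_word; have i_w : (i < size w)%N by rewrite sw.
rewrite (take_nth 0%N) // map_rcons /rho_seq foldl_rcons -/(rho_seq R n _) IH; last nlia.
rewrite rho_rect_tile ?index_uniq ?(word_uniq w_word) //.
by rewrite -(word_mem w_word) mem_nth.
Qed.

End WordDrawing.
End Drawing.

(** * The image of [rho] consists of diagonal rectangulations *)

Section TilesSubdivide.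
Variable R : realType.
Local Notation pt := (R * R)%type.
Local Notation box := (pt * pt)%type.

Lemma real_cell n (x : R) : (0 < n)%N -> 0 <= x <= n%:R ->
  exists2 i, (0 < i <= n)%N & i%:R - 1 <= x <= i%:R.
Proof.
elim: n => // n IH _; rewrite -natr1 => xn; have [n0|n0] := posnP n.
  by exists 1%N => //; rewrite n0 in xn; lra.
have [xn'|xn'] := lerP x n%:R.
  by have [i i_in xi] := IH n0 ltac:(lra); exists i => //; nlia.
by exists n.+1; rewrite -?natr1 ?leqnn //; lra.
Qed.

(** At a non-integer height only vertical sides can pass, and at a non-integer abscissa only
    horizontal ones; such points tell the two kinds apart. *)
Lemma between_nonint (x y : R) : x < y -> exists2 z, x < z < y & forall m : nat, z <> m%:R.
Proof.
move=> xy; have [x0|x0] := ltrP x 0.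
  exists ((x + Num.min y 0) / 2) => [|m]; first by rewrite /Num.min; case: ifP; lra.
  by have := ler0n R m; rewrite /Num.min; case: ifP; lra.
have := truncn_itv x0; set k := Num.truncn x => /andP[kx xk].
rewrite -natr1 in xk; pose u : R := Num.min y (k%:R + 1).
have [xu uy uk] : [/\ x < u, u <= y & u <= k%:R + 1].
  by rewrite /u /Num.min; case: ifP; split; lra.
exists ((x + u) / 2) => [|m E]; first lra.
have [mk|km] := leqP m k; first by have := natr_le R mk; lra.
by have := natrS_le R km; lra.
Qed.

Lemma tiling_boundsR n (l t r s : nat -> nat) k : tiling n l t r s -> (0 < k <= n)%N ->
  [/\ 0 <= (l k)%:R :> R, (l k)%:R + 1 <= k%:R :> R, k%:R <= (r k)%:R :> R &
       (r k)%:R <= n%:R :> R] /\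
  [/\ 0 <= (t k)%:R :> R, (t k)%:R + 1 <= k%:R :> R, k%:R <= (s k)%:R :> R &
       (s k)%:R <= n%:R :> R].
Proof.
move=> [bd _ _] k_in; have [lk tk /andP[rk rn] /andP[sk sn]] := bd k k_in.
by have := (natrS_le R lk, natrS_le R tk, natr_le R rk, natr_le R rn, natr_le R sk, natr_le R sn)
  => -[[[[[? ?] ?] ?] ?] ?]; split.
Qed.

Lemma tiles_subdivision n (l t r s : nat -> nat) (D : {fset box}) : (0 < n)%N ->
  tiling n l t r s ->
  (forall b, b \in D <-> exists2 k, (0 < k <= n)%N & b = tile R n l t r s k) ->
  subdivision (square R n) D.
Proof.
move=> n0 tl memD; have [bd cov inj] := tl; split.
- move=> b /memD[k k_in ->]; have [[? ? ? ?] [? ? ? ?]] := tiling_boundsR tl k_in.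
  by rewrite /is_rect /=; lra.
- move=> p; split=> [|[b /memD[k k_in ->]]]; rewrite !in_boxE /square /=; last first.
    have [[? ? ? ?] [? ? ? ?]] := tiling_boundsR tl k_in; lra.
  move=> /and4P[x0 xn y0 yn].
  have [i i_in xi] := @real_cell n p.1 n0 ltac:(lra).
  have [j j_in yj] := @real_cell n (n%:R - p.2) n0 ltac:(lra).
  have [k k_in ck] := cov i j i_in j_in.
  exists (tile R n l t r s k); first by apply/memD; exists k.
  by apply: (tile_cell ck xi); lra.
- move=> b c /memD[k k_in ->] /memD[m m_in ->] /eqP km; rewrite -subset0 => p []; rewrite /rect_interior /=.
  have [lk tk /andP[rk rn] /andP[sk sn]] := bd k k_in.
  have [lm tm /andP[rm rm'] /andP[sm sm']] := bd m m_in.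
  move=> /andP[/andP[x1 x2] /andP[y1 y2]] /andP[/andP[x3 x4] /andP[y3 y4]].
  have h1 : (l k < r m)%N by rewrite -(ltr_nat R); lra.
  have h2 : (l m < r k)%N by rewrite -(ltr_nat R); lra.
  have h3 : (t k < s m)%N by rewrite -(ltr_nat R); lra.
  have h4 : (t m < s k)%N by rewrite -(ltr_nat R); lra.
  case: km; congr tile; apply: (inj (maxn (l k) (l m)).+1 (maxn (t k) (t m)).+1) => //;
    rewrite /in_cell; nlia.
Qed.

Lemma mem_diag_pts n p : p \in diag_pts R n <->
  exists2 c, (0 < c < n)%N & p = diag_pt R n c.
Proof.
rewrite /diag_pts !inE /=; split=> [/mapP[c]|[c c_n ->]].
  by rewrite mem_iota => c_n ->; exists c => //; nlia.
by apply/mapP; exists c => //; rewrite mem_iota; nlia.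
Qed.

End TilesSubdivide.

(** * Walls of a drawn rectangulation *)

Section WordWalls.
Variables (n : nat) (w : seq nat).
Hypothesis w_word : word n w.

(** The side fixes the order of [k] relative to all labels between it and the line [c], and so the
    order of [c] and [c.+1]. Consequently the sides on one inner grid line all fit into a single
    segment, the future wall. *)
Lemma vertical_side k c : (0 < k <= n)%N -> c = lft w k \/ c = rgt w k -> (0 < c < n)%N ->
  [/\ bef w c c.+1, (bot w k <= bot w c)%N & (top w c.+1 <= top w k)%N].
Proof.
move=> k_in ck c_in; have c_n : (0 < c <= n)%N by nlia.
have c1_n : (0 < c.+1 <= n)%N by nlia.
have [lk rk] := (lft_lt w k_in, rgt_ge w k); have [bk bn] := (bot_ge w k, bot_le w_word k_in).
have cc := bot_ge w c; have tk := top_lt w k_in; have tc := top_lt w c1_n.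
case: ck => E; rewrite E.
  have ck : bef w c k by rewrite E; apply: bef_lft; nlia.
  have k1 : (c.+1 < k)%N -> top w k = k.-1.
    move=> k1; apply/eqP; rewrite eqn_leq; apply/andP; split; first nlia.
    rewrite leqNgt; apply/negP => t1.
    have b1 := top_bef w_word k_in (_ : top w k < k.-1 < k)%N.
    have b2 := lft_bef w_word k_in (_ : lft w k < k.-1 < k)%N.
    by have := bef_asym (b1 ltac:(nlia)); rewrite b2 //; nlia.
  rewrite -E; split.
  - have [->//|/eqP ck1] := eqVneq c.+1 k.
    by apply: (bef_trans ck); apply: (lft_bef w_word k_in); nlia.
  - apply/(botP w_word c_n) => [|e he]; first nlia.
    have [ek|ke|->//] := ltngtP e k; apply: (bef_trans ck).
      by apply: (lft_bef w_word k_in); nlia.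
    by apply: (bot_bef w_word k_in); nlia.
  - have [->//|/eqP ck1] := eqVneq c.+1 k.
    by have := k1 ltac:(nlia); nlia.
have kc : bef w k c.+1 by rewrite E; apply: (bef_rgt w_word).
have ck e : (k <= e <= c)%N -> e = k \/ bef w e k.
  have [->|/eqP ek] := eqVneq e k; first by left.
  by move=> he; right; apply: (rgt_bef w_word k_in); nlia.
rewrite -E; split.
- by have [Ek|bck] := ck c ltac:(nlia); [rewrite {1}Ek|apply: bef_trans bck kc].
- have [->//|/eqP nkc] := eqVneq c k; have kb : (bot w k <= k)%N; last nlia.
  rewrite leqNgt; apply/negP => kb.
  have b1 := bot_bef w_word k_in (_ : k < k.+1 <= bot w k)%N.
  have b2 := rgt_bef w_word k_in (_ : k < k.+1 <= rgt w k)%N.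
  by have := bef_asym (b1 ltac:(nlia)); rewrite b2 //; nlia.
- rewrite -ltnS; apply/(topP w_word c1_n) => // e he.
  have [ek|ke] := ltnP e k.
    by apply: bef_trans kc; apply: (top_bef w_word k_in); nlia.
  by have [->//|ek] := ck e ltac:(nlia); apply: bef_trans ek kc.
Qed.

Lemma horizontal_side k c : (0 < k <= n)%N -> c = top w k \/ c = bot w k -> (0 < c < n)%N ->
  [/\ bef w c.+1 c, (rgt w k <= rgt w c)%N & (lft w c.+1 <= lft w k)%N].
Proof.
move=> k_in ck c_in; have c_n : (0 < c <= n)%N by nlia.
have c1_n : (0 < c.+1 <= n)%N by nlia.
have [lk rk] := (top_lt w k_in, bot_ge w k); have [bk bn] := (rgt_ge w k, rgt_le w_word k_in).
have cc := rgt_ge w c; have tk := lft_lt w k_in; have tc := lft_lt w c1_n.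
case: ck => E; rewrite E.
  have ck : bef w k c by rewrite E; apply: (bef_top w_word).
  have k1 : (c.+1 < k)%N -> lft w k = k.-1.
    move=> k1; apply/eqP; rewrite eqn_leq; apply/andP; split; first nlia.
    rewrite leqNgt; apply/negP => t1.
    have b1 := top_bef w_word k_in (_ : top w k < k.-1 < k)%N.
    have b2 := lft_bef w_word k_in (_ : lft w k < k.-1 < k)%N.
    by have := bef_asym (b1 ltac:(nlia)); rewrite b2 //; nlia.
  rewrite -E; split.
  - have [->//|/eqP ck1] := eqVneq c.+1 k.
    by apply: bef_trans ck; apply: (top_bef w_word k_in); nlia.
  - apply/(rgtP w_word c_n) => [|e he]; first nlia.
    have [ek|ke|->//] := ltngtP e k; apply: bef_trans ck.
      by apply: (top_bef w_word k_in); nlia.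
    by apply: (rgt_bef w_word k_in); nlia.
  - have [->//|/eqP ck1] := eqVneq c.+1 k.
    by have := k1 ltac:(nlia); nlia.
have kc : bef w c.+1 k by rewrite E; apply: (bef_bot w_word k_in); nlia.
have ck e : (k <= e <= c)%N -> e = k \/ bef w k e.
  have [->|/eqP ek] := eqVneq e k; first by left.
  by move=> he; right; apply: (bot_bef w_word k_in); nlia.
rewrite -E; split.
- by have [Ek|bck] := ck c ltac:(nlia); [rewrite {2}Ek|apply: bef_trans kc bck].
- have [->//|/eqP nkc] := eqVneq c k; have kb : (rgt w k <= k)%N; last nlia.
  rewrite leqNgt; apply/negP => kb.
  have b1 := bot_bef w_word k_in (_ : k < k.+1 <= bot w k)%N.
  have b2 := rgt_bef w_word k_in (_ : k < k.+1 <= rgt w k)%N.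
  by have := bef_asym (b1 ltac:(nlia)); rewrite b2 //; nlia.
- rewrite -ltnS; apply/(lftP w_word c1_n) => // e he.
  have [ek|ke] := ltnP e k.
    by apply: (bef_trans kc); apply: (lft_bef w_word k_in); nlia.
  by have [->//|ek] := ck e ltac:(nlia); apply: bef_trans kc ek.
Qed.

(** For [c < j] the vertical wall reaching past row [j] puts [c] before [j.+1], and the horizontal
    wall reaching past column [c] says the opposite; for [j < c] the same happens to [j] and
    [c.+1]. *)
Lemma walls_do_not_cross c j : (0 < c < n)%N -> (0 < j < n)%N ->
  bef w c c.+1 -> bef w j.+1 j ->
  (top w c.+1 < j < bot w c)%N -> (lft w j.+1 < c < rgt w j)%N -> False.
Proof.
move=> c_in j_in cc jj hj hc.
have [c_n c1_n] : (0 < c <= n)%N /\ (0 < c.+1 <= n)%N by nlia.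
have [j_n j1_n] : (0 < j <= n)%N /\ (0 < j.+1 <= n)%N by nlia.
have [cj|jc|E] := ltngtP c j.
- have b1 := bot_bef w_word c_n (_ : c < j.+1 <= bot w c)%N.
  have b2 := lft_bef w_word j1_n (_ : lft w j.+1 < c < j.+1)%N.
  by have := bef_asym (b1 ltac:(nlia)); rewrite b2 //; nlia.
- have b1 := rgt_bef w_word j_n (_ : j < c.+1 <= rgt w j)%N.
  have b2 := top_bef w_word c1_n (_ : top w c.+1 < j < c.+1)%N.
  by have := bef_asym (b1 ltac:(nlia)); rewrite b2 //; nlia.
- by move: jj; rewrite -E; apply/negP/bef_asym.
Qed.

End WordWalls.

Section RhoWalls.
Variables (R : realType) (n : nat) (x : 'S_n).
Hypothesis n0 : (0 < n)%N.
Local Notation w := (oneline x).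
Local Notation pt := (R * R)%type.
Local Notation box := (pt * pt)%type.
Local Notation bx := (tile R n (lft w) (top w) (rgt w) (bot w)).
Local Notation S := (square R n).
Let w_word : word n w := oneline_word x.

Lemma mem_rho b : b \in rho R x <-> exists2 k, (0 < k <= n)%N & b = bx k.
Proof.
rewrite /rho (rho_seq_tiles R w_word) !inE /=; split=> [/mapP[k kw ->]|[k k_in ->]].
  by exists k => //; rewrite -(word_mem w_word).
by apply/mapP; exists k; rewrite ?(word_mem w_word).
Qed.

Lemma rho_subdivision : subdivision S (rho R x).
Proof. exact: tiles_subdivision (word_tiling w_word) mem_rho. Qed.

Lemma skeletonP p : skeleton (rho R x) p <-> exists2 k, (0 < k <= n)%N &
  in_box (bx k) p /\ ([\/ p.1 = (lft w k)%:R | p.1 = (rgt w k)%:R] \/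
    [\/ p.2 = n%:R - (bot w k)%:R | p.2 = n%:R - (top w k)%:R]).
Proof.
split=> [[b /mem_rho[k k_in ->] h]|[k k_in [ib h]]]; last first.
  exists (bx k); first by apply/mem_rho; exists k.
  move: ib h; rewrite /= !in_boxE /= => /and4P[? ? ? ?].
  case=> -[h|h]; rewrite orbF; apply/or4P.
  - by apply: Or43; apply/and4P; split; lra.
  - by apply: Or44; apply/and4P; split; lra.
  - by apply: Or41; apply/and4P; split; lra.
  - by apply: Or42; apply/and4P; split; lra.
exists k => //; have [[? ? ? ?] [? ? ? ?]] := tiling_boundsR R (word_tiling w_word) k_in.
move: h; rewrite /= !in_boxE /= orbF.
case/or4P => /and4P[? ? ? ?]; (split; first by apply/and4P; split; lra).
- by right; left; lra.
- by right; right; lra.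
- by left; left; lra.
- by left; right; lra.
Qed.

Lemma vertical_in_skeleton (a y1 y2 : R) : y1 < y2 ->
  (forall y, y1 <= y <= y2 -> skeleton (rho R x) (a, y)) ->
  (0 <= y1 /\ y2 <= n%:R) /\ exists2 c : nat, a = c%:R &
    [\/ c = 0%N, c = n | [/\ (0 < c < n)%N, bef w c c.+1,
      n%:R - (bot w c)%:R <= y1 & y2 <= n%:R - (top w c.+1)%:R]].
Proof.
move=> y12 sk; split.
  have sq y : y1 <= y <= y2 -> 0 <= y <= n%:R.
    move=> /sk/skeletonP[k k_in []]; rewrite in_boxE /= => /and4P[_ _ ? ?] _.
    have [[? ? ? ?] [? ? ? ?]] := tiling_boundsR R (word_tiling w_word) k_in; lra.
  by have := sq y1 ltac:(lra); have := sq y2 ltac:(lra); lra.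
have side y : y1 < y < y2 -> (forall m : nat, y <> m%:R) -> exists k c,
    [/\ (0 < k <= n)%N, a = c%:R, c = lft w k \/ c = rgt w k &
        n%:R - (bot w k)%:R <= y <= n%:R - (top w k)%:R].
  move=> hy ny; have /skeletonP[k k_in []] := sk y ltac:(lra).
  rewrite in_boxE /= => /and4P[_ _ b1 b2].
  case=> -[E|E].
  - by exists k, (lft w k); split=> //; [left|lra].
  - by exists k, (rgt w k); split=> //; [right|lra].
  - by case: (ny (n - bot w k)%N); rewrite natrB // (bot_le w_word k_in).
  - by case: (ny (n - top w k)%N); rewrite natrB //; have := top_lt w k_in; nlia.
have [y hy ny] := between_nonint y12; have [k [c [k_in ac ck _]]] := side y hy ny.
exists c => //; have cn : (c <= n)%N.
  by case: ck => ->; [have := lft_lt w k_in; nlia|exact: (rgt_le w_word k_in)].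
have [->|c0] := eqVneq c 0%N; first exact: Or31.
have [->|cn'] := eqVneq c n; first exact: Or32.
have c_in : (0 < c < n)%N by nlia.
have side' z : y1 < z < y2 -> (forall m : nat, z <> m%:R) ->
    [/\ bef w c c.+1, n%:R - (bot w c)%:R <= z & z <= n%:R - (top w c.+1)%:R].
  move=> hz nz; have [k' [c' [k'_in ac' ck' hk']]] := side z hz nz.
  have Ec : c' = c by apply/eqP; rewrite -(eqr_nat R) -ac' ac.
  subst c'; have [bc bb tt] := vertical_side w_word k'_in ck' c_in.
  by have := (natr_le R bb, natr_le R tt) => -[? ?]; split=> //; lra.
have [bc _ _] := side' y hy ny; apply: Or33; split=> //.
  (* The bound is known at interior non-integer heights only; if the end point violated it, so would
     such a height nearby. *)
  rewrite leNgt; apply/negP => h; have hlt : y1 < Num.min y2 (n%:R - (bot w c)%:R).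
    by rewrite lt_min y12 h.
  have [z /andP[z1]] := between_nonint hlt; rewrite lt_min => /andP[z2 z3] nz.
  by have [_ + _] := side' z ltac:(lra) nz; lra.
rewrite leNgt; apply/negP => h; have hlt : Num.max y1 (n%:R - (top w c.+1)%:R) < y2.
  by rewrite gt_max y12 h.
have [z /andP[+ z1]] := between_nonint hlt; rewrite gt_max => /andP[z2 z3] nz.
by have [_ _ +] := side' z ltac:(lra) nz; lra.
Qed.

Lemma horizontal_in_skeleton (a y1 y2 : R) : y1 < y2 ->
  (forall y, y1 <= y <= y2 -> skeleton (rho R x) (y, a)) ->
  (0 <= y1 /\ y2 <= n%:R) /\ exists2 c : nat, a = n%:R - c%:R &
    [\/ c = 0%N, c = n | [/\ (0 < c < n)%N, bef w c.+1 c,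
      (lft w c.+1)%:R <= y1 & y2 <= (rgt w c)%:R]].
Proof.
move=> y12 sk; split.
  have sq y : y1 <= y <= y2 -> 0 <= y <= n%:R.
    move=> /sk/skeletonP[k k_in []]; rewrite in_boxE /= => /and4P[? ? _ _] _.
    have [[? ? ? ?] [? ? ? ?]] := tiling_boundsR R (word_tiling w_word) k_in; lra.
  by have := sq y1 ltac:(lra); have := sq y2 ltac:(lra); lra.
have side y : y1 < y < y2 -> (forall m : nat, y <> m%:R) -> exists k c,
    [/\ (0 < k <= n)%N, a = n%:R - c%:R, c = top w k \/ c = bot w k &
        (lft w k)%:R <= y <= (rgt w k)%:R].
  move=> hy ny; have /skeletonP[k k_in []] := sk y ltac:(lra).
  rewrite in_boxE /= => /and4P[b1 b2 _ _].
  case=> -[E|E].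
  - by case: (ny (lft w k)).
  - by case: (ny (rgt w k)).
  - by exists k, (bot w k); split=> //; [right|lra].
  - by exists k, (top w k); split=> //; [left|lra].
have [y hy ny] := between_nonint y12; have [k [c [k_in ac ck _]]] := side y hy ny.
exists c => //; have cn : (c <= n)%N.
  by case: ck => ->; [have := top_lt w k_in; nlia|exact: (bot_le w_word k_in)].
have [->|c0] := eqVneq c 0%N; first exact: Or31.
have [->|cn'] := eqVneq c n; first exact: Or32.
have c_in : (0 < c < n)%N by nlia.
have side' z : y1 < z < y2 -> (forall m : nat, z <> m%:R) ->
    [/\ bef w c.+1 c, (lft w c.+1)%:R <= z & z <= (rgt w c)%:R].
  move=> hz nz; have [k' [c' [k'_in ac' ck' hk']]] := side z hz nz.
  have Ec : c' = c by apply/eqP; rewrite -(eqr_nat R); apply/eqP; lra.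
  subst c'; have [bc bb tt] := horizontal_side w_word k'_in ck' c_in.
  by have := (natr_le R bb, natr_le R tt) => -[? ?]; split=> //; lra.
have [bc _ _] := side' y hy ny; apply: Or33; split=> //.
  rewrite leNgt; apply/negP => h; have hlt : y1 < Num.min y2 (lft w c.+1)%:R.
    by rewrite lt_min y12 h.
  have [z /andP[z1]] := between_nonint hlt; rewrite lt_min => /andP[z2 z3] nz.
  by have [_ + _] := side' z ltac:(lra) nz; lra.
rewrite leNgt; apply/negP => h; have hlt : Num.max y1 (rgt w c)%:R < y2.
  by rewrite gt_max y12 h.
have [z /andP[+ z1]] := between_nonint hlt; rewrite gt_max => /andP[z2 z3] nz.
by have [_ _ +] := side' z ltac:(lra) nz; lra.
Qed.

End RhoWalls.

Section RhoDiagonal.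
Variables (R : realType) (n : nat) (x : 'S_n).
Hypothesis n0 : (0 < n)%N.
Local Notation w := (oneline x).
Local Notation pt := (R * R)%type.
Local Notation box := (pt * pt)%type.
Local Notation bx := (tile R n (lft w) (top w) (rgt w) (bot w)).
Local Notation S := (square R n).
Let w_word : word n w := oneline_word x.

(** The wall through the diagonal point [c]. If vertical, it consists of the right side of rectangle
    [c] and the left side of [c.+1]; if horizontal, of the top side of [c.+1] and the bottom side of
    [c]. *)
Definition rho_wall c : box :=
  if bef w c c.+1 then ((c%:R, n%:R - (bot w c)%:R), (c%:R, n%:R - (top w c.+1)%:R))
  else (((lft w c.+1)%:R, n%:R - c%:R), ((rgt w c)%:R, n%:R - c%:R)).

Lemma in_tile_side k p : (0 < k <= n)%N -> in_box (bx k) p ->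
  [\/ p.1 = (lft w k)%:R | p.1 = (rgt w k)%:R] \/
  [\/ p.2 = n%:R - (bot w k)%:R | p.2 = n%:R - (top w k)%:R] -> skeleton (rho R x) p.
Proof. by move=> k_in kp h; apply/skeletonP; exists k. Qed.

Lemma rho_wall_props c : (0 < c < n)%N ->
  [/\ is_segment (rho_wall c), box_set (rho_wall c) `<=` skeleton (rho R x) &
      in_box (rho_wall c) (diag_pt R n c)].
Proof.
move=> c_in; have [c_n c1_n] : (0 < c <= n)%N /\ (0 < c.+1 <= n)%N by nlia.
rewrite /rho_wall; case: ifP => [cc|/negbT].
  have El : lft w c.+1 = c.
    apply/eqP; rewrite eqn_leq -ltnS (lft_lt w c1_n) /= leqNgt; apply/negP => h.
    by have := lft_bef w_word c1_n (_ : lft w c.+1 < c < c.+1)%N; move/(_ ltac:(nlia)); apply/negP/bef_asym.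
  have Er : rgt w c = c.
    apply/eqP; rewrite eqn_leq rgt_ge andbT leqNgt; apply/negP => h.
    by have := rgt_bef w_word c_n (_ : c < c.+1 <= rgt w c)%N; move/(_ ltac:(nlia)); apply/negP/bef_asym.
  have cb : (c < bot w c)%N.
    by apply/(botP w_word c_n) => [|e he]; [nlia|rewrite (_ : e = c.+1) //; nlia].
  have cbR := natrS_le R cb.
  have bc := tiling_boundsR R (word_tiling w_word) c_n.
  have bc1 := tiling_boundsR R (word_tiling w_word) c1_n.
  have cS : c.+1%:R = c%:R + 1 :> R by rewrite -natr1.
  split.
  - have [_ [_ ? _ _]] := bc1.
    by rewrite /is_segment /vertical /= eqxx /=; apply/orP; right; lra.
  - move=> p; rewrite /box_set /= in_boxE /= => /and4P[? ? ? ?].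
    have [h|h] := lerP p.2 (n%:R - c%:R).
      move: bc => [[_ ? _ _] [_ ? ? _]]; apply: (in_tile_side c_n).
        by rewrite in_boxE /= Er; apply/and4P; split; lra.
      by left; right; rewrite Er; lra.
    move: bc1 => [[_ _ ? _] [_ ? ? _]]; apply: (in_tile_side c1_n).
      by rewrite in_boxE /= El; apply/and4P; split; lra.
    by left; left; rewrite El; lra.
  - have [_ [_ ? _ _]] := bc1.
    by rewrite in_boxE /=; apply/and4P; split; lra.
rewrite (bef_neg w_word) => [cc||]; [|nlia|nlia].
have Et : top w c.+1 = c.
  apply/eqP; rewrite eqn_leq -ltnS (top_lt w c1_n) /= leqNgt; apply/negP => h.
  by have := top_bef w_word c1_n (_ : top w c.+1 < c < c.+1)%N; move/(_ ltac:(nlia)); apply/negP/bef_asym.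
have Eb : bot w c = c.
  apply/eqP; rewrite eqn_leq bot_ge andbT leqNgt; apply/negP => h.
  by have := bot_bef w_word c_n (_ : c < c.+1 <= bot w c)%N; move/(_ ltac:(nlia)); apply/negP/bef_asym.
have cr : (c < rgt w c)%N.
  by apply/(rgtP w_word c_n) => [|e he]; [nlia|rewrite (_ : e = c.+1) //; nlia].
have crR := natrS_le R cr.
have bc := tiling_boundsR R (word_tiling w_word) c_n.
have bc1 := tiling_boundsR R (word_tiling w_word) c1_n.
have cS : c.+1%:R = c%:R + 1 :> R by rewrite -natr1.
split.
- have [[_ ? _ _] _] := bc1.
  by rewrite /is_segment /horizontal /= eqxx /=; apply/orP; left; lra.
- move=> p; rewrite /box_set /= in_boxE /= => /and4P[? ? ? ?].
  have [h|h] := lerP p.1 c%:R.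
    move: bc1 => [[_ ? ? _] [_ _ ? _]]; apply: (in_tile_side c1_n).
      by rewrite in_boxE /= Et; apply/and4P; split; lra.
    by right; right; rewrite Et; lra.
  move: bc => [[_ ? ? _] [_ ? _ _]]; apply: (in_tile_side c_n).
    by rewrite in_boxE /= Eb; apply/and4P; split; lra.
  by right; left; rewrite Eb; lra.
- have [[_ ? _ _] _] := bc1.
  by rewrite in_boxE /=; apply/and4P; split; lra.
Qed.

Lemma rho_wall_diag c j : in_box (rho_wall j) (diag_pt R n c) -> j = c.
Proof.
rewrite in_boxE => h; apply/eqP; rewrite -(eqr_nat R); apply/eqP.
by move: h; rewrite /rho_wall; case: ifP => _ /= h; lra.
Qed.

Lemma side_in_skeleton s : s \in sides S -> box_set s `<=` skeleton (rho R x).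
Proof.
have [_ cov _] := rho_subdivision R x n0.
move=> sS p sp; have inS : in_box S p.
  by move: sS sp; rewrite !inE => /or4P[] /eqP ->; rewrite /box_set /= !in_boxE /= => h; lra.
have [b /mem_rho[k k_in ->] kp] := (cov p).1 inS.
apply: (in_tile_side k_in kp); move: kp sS sp; rewrite in_boxE /= => kp.
have [[? ? ? ?] [? ? ? ?]] := tiling_boundsR R (word_tiling w_word) k_in.
rewrite !inE => /or4P[] /eqP ->; rewrite /box_set /= in_boxE /= => h.
- by right; left; lra.
- by right; right; lra.
- by left; left; lra.
- by left; right; lra.
Qed.

Lemma segment_cases v : is_segment v -> box_set v `<=` skeleton (rho R x) ->
  [\/ exists2 s, s \in sides S & is_segment s /\ box_set v `<=` box_set s
    | exists2 c, (0 < c < n)%N & box_set v `<=` box_set (rho_wall c)].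
Proof.
have nR : 0 < n%:R :> R by rewrite ltr0n.
case: v => -[a1 b1] [a2 b2] /orP[]/=; rewrite /horizontal /vertical /= => /andP[].
  move=> a12 /eqP b12 sk; subst b2.
  have [y hy|sq [c Ea H]] := @horizontal_in_skeleton R n x n0 b1 a1 a2 a12.
    by apply: sk; rewrite /box_set /= in_boxE /=; lra.
  case: H => [c0|cn|[c_in cc h1 h2]].
  - left; exists (top_side S); first by rewrite !inE eqxx orbT.
    split; first by rewrite /is_segment /horizontal /= eqxx andbT nR.
    by move=> p; rewrite /box_set /= !in_boxE /= Ea c0 => h; lra.
  - left; exists (bottom_side S); first by rewrite !inE eqxx.
    split; first by rewrite /is_segment /horizontal /= eqxx andbT nR.
    by move=> p; rewrite /box_set /= !in_boxE /= Ea cn => h; lra.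
  - right; exists c => // p; rewrite /rho_wall ifN ?(bef_asym cc) //.
    by rewrite /box_set /= !in_boxE /= Ea => h; lra.
move=> /eqP a12 b12 sk; subst a2.
have [y hy|sq [c Ea H]] := @vertical_in_skeleton R n x n0 a1 b1 b2 b12.
  by apply: sk; rewrite /box_set /= in_boxE /=; lra.
case: H => [c0|cn|[c_in cc h1 h2]].
- left; exists (left_side S); first by rewrite !inE eqxx !orbT.
  split; first by rewrite /is_segment /vertical /= eqxx nR orbT.
  by move=> p; rewrite /box_set /= !in_boxE /= Ea c0 => h; lra.
- left; exists (right_side S); first by rewrite !inE eqxx !orbT.
  split; first by rewrite /is_segment /vertical /= eqxx nR orbT.
  by move=> p; rewrite /box_set /= !in_boxE /= Ea cn => h; lra.
- right; exists c => // p; rewrite /rho_wall cc.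
  by rewrite /box_set /= !in_boxE /= Ea => h; lra.
Qed.

(** A segment containing the wall contains its diagonal point. The sides of the square miss that
    point and so do the walls of other labels, so [segment_cases] leaves only the wall itself. *)
Lemma rho_wallP v : wall S (rho R x) v <-> exists2 c, (0 < c < n)%N & v = rho_wall c.
Proof.
split=> [[seg sk maxi nS]|[c c_in ->]].
  have [[s sS [segs vs]]|[c c_in vc]] := segment_cases seg sk.
    by move: nS; rewrite -(maxi s segs (side_in_skeleton sS) vs) sS.
  by have [? ? _] := rho_wall_props c_in; exists c => //; rewrite -(maxi (rho_wall c)).
have [seg sk cp] := rho_wall_props c_in.
have c0 : 1 <= c%:R :> R by rewrite ler1n; nlia.
have cn : c%:R + 1 <= n%:R :> R by apply: natrS_le; nlia.
have seg_ends (u : box) : is_segment u -> in_box u u.1 /\ in_box u u.2.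
  by rewrite /is_segment /horizontal /vertical !in_boxE => /orP[/andP[h1 /eqP h2]|/andP[/eqP h1 h2]]; lra.
have [e1 e2] := seg_ends _ seg.
split=> //.
  move=> {}v segv skv cv.
  have [v1 v2] := (cv _ e1, cv _ e2).
  have [[s sS [segs vs]]|[c' c'_in vc]] := segment_cases segv skv.
    exfalso; have := vs _ (cv _ cp); move: sS; rewrite !inE => /or4P[] /eqP ->;
      rewrite /box_set /= !in_boxE /= => *; lra.
  have cc : c' = c by apply: rho_wall_diag; apply: vc; apply: cv.
  subst c'; have [w1 w2] := seg_ends _ segv.
  have := vc _ w1; have := vc _ w2; rewrite /box_set /=.
  move: v1 v2; rewrite /box_set /= !in_boxE.
  move: (rho_wall c) => [[a1 a2] [a3 a4]]; case: v {segv skv cv w1 w2 vc} => [[b1 b2] [b3 b4]] /=.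
  by move=> *; congr ((_, _), (_, _)); lra.
apply/negP; move: cp seg; rewrite !in_boxE /is_segment /horizontal /vertical /rho_wall.
by case: ifP => _; rewrite /= !inE => h hs /or4P[] /eqP []; move=> *; move: hs; lra.
Qed.

Lemma rho_dRec : dRec R n (rho R x).
Proof.
split; first exact: rho_subdivision.
- move=> v v' /rho_wallP[c c_in ->] /rho_wallP[j j_in ->] cj.
  have {}cj : c <> j by move=> E; apply: cj; rewrite E.
  have rev_bef m : (0 < m < n)%N -> bef w m m.+1 = false -> bef w m.+1 m.
    by move=> m_in /negbT; rewrite (bef_neg w_word) //; nlia.
  rewrite -subset0 => p []; rewrite /segment_interior /= !in_boxE.
  rewrite /rho_wall; case: ifP => bc; case: ifP => bj /= /and3P[h1 h2 h3] /and3P[h4 h5 h6].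
  + by apply: cj; apply/eqP; rewrite -(eqr_nat R); apply/eqP; lra.
  + have {}bj := rev_bef j j_in bj.
    have E1 : p.1 = c%:R by lra. have E2 : p.2 = n%:R - j%:R by lra.
    apply: (walls_do_not_cross w_word c_in j_in bc bj).
      have a1 : (j < bot w c)%N.
        rewrite ltn_neqAle -!(ler_nat R) andbC; apply/andP; split; first lra.
        by apply: contraNneq h2 => E; apply/eqP; rewrite [p]surjective_pairing E1 E2 E.
      have a2 : (top w c.+1 < j)%N.
        rewrite ltn_neqAle -!(ler_nat R) andbC; apply/andP; split; first lra.
        by apply: contraNneq h3 => E; apply/eqP; rewrite [p]surjective_pairing E1 E2 E.
      by rewrite a1 a2.
    have a1 : (lft w j.+1 < c)%N.
      rewrite ltn_neqAle -!(ler_nat R) andbC; apply/andP; split; first lra.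
      by apply: contraNneq h5 => E; apply/eqP; rewrite [p]surjective_pairing E1 E2 E.
    have a2 : (c < rgt w j)%N.
      rewrite ltn_neqAle -!(ler_nat R) andbC; apply/andP; split; first lra.
      by apply: contraNneq h6 => E; apply/eqP; rewrite [p]surjective_pairing E1 E2 E.
    by rewrite a1 a2.
  + have {}bc := rev_bef c c_in bc.
    have E1 : p.1 = j%:R by lra. have E2 : p.2 = n%:R - c%:R by lra.
    apply: (walls_do_not_cross w_word j_in c_in bj bc).
      have a1 : (c < bot w j)%N.
        rewrite ltn_neqAle -!(ler_nat R) andbC; apply/andP; split; first lra.
        by apply: contraNneq h5 => E; apply/eqP; rewrite [p]surjective_pairing E1 E2 E.
      have a2 : (top w j.+1 < c)%N.
        rewrite ltn_neqAle -!(ler_nat R) andbC; apply/andP; split; first lra.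
        by apply: contraNneq h6 => E; apply/eqP; rewrite [p]surjective_pairing E1 E2 E.
      by rewrite a1 a2.
    have a1 : (lft w c.+1 < j)%N.
      rewrite ltn_neqAle -!(ler_nat R) andbC; apply/andP; split; first lra.
      by apply: contraNneq h2 => E; apply/eqP; rewrite [p]surjective_pairing E1 E2 E.
    have a2 : (j < rgt w c)%N.
      rewrite ltn_neqAle -!(ler_nat R) andbC; apply/andP; split; first lra.
      by apply: contraNneq h3 => E; apply/eqP; rewrite [p]surjective_pairing E1 E2 E.
    by rewrite a1 a2.
  + by apply: cj; apply/eqP; rewrite -(eqr_nat R); apply/eqP; lra.
- move=> v /rho_wallP[c c_in ->]; exists (diag_pt R n c); first by apply/mem_diag_pts; exists c.
  by case: (rho_wall_props c_in).
- move=> p /mem_diag_pts[c c_in ->]; exists (rho_wall c).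
  split; first by split; [apply/rho_wallP; exists c|case: (rho_wall_props c_in)].
  by move=> v [/rho_wallP[j j_in ->]] /rho_wall_diag ->.
Qed.

End RhoDiagonal.

(** * Diagonal rectangulations are tilings *)

Section IntervalUnion.
Variable R : realType.
Implicit Types (L : seq (R * R)).

Definition in_union L z := has (fun i => i.1 <= z <= i.2) L.

Lemma gap_below (L : seq R) u v : v < u ->
  exists2 z, v < z < u & forall t, t \in L -> t < u -> t < z.
Proof.
elim: L => [|a L IH] vu; first by exists ((v + u) / 2) => //; lra.
have [z hz Hz] := IH vu; have [au|ua] := ltrP a u.
  have mu : Num.max a z < u by rewrite gt_max au; lra.
  exists ((Num.max a z + u) / 2).
    by have : z <= Num.max a z by [rewrite le_max lexx orbT]; lra.
  move=> t; rewrite inE => /orP[/eqP ->|tL] tu.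
    by have : a <= Num.max a z by [rewrite le_max lexx]; lra.
  by have := Hz t tL tu; have : z <= Num.max a z by [rewrite le_max lexx orbT]; lra.
exists z => // t; rewrite inE => /orP[/eqP ->|tL] tu; last exact: Hz.
by have := le_lt_trans ua tu; rewrite ltxx.
Qed.

(** The supremum of the reachable points is attained because there are finitely many intervals: one
    containing a point close enough below it has its right end at or beyond it. *)
Lemma union_extend_up L m y : (forall z, in_union L z -> z <= m) -> in_union L y ->
  exists u, [/\ y <= u, forall z, y <= z <= u -> in_union L z &
    forall v, y <= v -> (forall z, y <= z <= v -> in_union L z) -> v <= u].
Proof.
move=> bd Ly; pose U := [set v | y <= v /\ forall z, y <= z <= v -> in_union L z].
have Uy : U y by split=> // z hz; rewrite (_ : z = y) //; apply: le_anti; lra.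
have hs : has_sup U.
  by split; [exists y|exists m => v [yv Hv]; apply: bd; apply: Hv; rewrite yv lexx].
have ub := sup_upper_bound hs.
have yu : y <= sup U by apply: ub.
have below z : y <= z < sup U -> in_union L z.
  move=> /andP[yz zu]; have [v [yv Hv] zv] := sup_adherent (ltac:(lra) : 0 < sup U - z) hs.
  by apply: Hv; lra.
exists (sup U); split=> // [z /andP[yz]|v yv Hv]; last by apply: ub.
rewrite le_eqVlt => /orP[/eqP ->|zu]; last by apply: below; rewrite yz.
move: yu; rewrite le_eqVlt => /orP[/eqP <- //|yu].
have [v hv Hv] := gap_below [seq i.2 | i <- L] yu.
have /hasP[i iL iv] := below v ltac:(lra).
apply/hasP; exists i => //; have := Hv i.2 (map_f _ iL); case: (ltrP i.2 (sup U)); last by lra.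
by move=> h /(_ isT); lra.
Qed.

Lemma union_extend L m m' y0 y1 : (forall z, in_union L z -> m' <= z <= m) -> y0 <= y1 ->
  (forall z, y0 <= z <= y1 -> in_union L z) ->
  exists u0 u1, [/\ u0 <= y0, y1 <= u1, forall z, u0 <= z <= u1 -> in_union L z &
    forall v0 v1, v0 <= u0 -> u1 <= v1 -> (forall z, v0 <= z <= v1 -> in_union L z) ->
      v0 = u0 /\ v1 = u1].
Proof.
move=> bd y01 H.
have [u1 [h1 H1 M1]] := @union_extend_up L m y1 (fun z Lz => (andP (bd z Lz)).2)
  ltac:(by apply: H; lra).
(* Reflecting the intervals in 0 turns the lower end into an upper one. *)
pose L' := [seq (- i.2, - i.1) | i <- L].
have L'E z : in_union L' z = in_union L (- z).
  by rewrite /in_union has_map; apply: eq_has => i /=; apply/idP/idP; lra.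
have bd' z : in_union L' z -> z <= - m' by rewrite L'E => /bd; lra.
have [u0 [h0 H0 M0]] := @union_extend_up L' (- m') (- y0) bd'
  ltac:(by rewrite L'E; apply: H; lra).
exists (- u0), u1; split=> //; first lra.
  move=> z hz; have [z0|z0] := lerP z y0.
    by have := H0 (- z); rewrite L'E opprK; apply; lra.
  by have [z1|z1] := lerP z y1; [apply: H|apply: H1]; lra.
move=> v0 v1 hv0 hv1 Hv; split.
  have := M0 (- v0) ltac:(lra); suff Hm : forall z, - y0 <= z <= - v0 -> in_union L' z.
    by move=> /(_ Hm); lra.
  by move=> z hz; rewrite L'E; apply: Hv; lra.
have := M1 v1 ltac:(lra); suff Hm : forall z, y1 <= z <= v1 -> in_union L z.
  by move=> /(_ Hm); lra.
by move=> z hz; apply: Hv; lra.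
Qed.

End IntervalUnion.

Section DiagonalTiles.
Variables (R : realType) (n : nat).
Local Notation pt := (R * R)%type.
Local Notation box := (pt * pt)%type.
Variable D : {fset box}.
Hypotheses (n0 : (0 < n)%N) (dD : dRec R n D).
Local Notation S := (square R n).

Lemma box_in_square b : b \in D -> [/\ 0 <= b.1.1, b.1.1 < b.2.1 & b.2.1 <= n%:R] /\
  [/\ 0 <= b.1.2, b.1.2 < b.2.2 & b.2.2 <= n%:R].
Proof.
case: dD => -[rect cov _] _ _ _ bD; have /andP[h1 h2] := rect b bD.
have : in_box S b.1 by apply/cov; exists b; rewrite // in_boxE; lra.
have : in_box S b.2 by apply/cov; exists b; rewrite // in_boxE; lra.
by rewrite !in_boxE /= => *; split; split; lra.
Qed.

(** The trace of the skeleton on a vertical line, as a finite union of closed intervals; horizontal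
    sides that meet the line contribute single points. Maximal intervals of such traces, given by
    [union_extend], are walls. *)
Definition column (a : R) : seq (R * R) :=
  [seq (s.1.2, s.2.2) | s <- flatten [seq sides b | b <- D] & s.1.1 <= a <= s.2.1].

Definition line (a : R) : seq (R * R) :=
  [seq (s.1.1, s.2.1) | s <- flatten [seq sides b | b <- D] & s.1.2 <= a <= s.2.2].

Lemma columnP a z : in_union (column a) z <-> skeleton D (a, z).
Proof.
rewrite /in_union /column has_map has_filter -filter_predI -has_filter; split.
  move=> /hasP[s /flatten_mapP[b bD sb] /= /andP[h1 h2]]; exists b => //.
  by apply/hasP; exists s => //; rewrite in_boxE /=; lra.
case=> b bD /hasP[s sb]; rewrite in_boxE /= => h; apply/hasP; exists s.
  by apply/flatten_mapP; exists b.
by rewrite /=; lra.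
Qed.

Lemma lineP a z : in_union (line a) z <-> skeleton D (z, a).
Proof.
rewrite /in_union /line has_map has_filter -filter_predI -has_filter; split.
  move=> /hasP[s /flatten_mapP[b bD sb] /= /andP[h1 h2]]; exists b => //.
  by apply/hasP; exists s => //; rewrite in_boxE /=; lra.
case=> b bD /hasP[s sb]; rewrite in_boxE /= => h; apply/hasP; exists s.
  by apply/flatten_mapP; exists b.
by rewrite /=; lra.
Qed.

Lemma skeleton_in_box b p : b \in D ->
  has (fun s => in_box s p) (sides b) -> in_box b p.
Proof.
move=> bD; have [[? ? ?] [? ? ?]] := box_in_square bD.
by rewrite /= !in_boxE /= orbF => /or4P[]; lra.
Qed.

Lemma skeleton_in_square p : skeleton D p -> 0 <= p.1 <= n%:R /\ 0 <= p.2 <= n%:R.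
Proof.
move=> [b bD /(skeleton_in_box bD)]; have [[? ? ?] [? ? ?]] := box_in_square bD.
by rewrite in_boxE; lra.
Qed.

Lemma vertical_wall (a y0 y1 : R) : 0 < a < n%:R -> y0 < y1 ->
  (forall z, y0 <= z <= y1 -> skeleton D (a, z)) ->
  exists u0 u1, [/\ u0 <= y0, y1 <= u1 & wall S D ((a, u0), (a, u1))].
Proof.
move=> ha y01 H; have bd z : in_union (column a) z -> 0 <= z <= n%:R.
  by move=> /columnP/skeleton_in_square[].
have [u0 [u1 [h0 h1 Hu M]]] := union_extend bd (ltW y01) (fun z hz => (columnP a z).2 (H z hz)).
exists u0, u1; split=> //; split.
- by rewrite /is_segment /vertical /= eqxx; apply/orP; right; lra.
- move=> [p1 p2]; rewrite /box_set /= in_boxE /= => h.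
  by rewrite (_ : p1 = a); [apply/columnP/Hu|]; lra.
- move=> [[b0 v0] [b1 v1]] seg sk sub.
  have := sub (a, u0); have := sub (a, u1); rewrite /box_set /= !in_boxE /=.
  move=> /(_ ltac:(lra)) h2 /(_ ltac:(lra)) h3.
  move: seg; rewrite /is_segment /horizontal /vertical /= => /orP[/andP[_ /eqP vv]|/andP[/eqP bb _]]; first by exfalso; lra.
  have [E0 E1] : v0 = u0 /\ v1 = u1.
    apply: M; [lra|lra|] => z hz; apply/columnP; apply: sk.
    by rewrite /box_set /= in_boxE /=; lra.
  by rewrite E0 E1; congr ((_, _), (_, _)); lra.
- by apply/negP; rewrite !inE => /or4P[] /eqP [] *; lra.
Qed.

Lemma horizontal_wall (a y0 y1 : R) : 0 < a < n%:R -> y0 < y1 ->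
  (forall z, y0 <= z <= y1 -> skeleton D (z, a)) ->
  exists u0 u1, [/\ u0 <= y0, y1 <= u1 & wall S D ((u0, a), (u1, a))].
Proof.
move=> ha y01 H; have bd z : in_union (line a) z -> 0 <= z <= n%:R.
  by move=> /lineP/skeleton_in_square[].
have [u0 [u1 [h0 h1 Hu M]]] := union_extend bd (ltW y01) (fun z hz => (lineP a z).2 (H z hz)).
exists u0, u1; split=> //; split.
- by rewrite /is_segment /horizontal /= eqxx; apply/orP; left; lra.
- move=> [p1 p2]; rewrite /box_set /= in_boxE /= => h.
  by rewrite (_ : p2 = a); [apply/lineP/Hu|]; lra.
- move=> [[v0 b0] [v1 b1]] seg sk sub.
  have := sub (u0, a); have := sub (u1, a); rewrite /box_set /= !in_boxE /=.
  move=> /(_ ltac:(lra)) h2 /(_ ltac:(lra)) h3.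
  move: seg; rewrite /is_segment /horizontal /vertical /= => /orP[/andP[_ /eqP bb]|/andP[/eqP bb _]]; last by exfalso; lra.
  have [E0 E1] : v0 = u0 /\ v1 = u1.
    apply: M; [lra|lra|] => z hz; apply/lineP; apply: sk.
    by rewrite /box_set /= in_boxE /=; lra.
  by rewrite E0 E1; congr ((_, _), (_, _)); lra.
- by apply/negP; rewrite !inE => /or4P[] /eqP [] *; lra.
Qed.

Lemma vertical_side_wall b a : b \in D -> a = b.1.1 \/ a = b.2.1 -> 0 < a < n%:R ->
  exists u0 u1 i, [/\ wall S D ((a, u0), (a, u1)), u0 <= b.1.2 /\ b.2.2 <= u1,
    (0 < i < n)%N, a = i%:R & u0 <= n%:R - a <= u1].
Proof.
move=> bD ab ha; have [[? ? ?] [? ? ?]] := box_in_square bD.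
have [u0 [u1 [h0 h1 wl]]] : exists u0 u1, [/\ u0 <= b.1.2, b.2.2 <= u1 & wall S D ((a, u0), (a, u1))].
  apply: vertical_wall => // z hz; exists b => //; rewrite /= !in_boxE /= orbF; apply/or4P.
  by case: ab => ab; [apply: Or43|apply: Or44]; rewrite ab; lra.
case: dD => _ _ /(_ _ wl)[p /mem_diag_pts[i i_in ->] +] _; rewrite in_boxE /= => hi.
by exists u0, u1, i; split=> //; lra.
Qed.

Lemma horizontal_side_wall b a : b \in D -> a = b.1.2 \/ a = b.2.2 -> 0 < a < n%:R ->
  exists u0 u1 i, [/\ wall S D ((u0, a), (u1, a)), u0 <= b.1.1 /\ b.2.1 <= u1,
    (0 < i < n)%N, a = n%:R - i%:R & u0 <= n%:R - a <= u1].
Proof.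
move=> bD ab ha; have [[? ? ?] [? ? ?]] := box_in_square bD.
have [u0 [u1 [h0 h1 wl]]] : exists u0 u1, [/\ u0 <= b.1.1, b.2.1 <= u1 & wall S D ((u0, a), (u1, a))].
  apply: horizontal_wall => // z hz; exists b => //; rewrite /= !in_boxE /= orbF; apply/or4P.
  by case: ab => ab; [apply: Or41|apply: Or42]; rewrite ab; lra.
case: dD => _ _ /(_ _ wl)[p /mem_diag_pts[i i_in ->] +] _; rewrite in_boxE /= => hi.
by exists u0, u1, i; split=> //; lra.
Qed.

(** Meeting at an end of a wall is allowed in general, but not at a point of the diagonal set, which
    lies on exactly one wall. *)
Lemma walls_meet a c u0 u1 t0 t1 : wall S D ((a, u0), (a, u1)) ->
  wall S D ((t0, c), (t1, c)) ->
  (u0 < c < u1 /\ t0 < a < t1) \/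
  ((exists2 i, (0 < i < n)%N & (a, c) = diag_pt R n i) /\ u0 <= c <= u1 /\ t0 <= a <= t1) ->
  False.
Proof.
move=> vw hw; have ne : ((a, u0), (a, u1)) <> ((t0, c), (t1, c)).
  case: vw => + _ _ _; rewrite /is_segment /horizontal /vertical /= ltxx /= => /andP[_ u01].
  by move=> [] *; lra.
case: dD => _ disj _ uniqw; case=> [[hc ha]|[[i i_in E] [hc ha]]].
  have := disj _ _ vw hw ne; rewrite -subset0 => /(_ (a, c)); apply.
  split; rewrite /segment_interior /= in_boxE /= !xpair_eqE !eqxx ?andbT /=.
    by apply/and3P; split; [lra|apply/eqP; lra|apply/eqP; lra].
  by apply/and3P; split; [lra|apply/eqP; lra|apply/eqP; lra].
have [v [_ Hv]] := uniqw (a, c) ltac:(by apply/mem_diag_pts; exists i).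
have h1 : in_box ((a, u0), (a, u1)) (a, c) by rewrite in_boxE /=; lra.
have h2 : in_box ((t0, c), (t1, c)) (a, c) by rewrite in_boxE /=; lra.
by apply: ne; rewrite -(Hv _ (conj vw h1)) (Hv _ (conj hw h2)).
Qed.

(** Otherwise the walls through the left and bottom sides would run on, downwards and to the left,
    as far as the diagonal. They would cross at the corner or, if it is on the diagonal, share a
    point of the diagonal set. *)
Lemma bottom_left_below b : b \in D -> b.1.1 + b.1.2 < n%:R.
Proof.
move=> bD; rewrite ltNge; apply/negP => h; have [[? ? ?] [? ? ?]] := box_in_square bD.
have [u0 [u1 [i [vw [? ?] i_in Ei ?]]]] := vertical_side_wall bD (or_introl erefl) ltac:(lra).
have [t0 [t1 [j [hw [? ?] j_in Ej ?]]]] := horizontal_side_wall bD (or_introl erefl) ltac:(lra).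
apply: (walls_meet vw hw); have [E|E] := eqVneq (b.1.1 + b.1.2) n%:R.
  by right; split; [exists i => //; rewrite /diag_pt; congr (_, _); lra|split; lra].
have {}E : n%:R < b.1.1 + b.1.2 by rewrite lt_neqAle eq_sym E.
by left; split; lra.
Qed.

Lemma top_right_above b : b \in D -> n%:R < b.2.1 + b.2.2.
Proof.
move=> bD; rewrite ltNge; apply/negP => h; have [[? ? ?] [? ? ?]] := box_in_square bD.
have [u0 [u1 [i [vw [? ?] i_in Ei ?]]]] := vertical_side_wall bD (or_intror erefl) ltac:(lra).
have [t0 [t1 [j [hw [? ?] j_in Ej ?]]]] := horizontal_side_wall bD (or_intror erefl) ltac:(lra).
apply: (walls_meet vw hw); have [E|E] := eqVneq (b.2.1 + b.2.2) n%:R.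
  by right; split; [exists i => //; rewrite /diag_pt; congr (_, _); lra|split; lra].
have {}E : b.2.1 + b.2.2 < n%:R by rewrite lt_neqAle E.
by left; split; lra.
Qed.

Lemma interior_in_box b c p : b \in D -> c \in D -> rect_interior b p -> in_box c p -> b = c.
Proof.
move=> bD cD.
have mid (x y z t u : R) : x < y < z -> t <= y <= u -> t < u -> exists q, x < q < z /\ t < q < u.
  move=> h1 h2 h3; exists ((Num.max x t + Num.min z u) / 2).
  have mm : Num.max x t < Num.min z u by rewrite gt_max !lt_min; lra.
  have m1 : x <= Num.max x t by rewrite le_max lexx.
  have m2 : t <= Num.max x t by rewrite le_max lexx orbT.
  have m3 : Num.min z u <= z by rewrite ge_min lexx.
  have m4 : Num.min z u <= u by rewrite ge_min lexx orbT.
  by clear h1 h2 h3; split; lra.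
have [[? ? ?] [? ? ?]] := box_in_square cD; have [[? ? ?] [? ? ?]] := box_in_square bD.
rewrite /rect_interior /= in_boxE => h h'; apply/eqP/negPn/negP => bc.
case: dD => -[_ _ /(_ b c bD cD bc)] + _ _ _; rewrite -subset0.
have [q1 [? ?]] := mid b.1.1 p.1 b.2.1 c.1.1 c.2.1 ltac:(lra) ltac:(lra) ltac:(lra).
have [q2 [? ?]] := mid b.1.2 p.2 b.2.2 c.1.2 c.2.2 ltac:(lra) ltac:(lra) ltac:(lra).
by move=> /(_ (q1, q2)); apply; split; rewrite /rect_interior /=; lra.
Qed.

Lemma nat_coordinate b a : b \in D -> a = b.1.1 \/ a = b.2.1 ->
  exists2 i, (i <= n)%N & a = i%:R.
Proof.
move=> bD ab; have [[? ? ?] [? ? ?]] := box_in_square bD.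
have [E0|a0] := eqVneq a 0; first by exists 0%N.
have [En|an] := eqVneq a n%:R; first by exists n.
have [_ [_ [i [_ _ i_in -> _]]]] : exists u0 u1 i, [/\ wall S D ((a, u0), (a, u1)),
    u0 <= b.1.2 /\ b.2.2 <= u1, (0 < i < n)%N, a = i%:R & u0 <= n%:R - a <= u1].
  by apply: vertical_side_wall => //; rewrite !lt_neqAle eq_sym a0 an /=; case: ab => ->; lra.
by exists i => //; case/andP: i_in => _ /ltnW.
Qed.

Lemma nat_ordinate b a : b \in D -> a = b.1.2 \/ a = b.2.2 ->
  exists2 i, (i <= n)%N & a = n%:R - i%:R.
Proof.
move=> bD ab; have [[? ? ?] [? ? ?]] := box_in_square bD.
have [E0|a0] := eqVneq a 0; first by exists n; rewrite ?E0 ?subrr.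
have [En|an] := eqVneq a n%:R; first by exists 0%N; rewrite ?En ?subr0.
have [_ [_ [i [_ _ i_in -> _]]]] : exists u0 u1 i, [/\ wall S D ((u0, a), (u1, a)),
    u0 <= b.1.1 /\ b.2.1 <= u1, (0 < i < n)%N, a = n%:R - i%:R & u0 <= n%:R - a <= u1].
  by apply: horizontal_side_wall => //; rewrite !lt_neqAle eq_sym a0 an /=; case: ab => ->; lra.
by exists i => //; case/andP: i_in => _ /ltnW.
Qed.

(** A diagonal point strictly inside [b] would lie on a wall, hence on a side of some rectangle,
    which [interior_in_box] identifies with [b]. So the rectangle contains a single diagonal
    cell. *)
Lemma box_shape b : b \in D -> exists l t r s k : nat,
  [/\ b = ((l%:R, n%:R - s%:R), (r%:R, n%:R - t%:R)), (r <= n)%N /\ (s <= n)%N,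
      maxn l t = k.-1, minn r s = k & (0 < k)%N].
Proof.
move=> bD; have [[? h1 ?] [? h2 ?]] := box_in_square bD.
have h3 := bottom_left_below bD; have h4 := top_right_above bD.
have [l ln El] := nat_coordinate bD (or_introl erefl).
have [r rn Er] := nat_coordinate bD (or_intror erefl).
have [s sn Es] := nat_ordinate bD (or_introl erefl).
have [t tn Et] := nat_ordinate bD (or_intror erefl).
have lr : (l < r)%N by rewrite -(ltr_nat R); lra.
have ts : (t < s)%N by rewrite -(ltr_nat R); lra.
have ls : (l < s)%N by rewrite -(ltr_nat R); lra.
have tr : (t < r)%N by rewrite -(ltr_nat R); lra.
suff E : (maxn l t).+1 = minn r s.
  exists l, t, r, s, (minn r s); rewrite -E; split=> //.
  by rewrite -El -Er -Es -Et -!surjective_pairing.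
apply/eqP; rewrite eqn_leq; apply/andP; split.
  by rewrite leq_min !gtn_max lr tr ls ts.
rewrite leqNgt; apply/negP; set i := (maxn l t).+1 => im.
have [li ti ri si] : [/\ (l < i)%N, (t < i)%N, (i < r)%N & (i < s)%N].
  by rewrite /i !ltnS leq_maxl leq_maxr; move: im; rewrite leq_min => /andP[].
have i_in : (0 < i < n)%N by rewrite /= (leq_trans ri).
have bp : rect_interior b (diag_pt R n i).
  by move: li ti ri si; rewrite /rect_interior /= Es El Er Et -!(ltr_nat R); lra.
case: dD => _ _ _ /(_ (diag_pt R n i) ltac:(by apply/mem_diag_pts; exists i)).
move=> [v [[[_ sk _ _] vp] _]]; have [c cD cs] := sk _ vp.
have bc := interior_in_box bD cD bp (skeleton_in_box cD cs).
move: cs bp; rewrite -bc /rect_interior /= !in_boxE /= orbF; clear.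
by move=> /or4P[] *; lra.
Qed.

(** The centre of a unit cell is on no grid line, so for it closed box, interior and integer cell
    condition agree. Covering and disjointness of rectangles thus turn into the clauses of
    [tiling]. *)
Lemma dRec_tiling : exists l t r s, tiling n l t r s /\
  forall b, b \in D <-> exists2 k, (0 < k <= n)%N & b = tile R n l t r s k.
Proof.
(* [q] packs the sides as [((l, t), (r, s))]; outside the labels its value is arbitrary. *)
pose P (k : nat) (q : nat * nat * (nat * nat)) := (0 < k <= n)%N ->
  [/\ ((q.1.1%:R, n%:R - q.2.2%:R), (q.2.1%:R, n%:R - q.1.2%:R)) \in D,
   (q.2.1 <= n)%N /\ (q.2.2 <= n)%N, maxn q.1.1 q.1.2 = k.-1 & minn q.2.1 q.2.2 = k].
have center k i j : (0 < i)%N -> (0 < j)%N -> exists p : pt, forall l t r s : nat,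
    [/\ in_box (tile R n (fun=> l) (fun=> t) (fun=> r) (fun=> s) k) p ->
      (l < i <= r)%N && (t < j <= s)%N
    & (l < i <= r)%N && (t < j <= s)%N ->
      rect_interior (tile R n (fun=> l) (fun=> t) (fun=> r) (fun=> s) k) p].
  move=> i0 j0; exists (i%:R - 1/2, n%:R - j%:R + 1/2) => l t r s.
  rewrite in_boxE /rect_interior /=; split.
    move=> /and4P[h1 h2 h3 h4].
    apply/andP; split; apply/andP; split.
    - by rewrite -(ltr_nat R); lra.
    - by rewrite leqNgt; apply/negP => /(natrS_le R); lra.
    - by rewrite -(ltr_nat R); lra.
    - by rewrite leqNgt; apply/negP => /(natrS_le R); lra.
  move=> /andP[/andP[a1 a2] /andP[a3 a4]].
  by have := (natrS_le R a1, natr_le R a2, natrS_le R a3, natr_le R a4) => -[[[? ?] ?] ?]; lra.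
have [_ cov _] := (let: And4 s _ _ _ := dD in s).
have cell_cov i j : (0 < i <= n)%N -> (0 < j <= n)%N -> exists l t r s k : nat,
    [/\ ((l%:R, n%:R - s%:R), (r%:R, n%:R - t%:R)) \in D,
     (r <= n)%N /\ (s <= n)%N, maxn l t = k.-1 /\ minn r s = k, (0 < k)%N
     & (l < i <= r)%N && (t < j <= s)%N].
  move=> i_in j_in; have [p Hp] := center 0%N i j ltac:(nlia) ltac:(nlia).
  have [_ inS] := Hp 0%N 0%N n n.
  have /cov[b bD bp] : in_box S p.
    have : rect_interior (tile R n (fun=> 0%N) (fun=> 0%N) (fun=> n) (fun=> n) 0) p by apply: inS; nlia.
    by rewrite /rect_interior in_boxE /= => h; lra.
  have [l [t [r [s [k [Eb rs mx mn k0]]]]]] := box_shape bD.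
  exists l, t, r, s, k; split=> //; first by rewrite -Eb.
  by apply: (Hp l t r s).1; rewrite /tile -Eb.
have /choice[q Hq] : forall k, exists q, P k q.
  move=> k; have [k_in|k_out] := boolP (0 < k <= n)%N; last by exists ((0, 0), (0, 0))%N => k_in; rewrite k_in in k_out.
  have [l [t [r [s [k' [bD rs [mx mn] k0 hk]]]]]] := cell_cov k k k_in k_in.
  have E : k' = k by nlia.
  by exists ((l, t), (r, s)) => _; split; rewrite /= ?mx ?mn ?E.
have mem_eq l t r s l' t' r' s' i j : (0 < i)%N -> (0 < j)%N ->
    tile R n (fun=> l) (fun=> t) (fun=> r) (fun=> s) 0 \in D ->
    tile R n (fun=> l') (fun=> t') (fun=> r') (fun=> s') 0 \in D ->
    (l < i <= r)%N && (t < j <= s)%N -> (l' < i <= r')%N && (t' < j <= s')%N ->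
    tile R n (fun=> l) (fun=> t) (fun=> r) (fun=> s) 0 =
    tile R n (fun=> l') (fun=> t') (fun=> r') (fun=> s') 0.
  move=> i0 j0 h1 h2 c1 c2; have [p Hp] := center 0%N i j i0 j0.
  apply: (interior_in_box h1 h2 ((Hp l t r s).2 c1)).
  have := (Hp l' t' r' s').2 c2; rewrite /rect_interior in_boxE /=; lra.
exists (fun k => (q k).1.1), (fun k => (q k).1.2), (fun k => (q k).2.1), (fun k => (q k).2.2).
have same l t r s k : (0 < k <= n)%N -> tile R n (fun=> l) (fun=> t) (fun=> r) (fun=> s) 0 \in D ->
    maxn l t = k.-1 -> minn r s = k ->
    tile R n (fun=> l) (fun=> t) (fun=> r) (fun=> s) 0 =
    ((((q k).1.1)%:R, n%:R - ((q k).2.2)%:R), (((q k).2.1)%:R, n%:R - ((q k).1.2)%:R)).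
  move=> k_in bD mx mn; have [qD [rn sn] mxq mnq] := Hq k k_in.
  by apply: (mem_eq _ _ _ _ (q k).1.1 (q k).1.2 (q k).2.1 (q k).2.2 k k) => //; nlia.
split; last first.
  move=> b; split=> [bD|[k k_in ->]]; last by case: (Hq k k_in).
  have [l [t [r [s [k [Eb [rn sn] mx mn k0]]]]]] := box_shape bD.
  have k_in : (0 < k <= n)%N by nlia.
  by exists k => //; rewrite Eb; apply: (same l t r s) => //; rewrite /tile -Eb.
split.
- by move=> k k_in; have [qD [rn sn] mxq mnq] := Hq k k_in; split; nlia.
- move=> i j i_in j_in; have [l [t [r [s [k [bD [rn sn] [mx mn] k0 hk]]]]]] := cell_cov i j i_in j_in.
  have k_in : (0 < k <= n)%N by nlia.
  have [] := same l t r s k k_in bD mx mn.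
  move=> /eqP; rewrite eqr_nat => /eqP El /addrI/oppr_inj/eqP; rewrite eqr_nat => /eqP Es.
  move=> /eqP; rewrite eqr_nat => /eqP Er /addrI/oppr_inj/eqP; rewrite eqr_nat => /eqP Et.
  by exists k => //; rewrite /in_cell -El -Es -Er -Et.
- move=> i j a b a_in b_in ca cb.
  have [aD _ mxa mna] := Hq a a_in; have [bD _ mxb mnb] := Hq b b_in.
  have i0 : (0 < i)%N by move: ca; rewrite /in_cell; nlia.
  have j0 : (0 < j)%N by move: ca; rewrite /in_cell; nlia.
  have [] := mem_eq _ _ _ _ _ _ _ _ i j i0 j0 aD bD ca cb.
  move=> /eqP; rewrite eqr_nat => /eqP El /addrI/oppr_inj/eqP; rewrite eqr_nat => /eqP Es.
  move=> /eqP; rewrite eqr_nat => /eqP Er /addrI/oppr_inj/eqP; rewrite eqr_nat => /eqP Et.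
  by rewrite -mna -mnb Er Es.
Qed.

Theorem rho_surjective : exists2 x : 'S_n, baxter x & rho R x = D.
Proof.
have [l [t [r [s [tl memD]]]]] := dRec_tiling.
have [w [ww bw Ew]] := tiling_baxter_word tl n0.
have [x Ex] := word_oneline ww; exists x; first by apply/baxterP; rewrite Ex.
apply/fsetP => b; apply/idP/idP.
  move=> /mem_rho[k k_in ->]; apply/memD; exists k => //.
  by rewrite /tile Ex; have [-> -> -> ->] := Ew k k_in.
move=> /memD[k k_in ->]; apply/mem_rho; exists k => //.
by rewrite /tile Ex; have [-> -> -> ->] := Ew k k_in.
Qed.

End DiagonalTiles.

(** * The map [beta] *)

Section Boundary.
Variable R : realType.
Local Notation pt := (R * R)%type.
Implicit Types (A : set pt) (p q : pt).

(** The staircase followed by [beta] has the drawn region below and to the left, so escaping in the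
    direction [(1, 1)] is the test that fits. *)
Lemma boundary_intro A p : A p ->
  (forall e, 0 < e -> ~ A (p.1 + e, p.2 + e)) -> boundary A p.
Proof.
move=> Ap out; split; first exact: subset_closure.
move=> /nbhs_ballP[e /= e0 sub]; apply: (out (e / 2)); first lra.
apply: sub; split; rewrite /ball /= /ball_ /=; rewrite opprD addrA subrr add0r normrN gtr0_norm; lra.
Qed.

Lemma closure_quadrant A p (a b : R) : closure A p -> a < p.1 -> b < p.2 ->
  exists2 q, A q & a < q.1 /\ b < q.2.
Proof.
move=> cl ap bp; have [|q [Aq [h1 h2]]] := cl [set q | a < q.1 /\ b < q.2].
  apply/nbhs_ballP; exists (Num.min (p.1 - a) (p.2 - b)) => /=; first by rewrite lt_min; lra.
  move=> [q1 q2] [] /=; rewrite /ball /= /ball_ /= !lt_min !ltr_norml => /andP[h1 _] /andP[_ h2]; lra.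
by exists q.
Qed.

Lemma turn_up_uniq A p q q' : turn_up A p q -> turn_up A p q' -> q = q'.
Proof.
move=> [e1 l1 _ u1 m1] [e2 l2 _ u2 m2]; rewrite [q]surjective_pairing [q']surjective_pairing e1 e2.
congr (_, _); have [h|h|//] := ltrgtP q.1 q'.1.
  by case: (m1 q' e2) => //; rewrite h l2.
by case: (m2 q e1) => //; rewrite h l1.
Qed.

Lemma turn_right_uniq A p q q' : turn_right A p q -> turn_right A p q' -> q = q'.
Proof.
move=> [e1 l1 _ u1 m1] [e2 l2 _ u2 m2]; rewrite [q]surjective_pairing [q']surjective_pairing e1 e2.
congr (_, _); have [h|h|//] := ltrgtP q.2 q'.2.
  by case: (m1 q' e2) => //; rewrite h l2.
by case: (m2 q e1) => //; rewrite h l1.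
Qed.

Lemma real_cell_between (g m : nat) (x : R) : (g < m)%N -> g%:R <= x <= m%:R ->
  exists2 i, (g < i <= m)%N & i%:R - 1 <= x <= i%:R.
Proof.
move=> gm hx; have md : (0 < m - g)%N by nlia.
have [|i i_in hi] := @real_cell R (m - g) (x - g%:R) md; first by rewrite natrB ?(ltnW gm) //; lra.
exists (g + i)%N; first by clear hi hx; nlia.
by rewrite natrD; lra.
Qed.

Lemma nearest_below (P : nat -> Prop) l a : (l < a)%N -> P l ->
  exists m, [/\ (l <= m < a)%N, P m & forall j, (m < j < a)%N -> ~ P j].
Proof.
elim: a => // a IH la Pl; have [Pa|nPa] := pselect (P a).
  by exists a; split=> // [|j]; nlia.
have [E|la'] := eqVneq l a; first by rewrite -E in nPa.
have [m [lm Pm H]] := IH ltac:(nlia) Pl; exists m; split=> // [|j hj]; first nlia.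
by have [->//|/eqP ja] := eqVneq j a; apply: H; nlia.
Qed.

Lemma nearest_above (P : nat -> Prop) a l : (a < l)%N -> P l ->
  exists m, [/\ (a < m <= l)%N, P m & forall j, (a < j < m)%N -> ~ P j].
Proof.
move=> al Pl; pose Q j := `[< P j >].
have exQ : exists j, (a < j)%N && Q j by exists l; rewrite al; apply/asboolP.
case: (ex_minnP exQ) => m /andP[am /asboolP Pm] H; exists m; split=> //.
  by rewrite am H // al; apply/asboolP.
move=> j /andP[aj jm] Pj; have := H j; rewrite aj => /(_ (introT (asboolP _) Pj)); nlia.
Qed.

End Boundary.

(** * Vertices, edges and labels of a drawn rectangulation *)

Section RhoEdges.
Variables (R : realType) (n : nat) (x : 'S_n).
Hypothesis n0 : (0 < n)%N.
Local Notation w := (oneline x).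
Local Notation pt := (R * R)%type.
Local Notation box := (pt * pt)%type.
Local Notation bx := (tile R n (lft w) (top w) (rgt w) (bot w)).
Local Notation D := (rho R x).
Let w_word : word n w := oneline_word x.

Lemma tile_corner k a b : (0 < k <= n)%N -> a = lft w k \/ a = rgt w k ->
  b = top w k \/ b = bot w k -> vertex D (a%:R, n%:R - b%:R).
Proof.
move=> k_in ha hb; exists (bx k); first by apply/mem_rho; exists k.
by rewrite !inE; case: ha => ->; case: hb => ->; rewrite eqxx ?orbT.
Qed.

Lemma vertex_nat v : vertex D v -> exists a b : nat, [/\ v = (a%:R, n%:R - b%:R) & (b <= n)%N].
Proof.
move=> [b /mem_rho[k k_in ->]]; have bn := bot_le w_word k_in; have tk := top_lt w k_in.
have tn : (top w k <= n)%N by nlia.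
rewrite !inE => /or4P[] /eqP ->.
- by exists (lft w k), (bot w k).
- by exists (rgt w k), (bot w k).
- by exists (lft w k), (top w k).
- by exists (rgt w k), (top w k).
Qed.

Lemma natr_inj (a b : nat) : a%:R = b%:R :> R -> a = b.
Proof. by move/eqP; rewrite eqr_nat => /eqP. Qed.

Lemma horizontal_edge k (a b m : nat) : (0 < k <= n)%N -> b = top w k \/ b = bot w k ->
  (lft w k <= a)%N -> (a < m)%N -> (m <= rgt w k)%N ->
  vertex D (a%:R, n%:R - b%:R) -> vertex D (m%:R, n%:R - b%:R) ->
  (forall j, (a < j < m)%N -> ~ vertex D (j%:R, n%:R - b%:R)) ->
  edge D ((a%:R, n%:R - b%:R), (m%:R, n%:R - b%:R)) /\
  horizontal ((a%:R, n%:R - b%:R), (m%:R, n%:R - b%:R) : pt).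
Proof.
move=> k_in hb la am mr va vm none.
have [[laR amR] mrR] := (natr_le R la, natrS_le R am, natr_le R mr).
have hor : horizontal ((a%:R, n%:R - b%:R), (m%:R, n%:R - b%:R) : pt).
  by rewrite /horizontal /= eqxx andbT; lra.
split=> //; split=> //; first by rewrite /is_segment hor.
  exists (bx k); first by apply/mem_rho; exists k.
  exists (if b == top w k then top_side (bx k) else bottom_side (bx k)).
    by rewrite !inE; case: ifP; rewrite eqxx ?orbT.
  move=> p; rewrite /box_set /= in_boxE /= => h.
  have [E|E] := eqVneq b (top w k); first by rewrite in_boxE /= -E; lra.
  by case: hb => E'; [case/eqP: E|rewrite in_boxE /= -E'; lra].
move=> v vv; have [j [b' [Ev b'n]]] := vertex_nat vv; rewrite /segment_interior /= in_boxE Ev /=.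
move=> /and3P[/and4P[h1 h2 h3 h4] h5 h6].
have Eb : b' = b by apply: natr_inj; lra.
subst b'; apply: (none j); last by rewrite -Ev.
move: h5 h6; rewrite !xpair_eqE !eqxx !andbT !eqr_nat => h5 h6.
by rewrite !ler_nat in h1 h2; rewrite !ltn_neqAle h1 h2 h6 eq_sym h5.
Qed.

Lemma vertical_edge k (a b m : nat) : (0 < k <= n)%N -> a = lft w k \/ a = rgt w k ->
  (top w k <= b)%N -> (b < m)%N -> (m <= bot w k)%N ->
  vertex D (a%:R, n%:R - b%:R) -> vertex D (a%:R, n%:R - m%:R) ->
  (forall j, (b < j < m)%N -> ~ vertex D (a%:R, n%:R - j%:R)) ->
  edge D ((a%:R, n%:R - m%:R), (a%:R, n%:R - b%:R)) /\
  vertical ((a%:R, n%:R - m%:R), (a%:R, n%:R - b%:R) : pt).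
Proof.
move=> k_in hb la am mr va vm none.
have [[laR amR] mrR] := (natr_le R la, natrS_le R am, natr_le R mr).
have hor : vertical ((a%:R, n%:R - m%:R), (a%:R, n%:R - b%:R) : pt).
  by rewrite /vertical /= eqxx /=; lra.
split=> //; split=> //; first by rewrite /is_segment hor orbT.
  exists (bx k); first by apply/mem_rho; exists k.
  exists (if a == lft w k then left_side (bx k) else right_side (bx k)).
    by rewrite !inE; case: ifP; rewrite eqxx ?orbT.
  move=> p; rewrite /box_set /= in_boxE /= => h.
  have [E|E] := eqVneq a (lft w k); first by rewrite in_boxE /= -E; lra.
  by case: hb => E'; [case/eqP: E|rewrite in_boxE /= -E'; lra].
move=> v vv; have [a' [j [Ev b'n]]] := vertex_nat vv; rewrite /segment_interior /= in_boxE Ev /=.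
move=> /and3P[/and4P[h1 h2 h3 h4] h5 h6].
have Eb : a' = a by apply: natr_inj; lra.
subst a'; apply: (none j); last by rewrite -Ev.
have jb : j <> b by move=> E; move: h6; rewrite E eqxx.
have jm : j <> m by move=> E; move: h5; rewrite E eqxx.
have bj : (b <= j)%N by rewrite -(ler_nat R); lra.
have mj : (j <= m)%N by rewrite -(ler_nat R); lra.
by clear - jb jm bj mj; nlia.
Qed.

(** The edge runs to the nearest vertex on the left along the side of rectangle [k]; the corner of
    [k] guarantees that there is one. *)
Lemma edge_left_tile k (a b : nat) : (0 < k <= n)%N -> b = top w k \/ b = bot w k ->
  (lft w k < a <= rgt w k)%N -> vertex D (a%:R, n%:R - b%:R) ->
  edge_left D (a%:R, n%:R - b%:R).
Proof.
move=> k_in hb /andP[la ar] va.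
have [m [/andP[lm ma] vm none]] := @nearest_below (fun j => vertex D (j%:R, n%:R - b%:R))
  _ _ la (tile_corner k_in (or_introl erefl) hb).
have [ed hor] := horizontal_edge k_in hb lm ma ar vm va none.
by exists ((m%:R, n%:R - b%:R), (a%:R, n%:R - b%:R)).
Qed.

Lemma edge_right_tile k (a b : nat) : (0 < k <= n)%N -> b = top w k \/ b = bot w k ->
  (lft w k <= a < rgt w k)%N -> vertex D (a%:R, n%:R - b%:R) ->
  edge_right D (a%:R, n%:R - b%:R).
Proof.
move=> k_in hb /andP[la ar] va.
have [m [/andP[am mr] vm none]] := @nearest_above (fun j => vertex D (j%:R, n%:R - b%:R))
  _ _ ar (tile_corner k_in (or_intror erefl) hb).
have [ed hor] := horizontal_edge k_in hb la am mr va vm none.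
by exists ((a%:R, n%:R - b%:R), (m%:R, n%:R - b%:R)).
Qed.

Lemma edge_up_tile k (a b : nat) : (0 < k <= n)%N -> a = lft w k \/ a = rgt w k ->
  (top w k < b <= bot w k)%N -> vertex D (a%:R, n%:R - b%:R) ->
  edge_up D (a%:R, n%:R - b%:R).
Proof.
move=> k_in ha /andP[la ar] va.
have [m [/andP[lm ma] vm none]] := @nearest_below (fun j => vertex D (a%:R, n%:R - j%:R))
  _ _ la (tile_corner k_in ha (or_introl erefl)).
have [ed hor] := vertical_edge k_in ha lm ma ar vm va none.
by exists ((a%:R, n%:R - b%:R), (a%:R, n%:R - m%:R)).
Qed.

Lemma edge_down_tile k (a b : nat) : (0 < k <= n)%N -> a = lft w k \/ a = rgt w k ->
  (top w k <= b < bot w k)%N -> vertex D (a%:R, n%:R - b%:R) ->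
  edge_down D (a%:R, n%:R - b%:R).
Proof.
move=> k_in ha /andP[la ar] va.
have [m [/andP[am mr] vm none]] := @nearest_above (fun j => vertex D (a%:R, n%:R - j%:R))
  _ _ ar (tile_corner k_in ha (or_intror erefl)).
have [ed hor] := vertical_edge k_in ha la am mr va vm none.
by exists ((a%:R, n%:R - m%:R), (a%:R, n%:R - b%:R)).
Qed.

Lemma edge_right_elim (a b : nat) : edge_right D (a%:R, n%:R - b%:R) ->
  exists k, [/\ (0 < k <= n)%N, b = top w k \/ b = bot w k & (lft w k <= a < rgt w k)%N].
Proof.
move=> [[s1 s2] [[_ _ [c /mem_rho[k k_in ->] [s' s'c sub]] _] /andP[/= h1 /eqP h2] E]].
rewrite /= in E; subst s1; rewrite /= in h1 h2.
have := sub (a%:R, n%:R - b%:R); have := sub s2; rewrite /box_set /= !in_boxE /=.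
move=> /(_ ltac:(lra)) e2 /(_ ltac:(lra)) e1; exists k; split=> //.
  move: s'c e1 e2; rewrite !inE => /or4P[] /eqP -> /= e1 e2.
  - by right; apply: natr_inj; lra.
  - by left; apply: natr_inj; lra.
  - by exfalso; lra.
  - by exfalso; lra.
have [l1 l2] : (lft w k)%:R <= a%:R :> R /\ a%:R < (rgt w k)%:R :> R.
  have [[? ? ? ?] _] := tiling_boundsR R (word_tiling w_word) k_in.
  by move: s'c e1 e2; rewrite !inE => /or4P[] /eqP -> /= e1 e2; lra.
by rewrite ler_nat in l1; rewrite ltr_nat in l2; rewrite l1 l2.
Qed.

Lemma edge_up_elim (a b : nat) : edge_up D (a%:R, n%:R - b%:R) ->
  exists k, [/\ (0 < k <= n)%N, a = lft w k \/ a = rgt w k & (top w k < b <= bot w k)%N].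
Proof.
move=> [[s1 s2] [[_ _ [c /mem_rho[k k_in ->] [s' s'c sub]] _] /andP[/= /eqP h1 h2] E]].
rewrite /= in E; subst s1; rewrite /= in h1 h2.
have := sub (a%:R, n%:R - b%:R); have := sub s2; rewrite /box_set /= !in_boxE /=.
move=> /(_ ltac:(lra)) e2 /(_ ltac:(lra)) e1; exists k; split=> //.
  move: s'c e1 e2; rewrite !inE => /or4P[] /eqP -> /= e1 e2.
  - by exfalso; lra.
  - by exfalso; lra.
  - by left; apply: natr_inj; lra.
  - by right; apply: natr_inj; lra.
have [l1 l2] : (top w k)%:R < b%:R :> R /\ b%:R <= (bot w k)%:R :> R.
  have [_ [? ? ? ?]] := tiling_boundsR R (word_tiling w_word) k_in.
  by move: s'c e1 e2; rewrite !inE => /or4P[] /eqP -> /= e1 e2; lra.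
by rewrite ltr_nat in l1; rewrite ler_nat in l2; rewrite l1 l2.
Qed.

Lemma tile_inj j k : (0 < j <= n)%N -> (0 < k <= n)%N -> lft w j = lft w k ->
  bot w j = bot w k -> j = k.
Proof.
move=> j_in k_in El Eb; have tl := word_tiling w_word.
have [? ? ? ?] := tiling_bounds tl j_in; have [? ? ? ?] := tiling_bounds tl k_in.
by apply: (tiling_eq tl (i := (lft w k).+1) (j := bot w k)) => //; rewrite /in_cell; nlia.
Qed.

Lemma bottom_left_inj j k : (0 < j <= n)%N -> (0 < k <= n)%N ->
  bottom_left (bx j) = bottom_left (bx k) -> j = k.
Proof.
move=> j_in k_in [E1 E2]; apply: tile_inj => //; apply: natr_inj => //.
by move/oppr_inj: (addrI _ E2).
Qed.

(** One of the left and top sides is at [k.-1] and one of the right and bottom sides at [k], which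
    confines the diagonal to its [k]-th piece. *)
Lemma tile_diag k (u : R) : (0 < k <= n)%N ->
  rect_interior (bx k) (u, n%:R - u) <-> k%:R - 1 < u < k%:R.
Proof.
move=> k_in; have tl := word_tiling w_word.
have [lb tb rb sb] := tiling_bounds tl k_in.
have b1 := tiling_before tl k_in; have b2 := tiling_after tl k_in.
have kR : k.-1%:R = k%:R - 1 :> R by apply: natr_pred; nlia.
have h1 : lft w k = k.-1 \/ top w k = k.-1 by nlia.
have h2 : rgt w k = k \/ bot w k = k by nlia.
have [[? ? ? ?] [? ? ? ?]] := tiling_boundsR R tl k_in.
rewrite /rect_interior /=; split=> h; last lra.
case: h1 => h1; case: h2 => h2; move: h; rewrite ?h1 ?h2 kR; lra.
Qed.

Lemma met_beforeP j k : (0 < j <= n)%N -> (0 < k <= n)%N ->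
  met_before n (bx j) (bx k) <-> (j < k)%N.
Proof.
move=> j_in k_in; split=> [H|jk t u /(tile_diag _ j_in) ht /(tile_diag _ k_in) hu].
  rewrite ltnNge; apply/negP => /(natr_le R) kj.
  have hj : rect_interior (bx j) (j%:R - 1/2, n%:R - (j%:R - 1/2)) by apply/tile_diag => //; lra.
  have hk : rect_interior (bx k) (k%:R - 1/2, n%:R - (k%:R - 1/2)) by apply/tile_diag => //; lra.
  by have := H _ _ hj hk; lra.
by have := natrS_le R jk; lra.
Qed.

Lemma label_tile k : (0 < k <= n)%N -> label n D (bx k) = k.
Proof.
move=> k_in; rewrite /label; have := @mem_rho R n x; move: (rho R x) => E memE.
have -> : [fset c in E | `[< met_before n c (bx k) >]]%fset =
    [fset b in [seq bx j | j <- iota 1 k.-1]]%fset.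
  apply/fsetP => b; rewrite !inE /=; apply/andP/mapP.
    move=> [/memE[j j_in ->] /asboolP/(met_beforeP j_in k_in) jk].
    by exists j => //; rewrite mem_iota; nlia.
  move=> [j]; rewrite mem_iota => hj ->; have j_in : (0 < j <= n)%N by nlia.
  have jE : bx j \in E by apply/memE; exists j.
  by split=> //; apply/asboolP/met_beforeP => //; nlia.
rewrite card_fseq undup_id ?size_map ?size_iota; first nlia.
rewrite map_inj_in_uniq ?iota_uniq // => i j; rewrite !mem_iota => hi hj Eij.
by apply: bottom_left_inj; [nlia|nlia|rewrite Eij].
Qed.

Lemma beta_first_tile : beta_first D = bx (nth 0%N w 0).
Proof.
have sw := word_size w_word; set h := nth 0%N w 0.
have hw : h \in w by rewrite mem_nth // sw.
have h_in : (0 < h <= n)%N by rewrite -(word_mem w_word).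
have ih : index h w = 0%N by rewrite /h index_uniq ?sw // (word_uniq w_word).
have befh e : e <> h -> bef w h e.
  move=> eh; rewrite /bef ih lt0n; apply/eqP => ie; case: eh.
  have ew : e \in w by rewrite -index_mem ie sw.
  by rewrite -(nth_index 0%N ew) ie.
have El : lft w h = 0%N.
  by suff : (lft w h < 1)%N by [nlia]; apply/(lftP w_word h_in) => // e he; apply: befh; nlia.
have Eb : bot w h = n.
  apply/eqP; rewrite eqn_leq bot_le //; apply/(botP w_word h_in) => [|e he]; first nlia.
  by apply: befh; nlia.
apply: xget_unique.
  split; first by apply/mem_rho; exists h.
  have [[? ? ? ?] [? ? ? ?]] := tiling_boundsR R (word_tiling w_word) h_in.
  by rewrite in_boxE /= El Eb; lra.
move=> y [/mem_rho[k k_in ->]]; rewrite in_boxE /= => /and4P[h1 _ h2 _].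
have h3 : (lft w k <= 0)%N by rewrite -(ler_nat R).
have h4 : (n <= bot w k)%N by rewrite -(ler_nat R); lra.
have h5 := bot_le w_word k_in.
by congr (bx _); apply: tile_inj => //; rewrite ?El ?Eb; clear h1 h2; nlia.
Qed.

End RhoEdges.

(** * One step of the inverse procedure *)

Section BetaStep.
Variables (R : realType) (n : nat) (x : 'S_n) (i u k : nat).
Local Notation w := (oneline x).
Local Notation pt := (R * R)%type.
Local Notation box := (pt * pt)%type.
Local Notation bx := (tile R n (lft w) (top w) (rgt w) (bot w)).
Local Notation D := (rho R x).
Local Notation r := (rgt w u).
Local Notation t := (top w u).
Local Notation T := (filled n [seq bx j | j <- take i.+1 w]).
Hypotheses (n0 : (0 < n)%N) (bw : baxter_word n w).
Hypotheses (u_in : (0 < u <= n)%N) (k_in : (0 < k <= n)%N).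
Hypotheses (iu : index u w = i) (ik : index k w = i.+1).
Let w_word : word n w := oneline_word x.
Let rn : (r <= n)%N := rgt_le w_word u_in.
Let ur : (u <= r)%N := rgt_ge w u.
Let tu : (t < u)%N := top_lt w u_in.

(** The labels in []t, r]] form the block of [u]: all are chosen by now, while [t] and [r.+1] are
    not. *)
Let block e : (t < e <= r)%N -> (index e w <= i)%N.
Proof.
move=> he; have [->|/eqP eu] := eqVneq e u; first by rewrite iu.
have : bef w e u.
  have [lt|gt] := ltnP e u; first by apply: (top_bef w_word u_in); nlia.
  by apply: (rgt_bef w_word u_in); nlia.
by rewrite /bef iu; nlia.
Qed.

Let t_out : (i < index t w)%N.
Proof. by have := bef_top w_word u_in; rewrite /bef iu. Qed.

Let r_out : (i < index r.+1 w)%N.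
Proof. by have := bef_rgt w_word u_in; rewrite /bef iu. Qed.

Lemma next_outside_block : (k <= t)%N \/ (r < k)%N.
Proof.
have [|tk] := leqP k t; [by left|right; rewrite ltnNge; apply/negP => kr].
by have := block (e := k) ltac:(nlia); rewrite ik; nlia.
Qed.

Let uk : adjacent w u k. Proof. by rewrite /adjacent iu ik. Qed.

Let later e : e <> k -> (0 < e <= n)%N -> (i < index e w)%N -> bef w k e.
Proof.
move=> ek e_in ie; rewrite -(bef_neg w_word) //; apply/negP; rewrite /bef ik => h.
have E : index e w = index k w by nlia.
have [ew kw] : e \in w /\ k \in w by rewrite !(word_mem w_word).
by case: ek; rewrite -(nth_index 0%N ew) E nth_index.
Qed.

Let p_vertex : vertex D (r%:R, n%:R - t%:R).
Proof. by apply: (tile_corner R u_in); [right|left]. Qed.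

Lemma block_edge_left : edge_left D (r%:R, n%:R - t%:R).
Proof.
by apply: (@edge_left_tile R n x n0 u) => //; [left|have := lft_lt w u_in; nlia].
Qed.

Lemma block_edge_down : edge_down D (r%:R, n%:R - t%:R).
Proof.
by apply: (@edge_down_tile R n x n0 u) => //; [right|have := bot_ge w u; nlia].
Qed.

Section GoLeft.
Hypothesis kt : (k <= t)%N.
Let t_in : (0 < t <= n)%N. Proof. nlia. Qed.
Let tn : (t <= n)%N. Proof. nlia. Qed.

(** If a label [e] between [k] and [t] were already chosen, [e u k t] would be a 2-41-3. *)
Lemma left_bot : bot w k = t.
Proof.
have bk := bot_le w_word k_in; apply/eqP; rewrite eqn_leq; apply/andP; split.
  rewrite leqNgt; apply/negP => tb.
  have b1 := bot_bef w_word k_in (_ : k < t.+1 <= bot w k)%N.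
  by have := b1 ltac:(nlia); have := block (e := t.+1) ltac:(nlia); rewrite /bef ik; nlia.
apply/(botP w_word k_in) => [|e he]; first nlia.
have [->|/eqP et] := eqVneq e t; first by apply: later; nlia.
apply: later; [nlia|nlia|rewrite ltnNge; apply/negP => ie].
have eu : bef w e u.
  rewrite /bef iu ltn_neqAle ie andbT; apply/eqP => E.
  have [ew uw] : e \in w /\ u \in w by rewrite !(word_mem w_word); nlia.
  by have : e = u; [rewrite -(nth_index 0%N ew) E -iu nth_index|nlia].
have kt2 : bef w k t by apply: later => //; nlia.
by have [_] := bw tn eu uk kt2; apply; nlia.
Qed.

(* Entries after [k] stay below [t] until [t] itself is placed. *)
Lemma left_order : r = n \/ bef w t r.+1.
Proof.
have [->|rn'] := eqVneq r n; [by left|right].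
have r1_in : (0 < r.+1 <= n)%N by nlia.
rewrite -(bef_negr w_word) //; [apply/negP => rt|nlia].
have kr : bef w k r.+1 by apply: later => //; nlia.
have [z [z' [[z_in z'_in] zz' [/= zt zt'] iz iz']]] :=
  @word_switch _ _ w_word (fun z => z <= t)%N k r.+1 r1_in kr kt ltac:(nlia).
have zt2 : z <> t by move=> E; move: rt zz' iz'; rewrite /bef /adjacent E; nlia.
have rz' : (r < z')%N.
  rewrite ltnNge; apply/negP => h; have := block (e := z') ltac:(nlia).
  by move: zz' iz; rewrite /adjacent ik; nlia.
have b1 : bef w t.+1 z.
  by have := block (e := t.+1) ltac:(nlia); move: iz; rewrite /bef ik; nlia.
have b2 : bef w z' t by move: rt iz'; rewrite /bef; nlia.
by have [+ _] := bw tn b1 zz' b2; apply; nlia.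
Qed.

(** The block precedes [t], and [left_order] puts [r.+1] after it, so rectangle [t] ends flush with
    the right side of [u]. *)
Lemma left_rgt : rgt w t = r.
Proof.
apply/eqP; rewrite eqn_leq; apply/andP; split.
  case: left_order => [->|tr]; first exact: rgt_le.
  rewrite leqNgt; apply/negP => h.
  have := rgt_bef w_word t_in (_ : t < r.+1 <= rgt w t)%N; move/(_ ltac:(nlia)).
  exact/negP/bef_asym.
apply/(rgtP w_word t_in) => [|e he]; first nlia.
by have := block (e := e) ltac:(nlia); rewrite /bef; move: t_out; nlia.
Qed.

(** By [left_rgt] the vertical wall continues upwards along the right side of rectangle [t]. *)
Lemma left_vertex_block : left_vertex D (r%:R, n%:R - t%:R).
Proof.
split; [exact: block_edge_left| |exact: block_edge_down|].
  apply: (@edge_up_tile R n x n0 t) => //; first by right; rewrite left_rgt.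
  by have := top_lt w t_in; have := bot_ge w t; nlia.
move=> /(edge_right_elim)[m [m_in tm lrm]].
have rn' : (r < n)%N by have := rgt_le w_word m_in; nlia.
have tr : bef w t r.+1 by case: left_order => //; nlia.
case: tm => E.
  have tm : (t < m)%N by rewrite E (top_lt w m_in).
  have [mr|mr] := leqP m r.
    have := rgt_bef w_word m_in (_ : m < r.+1 <= rgt w m)%N; move/(_ ltac:(nlia)).
    by have := block (e := m) ltac:(nlia); rewrite /bef; move: r_out; nlia.
  have mt : bef w m t by rewrite E; apply: (bef_top w_word).
  have rm : r.+1 = m \/ bef w r.+1 m.
    have [|/eqP nm] := eqVneq r.+1 m; [by left|right; apply: (top_bef w_word m_in); nlia].
  have rt : bef w r.+1 t by case: rm => [->|rm] //; apply: bef_trans rm mt.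
  by have := bef_asym rt; rewrite tr.
have mt : (m <= t)%N by rewrite E bot_ge.
have [Em|/eqP mt'] := eqVneq m t; first by move: lrm; rewrite Em left_rgt; nlia.
have b1 := rgt_bef w_word m_in (_ : m < m.+1 <= rgt w m)%N.
have b2 := bot_bef w_word m_in (_ : m < m.+1 <= bot w m)%N.
by have := bef_asym (b1 ltac:(nlia)); rewrite b2 //; nlia.
Qed.

Let g := lft w k.
Let gk : (g < k)%N := lft_lt w k_in.

Lemma left_gap (p : pt) : T p -> p.1 <= g%:R \/ p.2 <= n%:R - t%:R.
Proof.
have ab : (0 < g.+1 <= t)%N by nlia.
have out y : (g.+1 <= y <= t)%N -> (i.+1 <= index y w)%N.
  move=> hy; have [ky|yk|<-] := ltngtP k y; last by rewrite ik.
    by have := bot_bef w_word k_in (e := y); rewrite left_bot /bef ik => /(_ ltac:(nlia)); nlia.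
  by have := lft_bef w_word k_in (e := y); rewrite /bef ik => /(_ ltac:(nlia)); nlia.
move=> /(filled_gap w_word ab tn out).
by rewrite -natr1 addrK.
Qed.

Lemma left_boundary (p : pt) : T p -> g%:R <= p.1 -> n%:R - t%:R <= p.2 -> boundary T p.
Proof.
move=> Tp h1 h2; apply: boundary_intro => // e e0 /left_gap /=; lra.
Qed.

(** The turning point is the lower-left corner of the empty quadrant of [left_gap]; by [left_bot] it
    is also that of rectangle [k]. *)
Lemma left_turn_up : turn_up T (r%:R, n%:R - t%:R) (g%:R, n%:R - t%:R).
Proof.
have gr : (g < r)%N by nlia.
have t1_in : (0 < t.+1 <= n)%N by nlia.
have gn : (g <= n)%N by nlia.
have gt : (g < t)%N by nlia.
have gA : (0 < g)%N -> (index g w < i.+1)%N.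
  by move=> g0; have := bef_lft g0; rewrite /bef ik.
have t1A : (index t.+1 w < i.+1)%N by rewrite ltnS; apply: block; nlia.
have cell_top j : (g < j <= r)%N ->
    (if (t.+1 <= j)%N then (forall y, (t.+1 <= y <= j)%N -> (index y w < i.+1)%N)
     else exists2 y, (j <= y <= t.+1)%N & (index y w < i.+1)%N).
  move=> hj; case: ifP => tj; last by exists t.+1; nlia.
  by move=> y hy; rewrite ltnS; apply: block; nlia.
have cell_left : (0 < g)%N ->
    (if (t <= g)%N then (forall y, (t <= y <= g)%N -> (index y w < i.+1)%N)
     else exists2 y, (g <= y <= t)%N & (index y w < i.+1)%N).
  by move=> g0; rewrite leqNgt gt /=; exists g; [nlia|exact: gA].
have j_rng j : (g < j <= r)%N -> (0 < j <= n)%N by nlia.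
have g_rng : (0 < g)%N -> (0 < g <= n)%N by nlia.
have [tn1 tn0] : (t <= n)%N /\ (0 < t)%N by nlia.
have t1R : t.+1%:R = t%:R + 1 :> R by rewrite -natr1.
have tnR := natr_le R tn1; have t0R := natrS_le R tn0; have grR := natr_le R (ltnW gr).
split=> //.
- move=> [p1 p2]; rewrite /box_set /= in_boxE /= => h; apply: left_boundary => /=; try lra.
  have [j j_in hj] := @real_cell_between R g r p1 gr ltac:(lra).
  by apply: (filled_cell w_word (j_rng j j_in) t1_in (cell_top j j_in)); rewrite /= ?t1R; lra.
(* One unit suffices: the cell in column [g] and row [t] is drawn, or [g = 0] and the left side of
   the square takes its place. *)
- exists 1; first lra.
  move=> [p1 p2]; rewrite /box_set /= in_boxE /= => h; apply: left_boundary => /=; try lra.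
  have [g0|g0] := posnP g.
    by apply/(filled_takeP w_word)/Or31; rewrite /=; move: h; rewrite g0; lra.
  by apply: (filled_cell w_word (g_rng g0) t_in (cell_left g0)); rewrite /=; lra.
(* A vertical piece of boundary right of [g] would bring points of the drawn region into the empty
   quadrant. *)
- move=> q' /= q2 /andP[q1 _] [e e0 sub].
  have [cl _] := sub (q'.1, q'.2 + e) ltac:(by rewrite /box_set /= in_boxE /=; lra).
  have [q Tq [h1 h2]] := @closure_quadrant R _ _ g%:R (n%:R - t%:R) cl q1 ltac:(rewrite /=; lra).
  by have := left_gap Tq; lra.
Qed.

Lemma beta_next_left : beta_next n D [seq bx j | j <- take i.+1 w] (bx u) = Some (bx k).
Proof.
have E : top_right (bx u) = (r%:R, n%:R - t%:R) by [].
rewrite /beta_next E /= ifF; last first.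
  apply/negbTE; rewrite negb_and; apply/orP; right; apply/eqP.
  have tn0 : (0 < t)%N by nlia.
  by have := natrS_le R tn0; lra.
rewrite asboolT; last exact: left_vertex_block.
congr Some; have tup := left_turn_up; apply: xget_unique.
  by split; [apply/mem_rho; exists k|rewrite E /bottom_left /= left_bot].
move=> y [/mem_rho[m m_in ->]]; rewrite E => /(turn_up_uniq tup) Em.
by congr (bx _); apply: (bottom_left_inj (R := R) (x := x) n0) => //; rewrite -Em /bottom_left /= left_bot.
Qed.

End GoLeft.

Section GoRight.
Hypothesis rk : (r < k)%N.
Let r1_in : (0 < r.+1 <= n)%N. Proof. nlia. Qed.
Let r_in : (0 < r <= n)%N. Proof. nlia. Qed.
Let r1n : (r.+1 <= n)%N. Proof. nlia. Qed.
Let rA : (index r w < i.+1)%N. Proof. by rewrite ltnS; apply: block; nlia. Qed.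

(** If a label [e] between [r.+1] and [k] were already chosen, [e u k r.+1] would be a 3-14-2. *)
Lemma right_lft : lft w k = r.
Proof.
apply/eqP; rewrite eqn_leq; apply/andP; split; last first.
  rewrite leqNgt; apply/negP => lr.
  by have := lft_bef w_word k_in (e := r); rewrite /bef ik => /(_ ltac:(nlia)); move: rA; nlia.
rewrite -ltnS; apply/(lftP w_word k_in) => // e he.
have [->|/eqP et] := eqVneq e r.+1; first by apply: later; nlia.
apply: later; [nlia|nlia|rewrite ltnNge; apply/negP => ie].
have eu : bef w e u.
  rewrite /bef iu ltn_neqAle ie andbT; apply/eqP => E.
  have [ew uw] : e \in w /\ u \in w by rewrite !(word_mem w_word); nlia.
  by have : e = u; [rewrite -(nth_index 0%N ew) E -iu nth_index|nlia].
have kr : bef w k r.+1 by apply: later => //; nlia.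
by have [+ _] := bw r1n eu uk kr; apply; nlia.
Qed.

(* Entries after [k] stay above [r.+1] until [r.+1] itself is placed. *)
Lemma right_order : t = 0%N \/ bef w r.+1 t.
Proof.
have [->|t0] := posnP t; [by left|right].
have t_in : (0 < t <= n)%N by nlia.
rewrite -(bef_neg w_word) //; [apply/negP => tr|nlia].
have kr : bef w k t by apply: later => //; nlia.
have [z [z' [[z_in z'_in] zz' [/= zt zt'] iz iz']]] :=
  @word_switch _ _ w_word (fun z => r < z)%N k t t_in kr rk ltac:(nlia).
have zr : z <> r.+1 by move=> E; move: tr zz' iz'; rewrite /bef /adjacent E; nlia.
have tz' : (z' <= t)%N.
  rewrite leqNgt; apply/negP => h; have := block (e := z') ltac:(nlia).
  by move: zz' iz; rewrite /adjacent ik; nlia.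
have b1 : bef w r z by move: iz; rewrite /bef ik; move: rA; nlia.
have b2 : bef w z' r.+1 by move: tr iz'; rewrite /bef; nlia.
by have [_] := bw r1n b1 zz' b2; apply; nlia.
Qed.

Lemma right_top : top w r.+1 = t.
Proof.
apply/eqP; rewrite eqn_leq; apply/andP; split.
  rewrite -ltnS; apply/(topP w_word r1_in) => // e he.
  by have := block (e := e) ltac:(nlia); rewrite /bef; move: r_out; nlia.
case: right_order => [->//|rt]; rewrite leqNgt; apply/negP => h.
have := top_bef w_word r1_in (_ : top w r.+1 < t < r.+1)%N; move/(_ ltac:(nlia)).
exact/negP/bef_asym.
Qed.

Lemma right_not_edge_up : ~ edge_up D (r%:R, n%:R - t%:R).
Proof.
move=> /(edge_up_elim)[m [m_in rm tm]].
have rt : bef w r.+1 t by case: right_order => //; nlia.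
case: rm => E.
  have mr : (r < m)%N by rewrite E (lft_lt w m_in).
  have tm' : bef w t m by apply: (top_bef w_word m_in); nlia.
  have [Em|/eqP nm] := eqVneq m r.+1; first by have := bef_asym rt; rewrite -Em tm'.
  have b1 := lft_bef w_word m_in (_ : lft w m < r.+1 < m)%N.
  have b2 := top_bef w_word m_in (_ : top w m < r.+1 < m)%N.
  by have := bef_asym (b1 ltac:(nlia)); rewrite b2 //; nlia.
have mr : bef w m r.+1 by rewrite E; apply: (bef_rgt w_word).
have mr' : (m <= r)%N by rewrite E rgt_ge.
have [tm'|mt|Em] := ltngtP t m.
- have := top_bef w_word m_in (_ : top w m < t < m)%N; move/(_ ltac:(nlia)).
  by have := block (e := m) ltac:(nlia); rewrite /bef; move: t_out; nlia.
- have b1 := rgt_bef w_word m_in (_ : m < m.+1 <= rgt w m)%N.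
  have b2 := bot_bef w_word m_in (_ : m < m.+1 <= bot w m)%N.
  by have := bef_asym (b1 ltac:(nlia)); rewrite b2 //; nlia.
- by have := bef_asym rt; rewrite Em mr.
Qed.

(** By [right_top] the horizontal wall continues to the right along the top side of rectangle
    [r.+1]. *)
Lemma down_vertex_block : down_vertex D (r%:R, n%:R - t%:R).
Proof.
split; [exact: block_edge_down|exact: block_edge_left| |exact: right_not_edge_up].
apply: (@edge_right_tile R n x n0 r.+1) => //; first by left; rewrite right_top.
by have := lft_lt w r1_in; have := rgt_ge w r.+1; nlia.
Qed.

Let h := bot w k.
Let kh : (k <= h)%N := bot_ge w k.
Let hn : (h <= n)%N := bot_le w_word k_in.

Lemma right_gap (p : pt) : T p -> p.1 <= r%:R \/ p.2 <= n%:R - h%:R.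
Proof.
have ab : (0 < r.+1 <= h)%N by nlia.
have out y : (r.+1 <= y <= h)%N -> (i.+1 <= index y w)%N.
  move=> hy; have [ky|yk|<-] := ltngtP k y; last by rewrite ik.
    by have := bot_bef w_word k_in (e := y); rewrite /bef ik => /(_ ltac:(nlia)); nlia.
  by have := lft_bef w_word k_in (e := y); rewrite right_lft /bef ik => /(_ ltac:(nlia)); nlia.
move=> /(filled_gap w_word ab hn out).
by rewrite -natr1 addrK.
Qed.

Lemma right_boundary (p : pt) : T p -> r%:R <= p.1 -> n%:R - h%:R <= p.2 -> boundary T p.
Proof.
move=> Tp h1 h2; apply: boundary_intro => // e e0 /right_gap /=; lra.
Qed.

Lemma right_turn_right : turn_right T (r%:R, n%:R - t%:R) (r%:R, n%:R - h%:R).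
Proof.
have th : (t < h)%N by nlia.
have hA : (h < n)%N -> (index h.+1 w < i.+1)%N.
  by move=> hn'; have := bef_bot w_word k_in hn'; rewrite /bef ik.
have cell_left j : (t < j <= h)%N ->
    (if (j <= r)%N then (forall y, (j <= y <= r)%N -> (index y w < i.+1)%N)
     else exists2 y, (r <= y <= j)%N & (index y w < i.+1)%N).
  move=> hj; case: ifP => tj; last by exists r; [nlia|exact: rA].
  by move=> y hy; rewrite ltnS; apply: block; nlia.
have cell_bot : (h < n)%N ->
    (if (h.+1 <= r.+1)%N then (forall y, (h.+1 <= y <= r.+1)%N -> (index y w < i.+1)%N)
     else exists2 y, (r.+1 <= y <= h.+1)%N & (index y w < i.+1)%N).
  move=> hn'; rewrite ifF; last by apply/negbTE; nlia.
  by exists h.+1; [nlia|exact: hA].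
have j_rng j : (t < j <= h)%N -> (0 < j <= n)%N by nlia.
have h1_rng : (h < n)%N -> (0 < h.+1 <= n)%N by nlia.
have rn1 : (r < n)%N by nlia.
have hlt : h != n -> (h < n)%N by nlia.
have h1R : h.+1%:R = h%:R + 1 :> R by rewrite -natr1.
have r1R : r.+1%:R = r%:R + 1 :> R by rewrite -natr1.
have hnR := natr_le R hn; have rnR := natrS_le R rn1; have thR := natr_le R (ltnW th).
have r0R := ler0n R r.
split=> //=; first lra.
- move=> [p1 p2]; rewrite /box_set /= in_boxE /= => hp; apply: right_boundary => /=; try lra.
  have [j j_in hj] := @real_cell_between R t h (n%:R - p2) th ltac:(lra).
  by apply: (filled_cell w_word r_in (j_rng j j_in) (cell_left j j_in)); rewrite /=; lra.
- exists 1; first lra.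
  move=> [p1 p2]; rewrite /box_set /= in_boxE /= => hp; apply: right_boundary => /=; try lra.
  have [hn'|/hlt hn'] := eqVneq h n.
    by apply/(filled_takeP w_word)/Or32; rewrite /=; move: hp; rewrite hn'; lra.
  by apply: (filled_cell w_word r1_in (h1_rng hn') (cell_bot hn')); rewrite /= ?h1R ?r1R; lra.
- move=> q' /= q1 /andP[q2 _] [e e0 sub].
  have [cl _] := sub (q'.1 + e, q'.2) ltac:(by rewrite /box_set /= in_boxE /=; lra).
  have [q Tq [h1 h2]] := @closure_quadrant R _ _ r%:R (n%:R - h%:R) cl ltac:(rewrite /=; lra) q2.
  by have := right_gap Tq; lra.
Qed.

Lemma beta_next_right : beta_next n D [seq bx j | j <- take i.+1 w] (bx u) = Some (bx k).
Proof.
have E : top_right (bx u) = (r%:R, n%:R - t%:R) by [].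
rewrite /beta_next E /= ifF; last first.
  apply/negbTE; rewrite negb_and; apply/orP; left; apply/eqP.
  have rn1 : (r < n)%N by nlia.
  by have := natrS_le R rn1; lra.
rewrite asboolF; last by case=> _ /right_not_edge_up.
rewrite asboolT; last exact: down_vertex_block.
congr Some; have tup := right_turn_right; apply: xget_unique.
  by split; [apply/mem_rho; exists k|rewrite E /bottom_left /= right_lft].
move=> y [/mem_rho[m m_in ->]]; rewrite E => /(turn_right_uniq tup) Em.
by congr (bx _); apply: (bottom_left_inj (R := R) (x := x) n0) => //; rewrite -Em /bottom_left /= right_lft.
Qed.

End GoRight.

Lemma beta_next_tile : beta_next n D [seq bx j | j <- take i.+1 w] (bx u) = Some (bx k).
Proof. by case: next_outside_block => h; [apply: beta_next_left|apply: beta_next_right]. Qed.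

End BetaStep.

(** * The inverse procedure on drawn rectangulations *)

Section BetaWord.
Variables (R : realType) (n : nat) (x : 'S_n).
Hypotheses (n0 : (0 < n)%N) (bx : baxter x).
Local Notation w := (oneline x).
Local Notation tl := (tile R n (lft w) (top w) (rgt w) (bot w)).
Let w_word : word n w := oneline_word x.
Let w_size : size w = n := word_size w_word.

Let nth_in i : (i < n)%N -> (0 < nth 0%N w i <= n)%N.
Proof. by move=> i_n; rewrite -(word_mem w_word) mem_nth // w_size. Qed.

Let index_nth i : (i < n)%N -> index (nth 0%N w i) w = i.
Proof. by move=> i_n; rewrite index_uniq ?w_size // (word_uniq w_word). Qed.

Lemma beta_next_last rs : beta_next n (rho R x) rs (tl (nth 0%N w n.-1)) = None.
Proof.
have n1 : (n.-1 < n)%N by nlia.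
set u := nth 0%N w n.-1; have u_in : (0 < u <= n)%N := nth_in n1.
have iu : index u w = n.-1 := index_nth n1.
have befu e : (0 < e <= n)%N -> e <> u -> bef w e u.
  move=> e_in eu; rewrite -(bef_neg w_word u_in (nesym eu)) /bef iu -leqNgt.
  by have := index_mem e w; rewrite (word_mem w_word) e_in w_size; nlia.
have -> : tl u = ((lft w u)%:R, n%:R - (bot w u)%:R, (n%:R, n%:R - 0%:R)).
  have Er : rgt w u = n.
    apply/eqP; rewrite eqn_leq (rgt_le w_word u_in); apply/(rgtP w_word u_in) => [|e he]; first nlia.
    by apply: befu; nlia.
  have Et : top w u = 0%N.
    by suff : (top w u < 1)%N by [nlia]; apply/(topP w_word u_in) => // e he; apply: befu; nlia.
  by rewrite /tile Er Et.
by rewrite /beta_next /= subr0 eqxx.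
Qed.

(** The bound [m] may exceed the number of remaining rectangles, since at the last one [beta_next]
    returns [None] and the list is kept. *)
Lemma beta_seq_rho m i : (i < n)%N -> (n <= i.+1 + m)%N ->
  beta_seq n (rho R x) m [seq tl k | k <- take i.+1 w] (tl (nth 0%N w i)) =
  [seq tl k | k <- w].
Proof.
elim: m i => [|m IH] i i_n nm /=; first by rewrite take_oversize // w_size; nlia.
have [i1|i1] := ltnP i.+1 n; last first.
  rewrite (_ : i = n.-1); last nlia.
  by rewrite beta_next_last take_oversize // w_size; nlia.
rewrite (beta_next_tile R n0 (elimT (baxterP x) bx) (nth_in i_n) (nth_in i1) (index_nth i_n) (index_nth i1)).
rewrite -map_rcons -take_nth ?w_size //; apply: IH => //; nlia.
Qed.

Lemma beta_word_rho : beta_word n (rho R x) = w.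
Proof.
rewrite /beta_word beta_first_tile // (_ : [:: _] = [seq tl k | k <- take 1 w]); last first.
  by rewrite (take_nth 0%N) ?w_size // take0.
rewrite (@beta_seq_rho n 0%N n0 (leqnSn n)).
rewrite -map_comp -[RHS]map_id; apply/eq_in_map => k kw /=.
by rewrite label_tile // -(word_mem w_word).
Qed.

Lemma beta_rho : beta n (rho R x) = x.
Proof.
rewrite /beta beta_word_rho; case: pickP => [y /eqP/oneline_inj -> //|/(_ x)].
by rewrite eqxx.
Qed.

End BetaWord.

(** * Comparison of the orders *)

(** As a set of boxes [rho R x] forgets which label drew which rectangle; the geometric [label]
    recovers it. *)
Lemma rho_eqP (R : realType) n (x y : 'S_n) : (0 < n)%N ->
  rho R x = rho R y <-> same_boxes n (oneline x) (oneline y).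
Proof.
move=> n0; split=> [E k k_in|E].
  set b := tile R n (lft (oneline x)) (top (oneline x)) (rgt (oneline x)) (bot (oneline x)) k.
  have bx : b \in rho R x by apply/mem_rho; exists k.
  have [j j_in Ej] := (mem_rho y b).1 ltac:(by rewrite -E).
  have Ekj : k = j.
    by rewrite -(label_tile R x n0 k_in) -/b Ej E label_tile.
  subst j; case: Ej => El Eb Er Et.
  split; apply: (@natr_inj R) => //.
    by move/oppr_inj: (addrI _ Et).
  by move/oppr_inj: (addrI _ Eb).
apply/fsetP => b; apply/idP/idP => /mem_rho[k k_in ->]; apply/mem_rho; exists k => //;
  by have [El Et Er Eb] := E k k_in; rewrite /tile El Et Er Eb.
Qed.

(** The equation for [oneline (beta n D)] certifies that the default value in [beta] is never taken
    on a diagonal rectangulation. *)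
Theorem corollary8p7 (R : realType) (n : nat) (hn : (0 < n)%N) :
  [/\ forall x : 'S_n, baxter x -> dRec R n (rho R x),
      forall D, dRec R n D ->
        oneline (beta n D) = beta_word n D /\ baxter (beta n D),
      (forall x : 'S_n, baxter x -> beta n (rho R x) = x) /\
      (forall D, dRec R n D -> rho R (beta n D) = D)
    & forall x y : 'S_n, baxter x -> baxter y ->
        (weak_le x y <-> dRec_le n (rho R x) (rho R y))].
Proof.
split=> [x _|D dD||x y bx by_].
- exact: rho_dRec.
- have [x bx <-] := rho_surjective hn dD.
  by rewrite beta_rho // beta_word_rho.
- split=> [x bx|D dD]; first exact: beta_rho.
  by have [x bx <-] := rho_surjective hn dD; rewrite beta_rho.
(* The order on rectangulations is read on these representatives, so both directions change words
   inside their classes. *)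
have tb_exists (z : 'S_n) : exists2 z' : 'S_n, twisted_baxter z' & rho R z' = rho R z.
  have [w' [ww' tb sb]] := tb_word_exists (oneline_word z).
  have [z' Ez] := word_oneline ww'; subst w'.
  by exists z'; [apply/twisted_baxterP|apply/rho_eqP].
split=> [/weak_leP xy|[x' [y' [tx ty /esym/(rho_eqP R _ _ hn) Ex /esym/(rho_eqP R _ _ hn) Ey /weak_leP xy]]]].
  have [x' tx /esym Ex] := tb_exists x; have [y' ty /esym Ey] := tb_exists y.
  exists x', y'; split=> //; apply/weak_leP.
  apply: (inv_sub_same_boxes_tb (oneline_word x) (oneline_word y)) xy; try exact: oneline_word.
  - exact/twisted_baxterP.
  - exact/(rho_eqP R).
  - exact/(rho_eqP R).
apply/weak_leP; apply: (inv_sub_same_boxes_baxter _ _ (oneline_word x') (oneline_word y')) xy => //;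
  try exact: oneline_word; exact/baxterP.
Qed.
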